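(* Fix $\beta\in[0,2)$ and $h=(2-\beta)\pi^2$. For a positive integer $N_t$ put $T=\sqrt{N_t h/4}$ and define, for $z\in\mathbb{C}$, $$r_t(z) = \frac{zh}{\pi} \sum_{j=1}^{N_t} \frac{1}{\sqrt{jh}} \cdot \frac{e^{\sqrt{jh}-\sqrt{N_t h/4}}}{e^{2\sqrt{jh}-2\sqrt{N_t h/4}} + z}.$$ Assume there is a constant $K$ such that for all sufficiently large $N_t$ and all $z = r e^{\pm i\beta\pi/2}$ with $r\in[e^{4+2\beta-2T},1]$, $$\left|\int_\Gamma f(u,z)\,\delta(u)\,du\right| \le K e^{-T},$$ where $f,\delta,\Gamma$ are as in the context. Then $$|r_t(z)-\sqrt{z}\,| = \mathcal{O}\big(e^{-\sqrt{N_t h/4}}\big) = \mathcal{O}\big(e^{-\pi\sqrt{(2-\beta)N_t/4}}\big)$$ as $N_t\to\infty$, uniformly for $z\in\{re^{i\beta\pi/2}: r\in[0,1]\}\cup\{re^{-i\beta\pi/2}: r\in[0,1]\}$.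
   Context: Here $\sqrt{\cdot}$ denotes the principal branch of the square root. For $u,z\in\mathbb{C}$, $f(u,z) = \frac{z}{\pi}\,\frac{1}{\sqrt{u}}\,\frac{e^{\sqrt{u}-T}}{e^{2(\sqrt{u}-T)}+z}$. The function $\delta(u)=\mu(u)-m(u)$, where $\mu(u)=-\tfrac12$ if $\operatorname{Im}u\ge 0$ and $\mu(u)=\tfrac12$ if $\operatorname{Im}u<0$, and $m(u) = -\tfrac{i}{2}\cot(\pi u/h)$. For $z=re^{\pm i\beta\pi/2}$, the contour $\Gamma$ is the positively oriented boundary of the rectangle $\{u: 1-\beta/2\le \operatorname{Re}u\le 4T^2+1-\beta/2,\ |\operatorname{Im}u|\le a\}$ with $a = 2\pi(T+\tfrac12\log r)$. *)

(* Defs.v *)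
From Stdlib Require Import Reals.
From Coquelicot Require Import Coquelicot.
Open Scope R_scope.

Definition Cexp (z : C) : C :=
  (exp (Re z) * cos (Im z), exp (Re z) * sin (Im z)).

(* principal branch of the square root (Re >= 0; on the negative real axis
   the value is i*sqrt|z|, i.e. arg in (-pi,pi]) *)
Definition Csqrt (z : C) : C :=
  (sqrt ((Cmod z + Re z) / 2),
   if Rle_dec 0 (Im z) then sqrt ((Cmod z - Re z) / 2)
   else - sqrt ((Cmod z - Re z) / 2)).

Definition Ccos (w : C) : C := ((Cexp (Ci * w) + Cexp (- (Ci * w))) / 2)%C.
Definition Csin (w : C) : C := ((Cexp (Ci * w) - Cexp (- (Ci * w))) / (2 * Ci))%C.
Definition Ccot (w : C) : C := (Ccos w / Csin w)%C.

Definition hh (beta : R) : R := (2 - beta) * PI ^ 2.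
Definition TT (beta : R) (Nt : nat) : R := sqrt (INR Nt * hh beta / 4).

Definition f_uz (beta : R) (Nt : nat) (u z : C) : C :=
  (z / RtoC PI * / Csqrt u * Cexp (Csqrt u - RtoC (TT beta Nt))
   / (Cexp (2 * (Csqrt u - RtoC (TT beta Nt))) + z))%C.

Definition mu (u : C) : C := if Rle_dec 0 (Im u) then RtoC (-1/2) else RtoC (1/2).
Definition m_cot (beta : R) (u : C) : C :=
  (- (Ci / 2) * Ccot (RtoC PI * u / RtoC (hh beta)))%C.
Definition delta (beta : R) (u : C) : C := (mu u - m_cot beta u)%C.

Definition seg_int (g : C -> C) (p q : C) : C :=
  @RInt C_R_CompleteNormedModule
    (fun t : R => (g (p + RtoC t * (q - p)) * (q - p))%C) 0 1.

Definition rect_int (g : C -> C) (x0 x1 a : R) : C :=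
  let p1 : C := (x0, - a) in let p2 : C := (x1, - a) in
  let p3 : C := (x1, a) in let p4 : C := (x0, a) in
  (seg_int g p1 p2 + seg_int g p2 p3 + seg_int g p3 p4 + seg_int g p4 p1)%C.

(* the contour Gamma for z = r e^{+- i beta pi/2}:
   1 - beta/2 <= Re u <= 4T^2 + 1 - beta/2, |Im u| <= 2 pi (T + log r / 2) *)
Definition Gamma_int (beta : R) (Nt : nat) (r : R) (g : C -> C) : C :=
  rect_int g (1 - beta / 2) (4 * TT beta Nt ^ 2 + 1 - beta / 2)
    (2 * PI * (TT beta Nt + ln r / 2)).

Fixpoint csum (F : nat -> C) (n : nat) : C :=
  match n with O => RtoC 0 | S k => (csum F k + F (S k))%C end.

Definition r_t (beta : R) (Nt : nat) (z : C) : C :=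
  (z * RtoC (hh beta) / RtoC PI *
   csum (fun j => RtoC (/ sqrt (INR j * hh beta)) *
          (RtoC (exp (sqrt (INR j * hh beta) - sqrt (INR Nt * hh beta / 4)))
           / (RtoC (exp (2 * sqrt (INR j * hh beta) - 2 * sqrt (INR Nt * hh beta / 4))) + z)))
     Nt)%C.

Definition ray_pt (beta : R) (s : bool) (r : R) : C :=
  (RtoC r * Cexp (((0, (if s then 1 else -1) * beta * PI / 2)%R) : C))%C.

(* Main.v *)
Require Import Defs.
From Stdlib Require Import Reals Lra Lia List ClassicalEpsilon ZArith FinFun.
From Coquelicot Require Import Coquelicot.
Open Scope R_scope.

(* The rational function r_t(z) is the quadrature sum [h * sum_j f(jh, z)] for
   the integral of [f(., z)] over the real segment from [1 - beta/2] to
   [4 T^2 + 1 - beta/2].  Inside Gamma the function [f] has two simple poles,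
   the squares of [T + log r / 2 + i q] with [q = +- pi/2 + arg z / 2].  The
   residue theorem, applied to [f m] on the rectangle and to [f] on its upper
   and lower halves, shows that the contour integral of [f delta] is the
   quadrature error plus [2 pi i] times the sum of [delta * residue of f] at
   these two poles.  The residues have modulus [sqrt r / pi] and [delta] is
   [O(exp (- T) / sqrt r)] there, because [h] is chosen such that
   [exp (2 pi i u / h)] has exactly this size.  The integral itself has the
   primitive [(2 sqrt z / pi) arctan (exp (sqrt u - T) / sqrt z)], which misses
   [sqrt z] by [O(exp (- T))].  For [r < exp (4 + 2 beta - 2 T)] both [r_t(z)]
   and [sqrt z] are [O(exp (- T))]. *)

(** * Complex differentiability *)

(** The factor [mu] jumps across the real axis, so the half rectangles must be closed along it; this
    closing is what produces the real integral. The numbers in the statement are all tied to the two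
    poles. The zeros of the denominator of [f] have square roots on one vertical line, with real
    part P = T + log r / 2 and heights q spaced by pi. At q = pi the imaginary part 2 P q equals a =
    2 pi P, so exactly two zeros fit into Gamma. The lower bound on r says P >= 2 + beta, which puts
    the real part P^2 - q^2 of the poles to the right of the left edge. That edge, 1 - beta/2 = h /
    (2 pi^2), lies between 0 and h, and since 4 T^2 = N_t h the right edge lies between N_t h and
    (N_t + 1) h: Gamma encloses exactly the nodes of the sum. For small r the primitive degenerates
    like 1 / sqrt r at the lower end; its prefactor sqrt z compensates this, at the price of powers
    of 1 / cos (beta pi / 4), which are finite because beta < 2. *)

Definition Ccont (g : C -> C) (p : C) : Prop :=
  forall eps, 0 < eps -> exists d, 0 < d /\
    forall u, Cmod (u - p) < d -> Cmod (g u - g p) < eps.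

(* Caratheodory's form of differentiability: it reduces the calculus rules to
   the continuity of sums, products and quotients. *)
Definition Cderiv (g : C -> C) (p l : C) : Prop :=
  exists phi d, 0 < d /\
    (forall u, Cmod (u - p) < d -> g u = (g p + phi u * (u - p))%C) /\
    phi p = l /\ Ccont phi p.

Definition Cdiff (g : C -> C) (p : C) : Prop := exists l, Cderiv g p l.

Lemma Cmod_minus_sym (a b : C) : Cmod (a - b) = Cmod (b - a).
Proof. rewrite <- (Cmod_opp (a - b)). f_equal. ring. Qed.

Lemma Cminus_diag (a : C) : (a - a)%C = RtoC 0.
Proof. ring. Qed.

Lemma Cmod_le_abs (a b : R) : Cmod (a, b) <= Rabs a + Rabs b.
Proof.
  unfold Cmod; simpl.
  pose proof (Rabs_pos a); pose proof (Rabs_pos b).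
  rewrite <- (sqrt_Rsqr (Rabs a + Rabs b)) by lra.
  apply sqrt_le_1_alt. unfold Rsqr.
  replace (a * (a * 1)) with (Rabs a * Rabs a)
    by (rewrite <- Rabs_mult, Rabs_pos_eq; nra).
  replace (b * (b * 1)) with (Rabs b * Rabs b)
    by (rewrite <- Rabs_mult, Rabs_pos_eq; nra).
  nra.
Qed.

Lemma Cmod_reverse (a b : C) : Cmod a - Cmod b <= Cmod (a - b).
Proof.
  pose proof (Cmod_triangle (a - b) b).
  replace (a - b + b)%C with a in H by ring. lra.
Qed.

Lemma im_le_Cmod (c : C) : Rabs (Im c) <= Cmod c.
Proof.
  eapply Rle_trans; [|apply Rmax_Cmod]. apply Rmax_r.
Qed.

Lemma Ccont_ext_loc (g k : C -> C) (p : C) (d : R) : 0 < d ->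
  (forall u, Cmod (u - p) < d -> g u = k u) -> Ccont g p -> Ccont k p.
Proof.
  intros Hd Heq Hg eps He. destruct (Hg eps He) as [d1 [Hd1 H1]].
  exists (Rmin d d1). split. { now apply Rmin_glb_lt. }
  intros u Hu. rewrite <- !Heq.
  - apply H1. eapply Rlt_le_trans; [exact Hu|apply Rmin_r].
  - rewrite Cminus_diag, Cmod_0. exact Hd.
  - eapply Rlt_le_trans; [exact Hu|apply Rmin_l].
Qed.

Lemma Ccont_const (c p : C) : Ccont (fun _ => c) p.
Proof.
  intros eps He. exists 1. split; [lra|]. intros u _.
  now rewrite Cminus_diag, Cmod_0.
Qed.

Lemma Ccont_id (p : C) : Ccont (fun u => u) p.
Proof. intros eps He. exists eps. auto. Qed.

Lemma Ccont_plus (g k : C -> C) (p : C) :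
  Ccont g p -> Ccont k p -> Ccont (fun u => g u + k u)%C p.
Proof.
  intros Hg Hk eps He.
  destruct (Hg (eps / 2)) as [d1 [Hd1 H1]]; [lra|].
  destruct (Hk (eps / 2)) as [d2 [Hd2 H2]]; [lra|].
  exists (Rmin d1 d2). split. { now apply Rmin_glb_lt. }
  intros u Hu.
  pose proof (H1 u (Rlt_le_trans _ _ _ Hu (Rmin_l _ _))).
  pose proof (H2 u (Rlt_le_trans _ _ _ Hu (Rmin_r _ _))).
  replace (g u + k u - (g p + k p))%C with ((g u - g p) + (k u - k p))%C by ring.
  eapply Rle_lt_trans; [apply Cmod_triangle|]. lra.
Qed.

Lemma Ccont_mult (g k : C -> C) (p : C) :
  Ccont g p -> Ccont k p -> Ccont (fun u => g u * k u)%C p.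
Proof.
  intros Hg Hk eps He.
  set (M := 1 + Cmod (g p) + Cmod (k p)).
  pose proof (Cmod_ge_0 (g p)). pose proof (Cmod_ge_0 (k p)).
  assert (HM : 1 <= M) by (unfold M; lra).
  (* The cap at 1 turns the product of the two increments into a linear term. *)
  set (e := Rmin 1 (eps / (2 * M))).
  assert (He0 : 0 < e).
  { apply Rmin_glb_lt; [lra|]. apply Rdiv_lt_0_compat; lra. }
  destruct (Hg e He0) as [d1 [Hd1 H1]].
  destruct (Hk e He0) as [d2 [Hd2 H2]].
  exists (Rmin d1 d2). split. { now apply Rmin_glb_lt. }
  intros u Hu.
  specialize (H1 u (Rlt_le_trans _ _ _ Hu (Rmin_l _ _))).
  specialize (H2 u (Rlt_le_trans _ _ _ Hu (Rmin_r _ _))).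
  replace (g u * k u - g p * k p)%C
    with ((g u - g p) * (k u - k p) + ((g u - g p) * k p + g p * (k u - k p)))%C by ring.
  assert (He1 : e <= 1) by apply Rmin_l.
  assert (He2 : e * (2 * M) <= eps).
  { apply Rle_trans with (eps / (2 * M) * (2 * M)).
    - apply Rmult_le_compat_r; [lra|apply Rmin_r].
    - right; field; lra. }
  eapply Rle_lt_trans; [apply Cmod_triangle|].
  eapply Rle_lt_trans;
    [apply Rplus_le_compat_l; apply Cmod_triangle|].
  rewrite !Cmod_mult.
  set (a := Cmod (g u - g p)) in *. set (b := Cmod (k u - k p)) in *.
  pose proof (Cmod_ge_0 (g u - g p)). pose proof (Cmod_ge_0 (k u - k p)).
  fold a in H3; fold b in H4.
  assert (a * b <= e * 1) by (apply Rmult_le_compat; lra).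
  assert (a * Cmod (k p) <= e * Cmod (k p)) by (apply Rmult_le_compat_r; lra).
  assert (Cmod (g p) * b <= Cmod (g p) * e) by (apply Rmult_le_compat_l; lra).
  assert (e * M <= eps / 2) by lra.
  unfold M in *. nra.
Qed.

Lemma Ccont_nonzero (g : C -> C) (p : C) : Ccont g p -> g p <> RtoC 0 ->
  exists d, 0 < d /\ forall u, Cmod (u - p) < d -> Cmod (g p) / 2 < Cmod (g u).
Proof.
  intros Hg H0. pose proof (proj1 (Cmod_gt_0 _) H0).
  destruct (Hg (Cmod (g p) / 2)) as [d [Hd H1]]; [lra|].
  exists d. split; [exact Hd|]. intros u Hu. specialize (H1 u Hu).
  rewrite Cmod_minus_sym in H1. pose proof (Cmod_reverse (g p) (g u)). lra.
Qed.

Lemma Ccont_inv (g : C -> C) (p : C) :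
  Ccont g p -> g p <> RtoC 0 -> Ccont (fun u => / g u)%C p.
Proof.
  intros Hg H0 eps He. pose proof (proj1 (Cmod_gt_0 _) H0) as Hm.
  destruct (Ccont_nonzero g p Hg H0) as [d1 [Hd1 H1]].
  set (m := Cmod (g p)) in *.
  destruct (Hg (eps * (m * m / 2))) as [d2 [Hd2 H2]]; [apply Rmult_lt_0_compat; nra|].
  exists (Rmin d1 d2). split. { now apply Rmin_glb_lt. }
  intros u Hu.
  specialize (H1 u (Rlt_le_trans _ _ _ Hu (Rmin_l _ _))).
  specialize (H2 u (Rlt_le_trans _ _ _ Hu (Rmin_r _ _))).
  assert (Hu0 : g u <> RtoC 0) by (apply Cmod_gt_0; lra).
  replace (/ g u - / g p)%C with ((g p - g u) / (g u * g p))%C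
    by (field; auto).
  rewrite Cmod_div by (now apply Cmult_neq_0).
  rewrite Cmod_mult. fold m. rewrite Cmod_minus_sym.
  apply Rmult_lt_reg_r with (Cmod (g u) * m); [nra|].
  unfold Rdiv. rewrite Rmult_assoc, Rinv_l by nra.
  rewrite Rmult_1_r. eapply Rlt_le_trans; [exact H2|].
  apply Rmult_le_compat_l; [lra|]. nra.
Qed.

Lemma Ccont_comp (g k : C -> C) (p : C) :
  Ccont k p -> Ccont g (k p) -> Ccont (fun u => g (k u)) p.
Proof.
  intros Hk Hg eps He. destruct (Hg eps He) as [d1 [Hd1 H1]].
  destruct (Hk d1 Hd1) as [d2 [Hd2 H2]]. exists d2. split; auto.
Qed.

Lemma Cderiv_cont (g : C -> C) (p l : C) : Cderiv g p l -> Ccont g p.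
Proof.
  intros [phi [d [Hd [H1 [_ H2]]]]].
  apply Ccont_ext_loc with (fun u => g p + phi u * (u + - p))%C d; [exact Hd| |].
  - intros u Hu. symmetry. apply H1, Hu.
  - apply Ccont_plus; [apply Ccont_const|]. apply Ccont_mult; [exact H2|].
    apply Ccont_plus; [apply Ccont_id|apply Ccont_const].
Qed.

Lemma Cdiff_cont (g : C -> C) (p : C) : Cdiff g p -> Ccont g p.
Proof. intros [l H]. eapply Cderiv_cont, H. Qed.

Lemma Cderiv_const (c p : C) : Cderiv (fun _ => c) p 0.
Proof.
  exists (fun _ => RtoC 0), 1. repeat split; [lra| |apply Ccont_const].
  intros. ring.
Qed.

Lemma Cderiv_id (p : C) : Cderiv (fun u => u) p 1.
Proof.
  exists (fun _ => RtoC 1), 1. repeat split; [lra| |apply Ccont_const].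
  intros. ring.
Qed.

Lemma Cderiv_plus (g k : C -> C) (p a b : C) :
  Cderiv g p a -> Cderiv k p b -> Cderiv (fun u => g u + k u)%C p (a + b).
Proof.
  intros [phi [d [Hd [H1 [H2 H3]]]]] [psi [e [He [H4 [H5 H6]]]]].
  exists (fun u => phi u + psi u)%C, (Rmin d e). repeat split.
  - now apply Rmin_glb_lt.
  - intros u Hu. rewrite H1, H4. ring.
    + eapply Rlt_le_trans; [exact Hu|apply Rmin_r].
    + eapply Rlt_le_trans; [exact Hu|apply Rmin_l].
  - now rewrite H2, H5.
  - now apply Ccont_plus.
Qed.

Lemma Cderiv_mult (g k : C -> C) (p a b : C) :
  Cderiv g p a -> Cderiv k p b ->
  Cderiv (fun u => g u * k u)%C p (a * k p + g p * b).
Proof.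
  intros Hg Hk. pose proof (Cderiv_cont _ _ _ Hk) as Hc. revert Hg Hk.
  intros [phi [d [Hd [H1 [H2 H3]]]]] [psi [e [He [H4 [H5 H6]]]]].
  exists (fun u => phi u * k u + g p * psi u)%C, (Rmin d e). repeat split.
  - now apply Rmin_glb_lt.
  - intros u Hu. rewrite H1, (H4 u). ring.
    + eapply Rlt_le_trans; [exact Hu|apply Rmin_r].
    + eapply Rlt_le_trans; [exact Hu|apply Rmin_l].
  - now rewrite H2, H5.
  - apply Ccont_plus; apply Ccont_mult; auto using Ccont_const.
Qed.

Lemma Cderiv_inv (g : C -> C) (p a : C) : g p <> RtoC 0 ->
  Cderiv g p a -> Cderiv (fun u => / g u)%C p (- a / (g p * g p)).
Proof.
  intros H0 Hg. pose proof (Cderiv_cont _ _ _ Hg) as Hc. revert Hg.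
  intros [phi [d [Hd [H1 [H2 H3]]]]].
  destruct (Ccont_nonzero g p Hc H0) as [e [He H4]].
  pose proof (proj1 (Cmod_gt_0 _) H0) as Hm.
  exists (fun u => (- RtoC 1) * phi u * (/ g u * / g p))%C, (Rmin d e). repeat split.
  - now apply Rmin_glb_lt.
  - intros u Hu.
    assert (Hu0 : g u <> RtoC 0).
    { apply Cmod_gt_0. pose proof (H4 u (Rlt_le_trans _ _ _ Hu (Rmin_r _ _))). lra. }
    assert (E : (phi u * (u - p))%C = (g u - g p)%C).
    { rewrite (H1 u). ring. eapply Rlt_le_trans; [exact Hu|apply Rmin_l]. }
    replace (- RtoC 1 * phi u * (/ g u * / g p) * (u - p))%C
      with (- (phi u * (u - p)) * (/ g u * / g p))%C by ring.
    rewrite E. field. auto.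
  - rewrite H2. field. auto.
  - apply Ccont_mult.
    + apply Ccont_mult; auto using Ccont_const.
    + apply Ccont_mult; auto using Ccont_const, Ccont_inv.
Qed.

Lemma Cderiv_comp (g k : C -> C) (p a b : C) :
  Cderiv k p a -> Cderiv g (k p) b -> Cderiv (fun u => g (k u)) p (b * a).
Proof.
  intros Hk Hg. pose proof (Cderiv_cont _ _ _ Hk) as Hc. revert Hg Hk.
  intros [phi [d [Hd [H1 [H2 H3]]]]] [psi [e [He [H4 [H5 H6]]]]].
  destruct (Hc d Hd) as [d1 [Hd1 H7]].
  exists (fun u => phi (k u) * psi u)%C, (Rmin d1 e). repeat split.
  - now apply Rmin_glb_lt.
  - intros u Hu. rewrite H1.
    + rewrite (H4 u) at 2. ring.
      eapply Rlt_le_trans; [exact Hu|apply Rmin_r].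
    + apply H7. eapply Rlt_le_trans; [exact Hu|apply Rmin_l].
  - now rewrite H2, H5.
  - apply Ccont_mult; auto. now apply Ccont_comp.
Qed.

Lemma Cderiv_eq (g : C -> C) (p a b : C) : a = b -> Cderiv g p a -> Cderiv g p b.
Proof. now intros ->. Qed.

(** The Caratheodory factor is the difference quotient, completed by [l] at [p]. The [eps] form is
    free of division and is the one that estimates deliver. *)
Lemma Cderiv_of_eps (g : C -> C) (p l : C) :
  (forall eps, 0 < eps -> exists d, 0 < d /\ forall u, Cmod (u - p) < d ->
     Cmod (g u - g p - l * (u - p)) <= eps * Cmod (u - p)) ->
  Cderiv g p l.
Proof.
  intros H.
  exists (fun u => if excluded_middle_informative (u = p) then l
                   else ((g u - g p) / (u - p))%C), 1.
  assert (Hne : forall u, u <> p -> (u - p)%C <> RtoC 0).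
  { intros u Hu E. apply Hu. replace u with (u - p + p)%C by ring. rewrite E. ring. }
  repeat split.
  - lra.
  - intros u _. destruct (excluded_middle_informative (u = p)) as [->|Hu]; [ring|].
    field. now apply Hne.
  - destruct (excluded_middle_informative (p = p)); congruence.
  - intros eps He. destruct (H (eps / 2)) as [d [Hd H1]]; [lra|].
    exists d. split; [exact Hd|]. intros u Hu.
    destruct (excluded_middle_informative (p = p)); [|congruence].
    destruct (excluded_middle_informative (u = p)) as [->|Hn].
    + now rewrite Cminus_diag, Cmod_0.
    + specialize (H1 u Hu). apply Hne in Hn.
      replace ((g u - g p) / (u - p) - l)%C
        with ((g u - g p - l * (u - p)) / (u - p))%C by (field; auto).
      rewrite Cmod_div by auto. pose proof (proj1 (Cmod_gt_0 _) Hn).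
      apply Rmult_lt_reg_r with (Cmod (u - p)); [auto|].
      unfold Rdiv. rewrite Rmult_assoc, Rinv_l by lra. nra.
Qed.

Lemma Cderiv_eps (g : C -> C) (p l : C) : Cderiv g p l ->
  forall eps, 0 < eps -> exists d, 0 < d /\ forall u, Cmod (u - p) < d ->
     Cmod (g u - g p - l * (u - p)) <= eps * Cmod (u - p).
Proof.
  intros [phi [d [Hd [H1 [H2 H3]]]]] eps He.
  destruct (H3 eps He) as [e [He' H4]].
  exists (Rmin d e). split. { now apply Rmin_glb_lt. }
  intros u Hu.
  specialize (H4 u (Rlt_le_trans _ _ _ Hu (Rmin_r _ _))).
  rewrite H1 by (eapply Rlt_le_trans; [exact Hu|apply Rmin_l]).
  rewrite H2 in H4.
  replace (g p + phi u * (u - p) - g p - l * (u - p))%C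
    with ((phi u - l) * (u - p))%C by ring.
  rewrite Cmod_mult. apply Rmult_le_compat_r; [apply Cmod_ge_0|lra].
Qed.

Lemma Cderiv_scal (c : C) (g : C -> C) (p l : C) :
  Cderiv g p l -> Cderiv (fun u => c * g u)%C p (c * l).
Proof.
  intros H. eapply Cderiv_eq; [|apply Cderiv_mult; [apply Cderiv_const|exact H]].
  cbv beta. ring.
Qed.

(** * The complex exponential *)

Lemma Cexp_plus (a b : C) : Cexp (a + b) = (Cexp a * Cexp b)%C.
Proof.
  destruct a as [a1 a2], b as [b1 b2]. unfold Cexp, Cmult, Cplus; simpl.
  rewrite exp_plus, cos_plus, sin_plus. f_equal; ring.
Qed.

Lemma Cexp_0 : Cexp 0 = RtoC 1.
Proof. unfold Cexp; simpl. now rewrite exp_0, cos_0, sin_0, !Rmult_1_l. Qed.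

Lemma Cmod_Cexp (a : C) : Cmod (Cexp a) = exp (Re a).
Proof.
  unfold Cmod, Cexp; simpl. transitivity (sqrt (Rsqr (exp (Re a)))).
  - f_equal. transitivity (Rsqr (exp (Re a)) * (Rsqr (sin (Im a)) + Rsqr (cos (Im a)))).
    + unfold Rsqr, Re, Im. ring.
    + rewrite sin2_cos2. ring.
  - apply sqrt_Rsqr. left; apply exp_pos.
Qed.

Lemma Cexp_neq_0 (a : C) : Cexp a <> RtoC 0.
Proof. apply Cmod_gt_0. rewrite Cmod_Cexp. apply exp_pos. Qed.

Lemma derivable_pt_lim_at_0 (f : R -> R) (l : R) : derivable_pt_lim f 0 l ->
  forall eps, 0 < eps -> exists d, 0 < d /\ forall x, Rabs x < d ->
    Rabs (f x - f 0 - l * x) <= eps * Rabs x.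
Proof.
  intros H eps He. destruct (H eps He) as [d Hd]. exists d. split; [apply cond_pos|].
  intros x Hx. destruct (Req_dec x 0) as [->|H0].
  - rewrite Rabs_R0. replace (f 0 - f 0 - l * 0) with 0 by ring. rewrite Rabs_R0; lra.
  - specialize (Hd x H0 Hx). rewrite Rplus_0_l in Hd.
    replace (f x - f 0 - l * x) with (((f x - f 0) / x - l) * x) by (now field).
    rewrite Rabs_mult. apply Rmult_le_compat_r; [apply Rabs_pos|lra].
Qed.

Lemma Cexp_deriv_0 : Cderiv Cexp 0 1.
Proof.
  apply Cderiv_of_eps. intros eps He.
  (* The two coordinates of the remainder cost at most 3 and 4 times [e * M], within the budget of
     8; the cap 1/4 gives [exp a <= 2]. *)
  set (e := Rmin (1 / 4) (eps / 8)).
  assert (H0e : 0 < e) by (apply Rmin_glb_lt; lra).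
  assert (He1 : e <= 1 / 4) by apply Rmin_l.
  assert (He2 : e <= eps / 8) by apply Rmin_r.
  destruct (derivable_pt_lim_at_0 exp 1) with e as [d1 [Hd1 H1]]; auto.
  { pose proof (derivable_pt_lim_exp 0) as H. now rewrite exp_0 in H. }
  destruct (derivable_pt_lim_at_0 cos 0) with e as [d2 [Hd2 H2]]; auto.
  { pose proof (derivable_pt_lim_cos 0) as H. now rewrite sin_0, Ropp_0 in H. }
  destruct (derivable_pt_lim_at_0 sin 1) with e as [d3 [Hd3 H3]]; auto.
  { pose proof (derivable_pt_lim_sin 0) as H. now rewrite cos_0 in H. }
  exists (Rmin (Rmin d1 d2) (Rmin d3 e)). split.
  { apply Rmin_glb_lt; apply Rmin_glb_lt; assumption. }
  intros [a b]. rewrite Cexp_0.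
  replace ((a, b) - 0)%C with (a, b) by (unfold Cminus, Cplus, Copp; simpl; f_equal; ring).
  intros Hu.
  assert (Ha : Rabs a <= Cmod (a, b)) by apply (re_le_Cmod (a, b)).
  assert (Hb : Rabs b <= Cmod (a, b)) by apply (im_le_Cmod (a, b)).
  set (M := Cmod (a, b)) in *.
  assert (Hm1 : M < d1) by (eapply Rlt_le_trans; [exact Hu|]; eapply Rle_trans; apply Rmin_l).
  assert (Hm2 : M < d2)
    by (eapply Rlt_le_trans; [exact Hu|]; eapply Rle_trans; [apply Rmin_l|apply Rmin_r]).
  assert (Hm3 : M < d3)
    by (eapply Rlt_le_trans; [exact Hu|]; eapply Rle_trans; [apply Rmin_r|apply Rmin_l]).
  assert (Hm4 : M < e)
    by (eapply Rlt_le_trans; [exact Hu|]; eapply Rle_trans; apply Rmin_r).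
  specialize (H1 a ltac:(lra)). specialize (H2 b ltac:(lra)). specialize (H3 b ltac:(lra)).
  rewrite exp_0 in H1. rewrite cos_0 in H2. rewrite sin_0 in H3.
  set (r1 := exp a - 1 - 1 * a) in *. set (r2 := cos b - 1 - 0 * b) in *.
  set (r3 := sin b - 0 - 1 * b) in *.
  (* The complex remainder is expressed through the first-order remainders of the real [exp], [cos]
     and [sin]. *)
  replace (Cexp (a, b) - 1 - 1 * (a, b))%C
    with (exp a * r2 + r1, exp a * r3 + (r1 + a) * b)
    by (unfold r1, r2, r3, Cexp, Cminus, Cmult, Cplus, Copp; simpl; f_equal; ring).
  eapply Rle_trans; [apply Cmod_le_abs|].
  assert (HM : 0 <= M) by apply Cmod_ge_0.
  assert (Hr1 : Rabs r1 <= e * M) by (eapply Rle_trans; [exact H1|]; apply Rmult_le_compat_l; lra).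
  assert (Hr2 : Rabs r2 <= e * M) by (eapply Rle_trans; [exact H2|]; apply Rmult_le_compat_l; lra).
  assert (Hr3 : Rabs r3 <= e * M) by (eapply Rle_trans; [exact H3|]; apply Rmult_le_compat_l; lra).
  assert (Hexp : Rabs (exp a) <= 2).
  { replace (exp a) with (1 + a + r1) by (unfold r1; ring).
    eapply Rle_trans; [apply Rabs_triang|].
    eapply Rle_trans; [apply Rplus_le_compat_r, Rabs_triang|].
    rewrite Rabs_R1. nra. }
  assert (Rabs (exp a * r2 + r1) <= 3 * (e * M)).
  { eapply Rle_trans; [apply Rabs_triang|]. rewrite Rabs_mult.
    pose proof (Rabs_pos r2). nra. }
  assert (Rabs (exp a * r3 + (r1 + a) * b) <= 4 * (e * M)).
  { eapply Rle_trans; [apply Rabs_triang|]. rewrite !Rabs_mult.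
    pose proof (Rabs_pos r3). pose proof (Rabs_pos b).
    assert (Rabs (r1 + a) <= 2 * e).
    { eapply Rle_trans; [apply Rabs_triang|]. nra. }
    pose proof (Rabs_pos (r1 + a)).
    assert (Rabs (r1 + a) * Rabs b <= 2 * e * M) by (apply Rmult_le_compat; lra).
    nra. }
  assert (8 * e * M <= eps * M) by (apply Rmult_le_compat_r; lra).
  nra.
Qed.

(** The functional equation moves the derivative at 0 to [p]. *)
Lemma Cexp_deriv (p : C) : Cderiv Cexp p (Cexp p).
Proof.
  assert (H : Cderiv (fun u => Cexp p * Cexp (u + - p))%C p (Cexp p * (1 * (1 + 0)))).
  { apply Cderiv_scal. apply Cderiv_comp.
    - apply Cderiv_plus; [apply Cderiv_id|apply Cderiv_const].
    - replace (p + - p)%C with (RtoC 0) by ring. apply Cexp_deriv_0. }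
  destruct H as [phi [d [Hd [H1 [H2 H3]]]]].
  exists phi, d. repeat split; auto.
  - intros u Hu. specialize (H1 u Hu). rewrite <- !Cexp_plus in H1.
    replace (p + (u + - p))%C with u in H1 by ring.
    replace (p + (p + - p))%C with p in H1 by ring. exact H1.
  - rewrite H2. ring.
Qed.

(** * The principal square root on the right half plane *)

Lemma Csqrt_sqr (p q : R) : 0 < p -> Csqrt ((p, q) * (p, q)) = (p, q).
Proof.
  intros Hp. unfold Csqrt.
  assert (E : Cmod ((p, q) * (p, q)) = p * p + q * q).
  { rewrite Cmod_mult. unfold Cmod; simpl. rewrite sqrt_sqrt; nra. }
  rewrite E. unfold Cmult; simpl.
  replace ((p * p + q * q + (p * p - q * q)) / 2) with (p * p) by field.
  replace ((p * p + q * q - (p * p - q * q)) / 2) with (q * q) by field.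
  rewrite sqrt_square by lra. f_equal.
  destruct (Rle_dec 0 (p * q + q * p)).
  - apply sqrt_square. nra.
  - replace (q * q) with ((- q) * (- q)) by ring. rewrite sqrt_square by nra. ring.
Qed.

Lemma Csqrt_spec (u : C) : 0 < Re u ->
  0 < Re (Csqrt u) /\ (Csqrt u * Csqrt u)%C = u.
Proof.
  intros Hu. pose proof (re_le_Cmod u). rewrite Rabs_pos_eq in H by lra.
  assert (H1 : 0 < sqrt ((Cmod u + Re u) / 2)) by (apply sqrt_lt_R0; lra).
  split; [exact H1|].
  assert (H2 : sqrt ((Cmod u + Re u) / 2) * sqrt ((Cmod u + Re u) / 2) = (Cmod u + Re u) / 2)
    by (apply sqrt_sqrt; lra).
  assert (H3 : sqrt ((Cmod u - Re u) / 2) * sqrt ((Cmod u - Re u) / 2) = (Cmod u - Re u) / 2)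
    by (apply sqrt_sqrt; lra).
  assert (H4 : 2 * (sqrt ((Cmod u + Re u) / 2) * sqrt ((Cmod u - Re u) / 2)) = Rabs (Im u)).
  { rewrite <- sqrt_mult by lra.
    replace ((Cmod u + Re u) / 2 * ((Cmod u - Re u) / 2))
      with ((Im u / 2) * (Im u / 2)).
    - replace (Im u / 2 * (Im u / 2)) with (Rsqr (Im u / 2)) by reflexivity.
      rewrite sqrt_Rsqr_abs. unfold Rdiv. rewrite Rabs_mult, (Rabs_pos_eq (/ 2)) by lra. field.
    - pose proof (Cmod2_alt u). nra. }
  destruct u as [x y]. simpl in *. unfold Csqrt, Cmult; simpl.
  destruct (Rle_dec 0 y).
  - rewrite Rabs_pos_eq in H4 by lra. f_equal; lra.
  - rewrite Rabs_left in H4 by lra. f_equal; nra.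
Qed.

Lemma Csqrt_neq_0 (u : C) : 0 < Re u -> Csqrt u <> RtoC 0.
Proof.
  intros Hu E. destruct (Csqrt_spec u Hu) as [H _]. rewrite E in H. simpl in H. lra.
Qed.

Lemma RtoC_neq_0 (x : R) : x <> 0 -> RtoC x <> RtoC 0.
Proof. intros H E. apply H. now injection E. Qed.

Lemma Csqrt_sum_pos (u p : C) : 0 < Re u -> 0 < Re p ->
  Re (Csqrt p) <= Cmod (Csqrt u + Csqrt p) /\ (Csqrt u + Csqrt p)%C <> RtoC 0.
Proof.
  intros Hu Hp. destruct (Csqrt_spec u Hu) as [H1 _]. destruct (Csqrt_spec p Hp) as [H2 _].
  assert (H : Re (Csqrt p) <= Cmod (Csqrt u + Csqrt p)).
  { eapply Rle_trans; [|apply re_le_Cmod].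
    replace (Re (Csqrt u + Csqrt p)) with (Re (Csqrt u) + Re (Csqrt p)) by reflexivity.
    rewrite Rabs_pos_eq; lra. }
  split; [exact H|]. apply Cmod_gt_0. lra.
Qed.

Lemma Re_near (u p : C) : Cmod (u - p) < Re p -> 0 < Re u.
Proof.
  intros H. pose proof (re_le_Cmod (u - p)).
  replace (Re (u - p)) with (Re u - Re p) in H0 by (destruct u, p; reflexivity).
  pose proof (Rle_abs (- (Re u - Re p))). rewrite Rabs_Ropp in H1. lra.
Qed.

(** Both roots lie in the right half plane, so their sum does not vanish. The identity yields
    continuity of the root and, with [1 / (Csqrt u + Csqrt p)], its Caratheodory factor. *)
Lemma Csqrt_diff_eq (u p : C) : 0 < Re u -> 0 < Re p ->
  (Csqrt u - Csqrt p)%C = ((u - p) / (Csqrt u + Csqrt p))%C.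
Proof.
  intros Hu Hp. destruct (Csqrt_sum_pos u p Hu Hp) as [_ H0].
  destruct (Csqrt_spec u Hu) as [_ H1]. destruct (Csqrt_spec p Hp) as [_ H2].
  rewrite <- H1 at 2. rewrite <- H2 at 2. field. exact H0.
Qed.

Lemma Csqrt_cont (p : C) : 0 < Re p -> Ccont Csqrt p.
Proof.
  intros Hp eps He. destruct (Csqrt_spec p Hp) as [Hs _].
  exists (Rmin (Re p) (eps * Re (Csqrt p))). split.
  { apply Rmin_glb_lt; nra. }
  intros u Hu.
  assert (Hu0 : 0 < Re u).
  { apply (Re_near u p). eapply Rlt_le_trans; [exact Hu|apply Rmin_l]. }
  rewrite Csqrt_diff_eq by auto. destruct (Csqrt_sum_pos u p Hu0 Hp) as [H1 H2].
  rewrite Cmod_div by exact H2.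
  apply Rmult_lt_reg_r with (Cmod (Csqrt u + Csqrt p)); [lra|].
  unfold Rdiv. rewrite Rmult_assoc, Rinv_l by lra. rewrite Rmult_1_r.
  eapply Rlt_le_trans; [exact Hu|]. eapply Rle_trans; [apply Rmin_r|].
  apply Rmult_le_compat_l; lra.
Qed.

Lemma Csqrt_deriv (p : C) : 0 < Re p -> Cderiv Csqrt p (/ (2 * Csqrt p)).
Proof.
  intros Hp.
  exists (fun u => / (Csqrt u + Csqrt p))%C, (Re p). repeat split.
  - exact Hp.
  - intros u Hu. assert (Hu0 : 0 < Re u) by (now apply (Re_near u p)).
    replace (/ (Csqrt u + Csqrt p) * (u - p))%C with ((u - p) / (Csqrt u + Csqrt p))%C
      by (unfold Cdiv; ring).
    rewrite <- Csqrt_diff_eq by auto. ring.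
  - f_equal. ring.
  - apply Ccont_inv.
    + apply Ccont_plus; [now apply Csqrt_cont|apply Ccont_const].
    + now apply Csqrt_sum_pos.
Qed.

(** * Integrals along horizontal and vertical segments *)

(** Integration by coordinates makes the real theorems on [RInt] applicable; [seg_int_h] and
    [seg_int_v] connect it with the complex integrals inside [rect_int]. *)
Definition CInt (g : R -> C) (a b : R) : C :=
  (RInt (fun t => Re (g t)) a b, RInt (fun t => Im (g t)) a b).

Definition ex_CInt (g : R -> C) (a b : R) : Prop :=
  ex_RInt (fun t => Re (g t)) a b /\ ex_RInt (fun t => Im (g t)) a b.

Lemma CInt_ext (g k : R -> C) (a b : R) : a <= b ->
  (forall t, a < t < b -> g t = k t) -> CInt g a b = CInt k a b.
Proof.
  intros Hab H. unfold CInt. f_equal; apply RInt_ext; intros t Ht;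
    rewrite Rmin_left, Rmax_right in Ht by lra; now rewrite H.
Qed.

Lemma CInt_Chasles (g : R -> C) (a b c : R) : ex_CInt g a b -> ex_CInt g b c ->
  (CInt g a b + CInt g b c)%C = CInt g a c.
Proof.
  intros [H1 H2] [H3 H4]. unfold CInt, Cplus; simpl.
  f_equal; now apply (RInt_Chasles (V := R_CompleteNormedModule)).
Qed.

Lemma ex_CInt_plus (g k : R -> C) (a b : R) : ex_CInt g a b -> ex_CInt k a b ->
  ex_CInt (fun t => g t + k t)%C a b.
Proof.
  intros [H1 H2] [H3 H4].
  split; [now apply (ex_RInt_plus (V := R_NormedModule)) with (1 := H1) (2 := H3)
         |now apply (ex_RInt_plus (V := R_NormedModule)) with (1 := H2) (2 := H4)].
Qed.

Lemma CInt_plus (g k : R -> C) (a b : R) : ex_CInt g a b -> ex_CInt k a b ->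
  CInt (fun t => g t + k t)%C a b = (CInt g a b + CInt k a b)%C.
Proof.
  intros [H1 H2] [H3 H4]. unfold CInt, Cplus; simpl. f_equal.
  - exact (RInt_plus (V := R_CompleteNormedModule) _ _ a b H1 H3).
  - exact (RInt_plus (V := R_CompleteNormedModule) _ _ a b H2 H4).
Qed.

Lemma CInt_scal (c : C) (g : R -> C) (a b : R) : ex_CInt g a b ->
  CInt (fun t => c * g t)%C a b = (c * CInt g a b)%C.
Proof.
  intros [H1 H2]. destruct c as [c1 c2]. unfold CInt, Cmult; simpl.
  pose proof (RInt_correct (V := R_CompleteNormedModule) _ _ _ H1) as I1.
  pose proof (RInt_correct (V := R_CompleteNormedModule) _ _ _ H2) as I2.
  f_equal; apply is_RInt_unique.
  - apply (is_RInt_minus (V := R_NormedModule));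
      apply (is_RInt_scal (V := R_NormedModule)); assumption.
  - apply (is_RInt_plus (V := R_NormedModule));
      apply (is_RInt_scal (V := R_NormedModule)); assumption.
Qed.

(** The crude factor 2 comes from adding the bounds of the two coordinates. It is harmless, since
    the estimate only serves to show that integrals vanish. *)
Lemma CInt_bound (g : R -> C) (a b M : R) : a <= b -> ex_CInt g a b ->
  (forall t, a <= t <= b -> Cmod (g t) <= M) ->
  Cmod (CInt g a b) <= 2 * ((b - a) * M).
Proof.
  intros Hab [H1 H2] HM. unfold CInt.
  eapply Rle_trans; [apply Cmod_le_abs|].
  assert (Rabs (RInt (fun t => Re (g t)) a b) <= (b - a) * M).
  { apply abs_RInt_le_const; auto. intros t Ht.
    eapply Rle_trans; [apply re_le_Cmod|auto]. }
  assert (Rabs (RInt (fun t => Im (g t)) a b) <= (b - a) * M).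
  { apply abs_RInt_le_const; auto. intros t Ht.
    eapply Rle_trans; [apply im_le_Cmod|auto]. }
  lra.
Qed.

Lemma continuous_of_eps (f : R -> R) (t : R) :
  (forall eps, 0 < eps -> exists d, 0 < d /\
     forall s, Rabs (s - t) < d -> Rabs (f s - f t) < eps) -> continuous f t.
Proof.
  intros H. apply (proj1 (continuity_pt_filterlim f t)).
  intros eps He. destruct (H eps He) as [d [Hd H1]]. exists d. split; [exact Hd|].
  intros s [_ Hs]. apply H1, Hs.
Qed.

Lemma Ccont_comp_lip (g : C -> C) (path : R -> C) (t : R) :
  (forall s, Cmod (path s - path t) <= Rabs (s - t)) -> Ccont g (path t) ->
  continuous (fun s => Re (g (path s))) t /\ continuous (fun s => Im (g (path s))) t.
Proof.
  intros Hl Hg.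
  split; apply continuous_of_eps; intros eps He;
    destruct (Hg eps He) as [d [Hd H1]]; exists d; (split; [exact Hd|]);
    intros s Hs; (eapply Rle_lt_trans; [|apply (H1 (path s)); specialize (Hl s); lra]).
  - exact (re_le_Cmod (g (path s) - g (path t))).
  - exact (im_le_Cmod (g (path s) - g (path t))).
Qed.

Lemma hpath_lip (y t s : R) : Cmod ((s, y) - (t, y)) <= Rabs (s - t).
Proof.
  unfold Cminus, Cplus, Copp; simpl. eapply Rle_trans; [apply Cmod_le_abs|].
  replace (y + - y) with 0 by ring. rewrite Rabs_R0. unfold Rminus. lra.
Qed.

Lemma vpath_lip (x t s : R) : Cmod ((x, s) - (x, t)) <= Rabs (s - t).
Proof.
  unfold Cminus, Cplus, Copp; simpl. eapply Rle_trans; [apply Cmod_le_abs|].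
  replace (x + - x) with 0 by ring. rewrite Rabs_R0. unfold Rminus. lra.
Qed.

Lemma ex_CInt_continuous (g : R -> C) (a b : R) : a <= b ->
  (forall t, a <= t <= b ->
     continuous (fun s => Re (g s)) t /\ continuous (fun s => Im (g s)) t) ->
  ex_CInt g a b.
Proof.
  intros Hab H. split; apply (ex_RInt_continuous (V := R_CompleteNormedModule));
    intros t Ht; rewrite Rmin_left, Rmax_right in Ht by lra; now apply H.
Qed.

Lemma ex_CInt_h (g : C -> C) (y a b : R) : a <= b ->
  (forall x, a <= x <= b -> Ccont g (x, y)) -> ex_CInt (fun x => g (x, y)) a b.
Proof.
  intros Hab H. apply ex_CInt_continuous; [exact Hab|]. intros t Ht.
  apply (Ccont_comp_lip g (fun x => (x, y))); auto. intros s. apply hpath_lip.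
Qed.

Lemma ex_CInt_v (g : C -> C) (x a b : R) : a <= b ->
  (forall y, a <= y <= b -> Ccont g (x, y)) -> ex_CInt (fun y => g (x, y)) a b.
Proof.
  intros Hab H. apply ex_CInt_continuous; [exact Hab|]. intros t Ht.
  apply (Ccont_comp_lip g (fun y => (x, y))); auto. intros s. apply vpath_lip.
Qed.

Lemma CInt_derive (F g : R -> C) (a b : R) : a <= b ->
  (forall t, a <= t <= b ->
     is_derive (fun s => Re (F s)) t (Re (g t)) /\
     is_derive (fun s => Im (F s)) t (Im (g t)) /\
     continuous (fun s => Re (g s)) t /\ continuous (fun s => Im (g s)) t) ->
  CInt g a b = (F b - F a)%C.
Proof.
  intros Hab H. unfold CInt, Cminus, Cplus, Copp; simpl. f_equal; apply is_RInt_unique.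
  - apply (is_RInt_derive (V := R_CompleteNormedModule) (fun s => Re (F s)));
      intros t Ht; rewrite Rmin_left, Rmax_right in Ht by lra; now apply H.
  - apply (is_RInt_derive (V := R_CompleteNormedModule) (fun s => Im (F s)));
      intros t Ht; rewrite Rmin_left, Rmax_right in Ht by lra; now apply H.
Qed.

(** * Cauchy's theorem on rectangles *)

Definition in_rect (x0 x1 y0 y1 : R) (u : C) : Prop :=
  x0 <= Re u <= x1 /\ y0 <= Im u <= y1.

Definition on_edge (x0 x1 y0 y1 : R) (u : C) : Prop :=
  in_rect x0 x1 y0 y1 u /\ (Re u = x0 \/ Re u = x1 \/ Im u = y0 \/ Im u = y1).

Definition oint (g : C -> C) (x0 x1 y0 y1 : R) : C :=
  (CInt (fun x => g (x, y0)) x0 x1 + Ci * CInt (fun y => g (x1, y)) y0 y1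
   - CInt (fun x => g (x, y1)) x0 x1 - Ci * CInt (fun y => g (x0, y)) y0 y1)%C.

Section Rectangle.
Variables x0 x1 y0 y1 : R.
Hypotheses (Hx : x0 <= x1) (Hy : y0 <= y1).

Lemma ex_CInt_edges (g : C -> C) :
  (forall u, on_edge x0 x1 y0 y1 u -> Ccont g u) ->
  ex_CInt (fun x => g (x, y0)) x0 x1 /\ ex_CInt (fun x => g (x, y1)) x0 x1 /\
  ex_CInt (fun y => g (x0, y)) y0 y1 /\ ex_CInt (fun y => g (x1, y)) y0 y1.
Proof.
  intros H. split; [|split; [|split]].
  1, 2: apply ex_CInt_h; [exact Hx|].
  3, 4: apply ex_CInt_v; [exact Hy|].
  all: intros t Ht; apply H; unfold on_edge, in_rect; simpl; lra.
Qed.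

Lemma oint_plus (g k : C -> C) :
  (forall u, on_edge x0 x1 y0 y1 u -> Ccont g u) ->
  (forall u, on_edge x0 x1 y0 y1 u -> Ccont k u) ->
  oint (fun u => g u + k u)%C x0 x1 y0 y1
    = (oint g x0 x1 y0 y1 + oint k x0 x1 y0 y1)%C.
Proof.
  intros Hg Hk. apply ex_CInt_edges in Hg. apply ex_CInt_edges in Hk.
  unfold oint. rewrite !CInt_plus by tauto. ring.
Qed.

Lemma oint_scal (c : C) (g : C -> C) :
  (forall u, on_edge x0 x1 y0 y1 u -> Ccont g u) ->
  oint (fun u => c * g u)%C x0 x1 y0 y1 = (c * oint g x0 x1 y0 y1)%C.
Proof.
  intros Hg. apply ex_CInt_edges in Hg.
  unfold oint. rewrite !CInt_scal by tauto. ring.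
Qed.

Lemma oint_ext (g k : C -> C) :
  (forall u, on_edge x0 x1 y0 y1 u -> g u = k u) ->
  oint g x0 x1 y0 y1 = oint k x0 x1 y0 y1.
Proof.
  intros H. unfold oint.
  rewrite (CInt_ext (fun x => g (x, y0)) (fun x => k (x, y0))),
    (CInt_ext (fun x => g (x, y1)) (fun x => k (x, y1))),
    (CInt_ext (fun y => g (x0, y)) (fun y => k (x0, y))),
    (CInt_ext (fun y => g (x1, y)) (fun y => k (x1, y))); auto;
    intros t Ht; apply H; unfold on_edge, in_rect; simpl; lra.
Qed.

Lemma oint_bound (g : C -> C) (M : R) :
  (forall u, on_edge x0 x1 y0 y1 u -> Ccont g u) ->
  (forall u, on_edge x0 x1 y0 y1 u -> Cmod (g u) <= M) ->
  Cmod (oint g x0 x1 y0 y1) <= 4 * ((x1 - x0) + (y1 - y0)) * M.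
Proof.
  intros Hg HM. apply ex_CInt_edges in Hg. destruct Hg as [H1 [H2 [H3 H4]]].
  assert (B1 := CInt_bound _ _ _ M Hx H1). assert (B2 := CInt_bound _ _ _ M Hx H2).
  assert (B3 := CInt_bound _ _ _ M Hy H3). assert (B4 := CInt_bound _ _ _ M Hy H4).
  assert (HE : forall t, (x0 <= t <= x1 -> Cmod (g (t, y0)) <= M /\ Cmod (g (t, y1)) <= M) /\
                         (y0 <= t <= y1 -> Cmod (g (x0, t)) <= M /\ Cmod (g (x1, t)) <= M)).
  { intros t. split; intros Ht; split; apply HM; unfold on_edge, in_rect; simpl; lra. }
  specialize (B1 (fun t Ht => proj1 (proj1 (HE t) Ht))).
  specialize (B2 (fun t Ht => proj2 (proj1 (HE t) Ht))).
  specialize (B3 (fun t Ht => proj1 (proj2 (HE t) Ht))).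
  specialize (B4 (fun t Ht => proj2 (proj2 (HE t) Ht))).
  unfold oint, Cminus.
  eapply Rle_trans; [apply Cmod_triangle|].
  eapply Rle_trans; [apply Rplus_le_compat_r, Cmod_triangle|].
  eapply Rle_trans; [apply Rplus_le_compat_r, Rplus_le_compat_r, Cmod_triangle|].
  rewrite !Cmod_opp, !Cmod_mult, !Cmod_Ci. lra.
Qed.

Lemma oint_split_x (g : C -> C) (xm : R) : x0 <= xm <= x1 ->
  (forall u, on_edge x0 x1 y0 y1 u -> Ccont g u) ->
  oint g x0 x1 y0 y1 = (oint g x0 xm y0 y1 + oint g xm x1 y0 y1)%C.
Proof.
  intros Hm Hg. unfold oint.
  rewrite <- (CInt_Chasles (fun x => g (x, y0)) x0 xm x1),
    <- (CInt_Chasles (fun x => g (x, y1)) x0 xm x1); [ring| | | |];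
    apply ex_CInt_h; try lra; intros t Ht; apply Hg;
    unfold on_edge, in_rect; simpl; lra.
Qed.

Lemma oint_split_y (g : C -> C) (ym : R) : y0 <= ym <= y1 ->
  (forall u, on_edge x0 x1 y0 y1 u -> Ccont g u) ->
  oint g x0 x1 y0 y1 = (oint g x0 x1 y0 ym + oint g x0 x1 ym y1)%C.
Proof.
  intros Hm Hg. unfold oint.
  rewrite <- (CInt_Chasles (fun y => g (x0, y)) y0 ym y1),
    <- (CInt_Chasles (fun y => g (x1, y)) y0 ym y1); [ring| | | |];
    apply ex_CInt_v; try lra; intros t Ht; apply Hg;
    unfold on_edge, in_rect; simpl; lra.
Qed.

(** Together with [oint_id] this disposes of affine functions, so that Goursat's argument may
    subtract the linear approximation. *)
Lemma oint_const (c : C) : oint (fun _ => c) x0 x1 y0 y1 = RtoC 0.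
Proof.
  unfold oint, CInt. rewrite !RInt_const.
  destruct c as [c1 c2]. unfold scal; simpl; unfold mult; simpl.
  unfold Cmult, Cplus, Cminus, Cplus, Copp, RtoC; simpl. f_equal; ring.
Qed.

Lemma oint_id : oint (fun u => u) x0 x1 y0 y1 = RtoC 0.
Proof.
  unfold oint.
  rewrite !(CInt_derive (fun x => (x * x / 2, x * y0)) (fun x => (x, y0))),
    !(CInt_derive (fun x => (x * x / 2, x * y1)) (fun x => (x, y1))),
    !(CInt_derive (fun y => (x0 * y, y * y / 2)) (fun y => (x0, y))),
    !(CInt_derive (fun y => (x1 * y, y * y / 2)) (fun y => (x1, y))); auto.
  { unfold Cmult, Cplus, Cminus, Cplus, Copp, RtoC; simpl. f_equal; field. }
  all: intros t _; simpl; split; [|split; [|split]].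
  all: try (auto_derive; [exact I|field]).
  all: apply continuous_const || apply continuous_id.
Qed.

End Rectangle.

Lemma nested_intervals (a b : nat -> R) :
  (forall n, a n <= a (S n)) -> (forall n, b (S n) <= b n) -> (forall n, a n <= b n) ->
  exists X, forall n, a n <= X <= b n.
Proof.
  intros Ha Hb Hab.
  assert (Ha' : forall n m, a n <= a (n + m)%nat).
  { intros n m. induction m as [|m IH].
    - rewrite Nat.add_0_r. lra.
    - rewrite Nat.add_succ_r. specialize (Ha (n + m)%nat). lra. }
  assert (Hb' : forall n m, b (n + m)%nat <= b n).
  { intros n m. induction m as [|m IH].
    - rewrite Nat.add_0_r. lra.
    - rewrite Nat.add_succ_r. specialize (Hb (n + m)%nat). lra. }
  assert (Hcross : forall n m, a n <= b m).
  { intros n m. specialize (Ha' n m). specialize (Hb' m n). specialize (Hab (n + m)%nat).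
    rewrite (Nat.add_comm m n) in Hb'. lra. }
  destruct (completeness (fun x => exists n, x = a n)) as [X [H1 H2]].
  - exists (b O). intros x [n ->]. apply Hcross.
  - exists (a O). now exists O.
  - exists X. intros n. split.
    + apply H1. now exists n.
    + apply H2. intros x [m ->]. apply Hcross.
Qed.

(* Rectangles of the fixed shape [w * h] are recorded by their lower left corner
   and their scale. *)
Lemma rectangle_bisection (P : R -> R -> R -> Prop) (w h x0 y0 : R) :
  0 < w -> 0 < h ->
  (forall x y t, 0 < t ->
     P x y (t / 2) -> P (x + t / 2 * w) y (t / 2) -> P x (y + t / 2 * h) (t / 2) ->
     P (x + t / 2 * w) (y + t / 2 * h) (t / 2) -> P x y t) ->
  (forall X Y, exists d, 0 < d /\ forall x y t, 0 < t < d ->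
     x <= X <= x + t * w -> y <= Y <= y + t * h -> P x y t) ->
  P x0 y0 1.
Proof.
  (* A rectangle where [P] fails has a quarter where it fails; the nested failing quarters shrink to
     a point that contradicts the local hypothesis. *)
  intros Hw Hh Hsub Hloc. apply NNPP. intros HnP.
  set (step := fun (t : R) (s s' : R * R) =>
    ~ P (fst s') (snd s') (t / 2) /\
    fst s <= fst s' /\ fst s' + t / 2 * w <= fst s + t * w /\
    snd s <= snd s' /\ snd s' + t / 2 * h <= snd s + t * h).
  assert (Hstep : forall t s, 0 < t -> ~ P (fst s) (snd s) t -> exists s', step t s s').
  { intros t [x y] Ht Hn. simpl in Hn. unfold step; simpl.
    assert (0 < t / 2 * w) by (apply Rmult_lt_0_compat; lra).
    assert (0 < t / 2 * h) by (apply Rmult_lt_0_compat; lra).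
    replace (t * w) with (t / 2 * w + t / 2 * w) by field.
    replace (t * h) with (t / 2 * h + t / 2 * h) by field.
    apply NNPP. intros Hno. apply Hn. apply Hsub; auto; apply NNPP; intros Hq; apply Hno.
    - exists (x, y). simpl. repeat split; auto; lra.
    - exists (x + t / 2 * w, y). simpl. repeat split; auto; lra.
    - exists (x, y + t / 2 * h). simpl. repeat split; auto; lra.
    - exists (x + t / 2 * w, y + t / 2 * h). simpl. repeat split; auto; lra. }
  (* The choice is meaningful only while [P] fails at the current rectangle; [HS] maintains this
     along the sequence. *)
  set (nxt := fun t s => epsilon (inhabits s) (step t s)).
  set (sc := fun n : nat => (/ 2) ^ n).
  set (S_ := fix S_ n := match n with O => (x0, y0) | S k => nxt (sc k) (S_ k) end).
  assert (Hsc : forall n, 0 < sc n) by (intros n; apply pow_lt; lra).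
  assert (Hsc2 : forall n, sc (S n) = sc n / 2) by (intros n; unfold sc; simpl; field).
  assert (HS : forall n, ~ P (fst (S_ n)) (snd (S_ n)) (sc n)).
  { induction n as [|n IH]; [exact HnP|].
    pose proof (epsilon_spec (inhabits (S_ n)) (step (sc n) (S_ n))
                  (Hstep _ _ (Hsc n) IH)) as [H _].
    rewrite Hsc2. exact H. }
  assert (HS2 : forall n, step (sc n) (S_ n) (S_ (S n))).
  { intros n. exact (epsilon_spec (inhabits (S_ n)) (step (sc n) (S_ n))
                  (Hstep _ _ (Hsc n) (HS n))). }
  destruct (nested_intervals (fun n => fst (S_ n)) (fun n => fst (S_ n) + sc n * w))
    as [X HX].
  { intros n. apply (HS2 n). }
  { intros n. rewrite Hsc2. apply (HS2 n). }
  { intros n. specialize (Hsc n). nra. }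
  destruct (nested_intervals (fun n => snd (S_ n)) (fun n => snd (S_ n) + sc n * h))
    as [Y HY].
  { intros n. apply (HS2 n). }
  { intros n. rewrite Hsc2. apply (HS2 n). }
  { intros n. specialize (Hsc n). nra. }
  destruct (Hloc X Y) as [d [Hd H]].
  destruct (pow_lt_1_zero (/ 2)) with d as [N HN]; auto.
  { rewrite Rabs_pos_eq; lra. }
  apply (HS N). apply H; auto. split; [apply Hsc|].
  specialize (HN N (le_n N)). rewrite Rabs_pos_eq in HN; [exact HN|].
  left. apply Hsc.
Qed.

Lemma Rle_0_of_small (a k : R) : (forall eps, 0 < eps -> a <= eps * k) -> a <= 0.
Proof.
  intros H. destruct (Rle_lt_dec a 0) as [Ha|Ha]; [exact Ha|exfalso].
  destruct (Rle_lt_dec k 0) as [Hk|Hk].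
  - specialize (H 1). lra.
  - specialize (H (a / (2 * k))).
    assert (0 < a / (2 * k)) by (apply Rdiv_lt_0_compat; lra).
    specialize (H H0). replace (a / (2 * k) * k) with (a / 2) in H by (field; lra). lra.
Qed.

Lemma Cmod_le_0_eq (a : C) : Cmod a <= 0 -> a = RtoC 0.
Proof. intros H. apply Cmod_eq_0. pose proof (Cmod_ge_0 a). lra. Qed.

Lemma goursat (g : C -> C) (x0 x1 y0 y1 : R) : x0 < x1 -> y0 < y1 ->
  (forall u, in_rect x0 x1 y0 y1 u -> Cdiff g u) ->
  oint g x0 x1 y0 y1 = RtoC 0.
Proof.
  intros Hx Hy Hg. apply Cmod_le_0_eq.
  set (w := x1 - x0). set (h := y1 - y0).
  apply Rle_0_of_small with (4 * ((w + h) * (w + h))). intros eps He.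
  (* The bound scales with the area, so the bounds of four quarters add up to exactly the bound of
     the whole. The side conditions make [P] hold trivially for rectangles that leave the domain. *)
  set (P := fun x y t : R =>
    x0 <= x -> x + t * w <= x1 -> y0 <= y -> y + t * h <= y1 ->
    Cmod (oint g x (x + t * w) y (y + t * h)) <= eps * (4 * ((w + h) * (w + h))) * (t * t)).
  assert (Hw : 0 < w) by (unfold w; lra). assert (Hh : 0 < h) by (unfold h; lra).
  assert (HP : P x0 y0 1).
  - apply (rectangle_bisection P w h); auto.
    + intros x y t Ht Q1 Q2 Q3 Q4 Hx0 Hx1 Hy0 Hy1.
      assert (Htw : 0 < t / 2 * w) by (apply Rmult_lt_0_compat; lra).
      assert (Hth : 0 < t / 2 * h) by (apply Rmult_lt_0_compat; lra).
      unfold P in *.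
      replace (t * w) with (t / 2 * w + t / 2 * w) in * by field.
      replace (t * h) with (t / 2 * h + t / 2 * h) in * by field.
      set (a := t / 2 * w) in *. set (b := t / 2 * h) in *.
      specialize (Q1 ltac:(lra) ltac:(lra) ltac:(lra) ltac:(lra)).
      specialize (Q2 ltac:(lra) ltac:(lra) ltac:(lra) ltac:(lra)).
      specialize (Q3 ltac:(lra) ltac:(lra) ltac:(lra) ltac:(lra)).
      specialize (Q4 ltac:(lra) ltac:(lra) ltac:(lra) ltac:(lra)).
      assert (Hc : forall u, in_rect x (x + (a + a)) y (y + (b + b)) u -> Ccont g u).
      { intros u Hu. apply Cdiff_cont, Hg. unfold in_rect in *. lra. }
      rewrite (oint_split_x x (x + (a + a)) y (y + (b + b))) with (xm := x + a);
        [|lra|lra|intros u [Hu _]; auto].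
      rewrite (oint_split_y x (x + a) y (y + (b + b))) with (ym := y + b);
        [|lra|lra|intros u [Hu _]; apply Hc; unfold in_rect in *; lra].
      rewrite (oint_split_y (x + a) (x + (a + a)) y (y + (b + b))) with (ym := y + b);
        [|lra|lra|intros u [Hu _]; apply Hc; unfold in_rect in *; lra].
      rewrite (Rplus_assoc x a a) in Q2, Q4. rewrite (Rplus_assoc y b b) in Q3, Q4.
      eapply Rle_trans; [apply Cmod_triangle|].
      eapply Rle_trans; [apply Rplus_le_compat; apply Cmod_triangle|].
      replace (t * t) with (t / 2 * (t / 2) + t / 2 * (t / 2)
                            + (t / 2 * (t / 2) + t / 2 * (t / 2))) by field.
      rewrite !Rmult_plus_distr_l. lra.
    + intros X Y.
      destruct (classic (in_rect x0 x1 y0 y1 (X, Y))) as [HXY|HXY].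
      * destruct (Hg _ HXY) as [l Hl].
        destruct (Cderiv_eps _ _ _ Hl eps He) as [d [Hd H]].
        exists (d / (w + h)). split; [apply Rdiv_lt_0_compat; lra|].
        intros x y t [Ht Htd] HXt HYt Hx0 Hx1 Hy0 Hy1.
        assert (Htw : 0 < t * w) by (apply Rmult_lt_0_compat; lra).
        assert (Hth : 0 < t * h) by (apply Rmult_lt_0_compat; lra).
        assert (Htd' : t * w + t * h < d).
        { apply Rmult_lt_compat_r with (r := w + h) in Htd; [|lra].
          unfold Rdiv in Htd. rewrite Rmult_assoc, Rinv_l in Htd by lra. lra. }
        set (p := (X, Y) : C) in *.
        (* [e] is [g] minus its linear approximation at [p]: it has the same contour integral, but
           its size is [eps] times the diameter, on a contour of comparable length. *)
        set (e := fun u => (g u + (- (g p - l * p) + - l * u))%C).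
        assert (Ha : forall u, Ccont (fun u => - (g p - l * p) + - l * u)%C u).
        { intros u. apply Ccont_plus; [apply Ccont_const|].
          apply Ccont_mult; [apply Ccont_const|apply Ccont_id]. }
        assert (Hc : forall u, on_edge x (x + t * w) y (y + t * h) u -> Ccont g u).
        { intros u [Hu _]. apply Cdiff_cont, Hg. unfold in_rect in *. lra. }
        assert (E : oint g x (x + t * w) y (y + t * h) = oint e x (x + t * w) y (y + t * h)).
        { unfold e. rewrite oint_plus by (auto; lra).
          rewrite oint_plus; try lra; auto using Ccont_const.
          - rewrite oint_const, oint_scal, oint_id by (auto using Ccont_id; lra). ring.
          - intros u _. apply Ccont_mult; [apply Ccont_const|apply Ccont_id]. }
        rewrite E.
        eapply Rle_trans.
        { apply oint_bound with (M := eps * (t * w + t * h)); try lra.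
          - intros u Hu. apply Ccont_plus; auto.
          - intros u [[Hu1 Hu2] _].
            assert (Hup : Cmod (u - p) <= t * w + t * h).
            { destruct u as [a b]. simpl in Hu1, Hu2.
              unfold p, Cminus, Cplus, Copp; simpl.
              eapply Rle_trans; [apply Cmod_le_abs|].
              apply Rplus_le_compat; apply Rabs_le; lra. }
            replace (e u) with (g u - g p - l * (u - p))%C by (unfold e; ring).
            eapply Rle_trans; [apply H; lra|].
            apply Rmult_le_compat_l; lra. }
        right. ring.
      * exists 1. split; [lra|]. intros x y t _ HXt HYt Hx0 Hx1 Hy0 Hy1.
        exfalso. apply HXY. unfold in_rect; simpl. lra.
  - unfold P in HP. rewrite !Rmult_1_l, !Rmult_1_r in HP.
    replace (x0 + w) with x1 in HP by (unfold w; ring).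
    replace (y0 + h) with y1 in HP by (unfold h; ring).
    apply HP; lra.
Qed.

(** * The residue theorem on rectangles *)

Definition in_interior (x0 x1 y0 y1 : R) (u : C) : Prop :=
  x0 < Re u < x1 /\ y0 < Im u < y1.

(** Riemann's condition for a removable singularity: [(u - p) * g u] tends to 0. The function [psi]
    supplies the limit at [p], where [g] itself may have any value. *)
Definition zero_residue (g : C -> C) (p : C) : Prop :=
  exists psi d, 0 < d /\ Ccont psi p /\ psi p = RtoC 0 /\
    forall u, 0 < Cmod (u - p) < d -> ((u - p) * g u)%C = psi u.

(** Used to size a small square around [p]: if its half-side is below [e], the lines through its
    sides miss every other exceptional point, even one that shares a coordinate with [p]. *)
Lemma list_gap (f : C -> R) (t : R) (l : list C) :
  exists e, 0 < e /\ forall q, In q l -> f q = t \/ e < Rabs (f q - t).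
Proof.
  induction l as [|q l [e [He IH]]].
  - exists 1. split; [lra|]. intros q [].
  - destruct (Req_dec (f q) t) as [E|E].
    + exists e. split; [exact He|]. intros q' [<-|Hq]; auto.
    + assert (H0 : 0 < Rabs (f q - t)) by (apply Rabs_pos_lt; lra).
      exists (Rmin e (Rabs (f q - t) / 2)). split; [apply Rmin_glb_lt; lra|].
      intros q' [<-|Hq].
      * right. eapply Rle_lt_trans; [apply Rmin_r|]. lra.
      * destruct (IH q' Hq) as [H|H]; [now left|right].
        eapply Rle_lt_trans; [apply Rmin_l|exact H].
Qed.

(** On the boundary of a square of half-side [e] the function is at most [eps / e], while the
    boundary has length [8 * e]; the product does not depend on [e]. *)
Lemma oint_small_square (g : C -> C) (p : C) (eps : R) : 0 < eps -> zero_residue g p ->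
  exists d, 0 < d /\ forall e, 0 < e < d ->
    (forall u, on_edge (Re p - e) (Re p + e) (Im p - e) (Im p + e) u -> Ccont g u) ->
    Cmod (oint g (Re p - e) (Re p + e) (Im p - e) (Im p + e)) <= eps * 16.
Proof.
  intros He [psi [d [Hd [Hc [H0 H]]]]].
  destruct (Hc eps He) as [d1 [Hd1 H1]].
  assert (Hm : 0 < Rmin d d1) by (now apply Rmin_glb_lt).
  exists (Rmin d d1 / 2). split; [lra|]. intros e [He0 Hed] Hg.
  eapply Rle_trans.
  - apply oint_bound with (M := eps / e); try lra; auto.
    intros u [[[A1 A2] [A3 A4]] Hu].
    assert (Hup : e <= Cmod (u - p)).
    { assert (Hor : Rabs (Re (u - p)) = e \/ Rabs (Im (u - p)) = e).
      { replace (Re (u - p)) with (Re u - Re p) by (destruct u, p; reflexivity).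
        replace (Im (u - p)) with (Im u - Im p) by (destruct u, p; reflexivity).
        destruct Hu as [->|[->|[->| ->]]]; [left|left|right|right].
        - rewrite Rabs_left by lra. ring.
        - rewrite Rabs_right by lra. ring.
        - rewrite Rabs_left by lra. ring.
        - rewrite Rabs_right by lra. ring. }
      destruct Hor as [<-|<-]; [apply re_le_Cmod|apply im_le_Cmod]. }
    assert (Hup2 : Cmod (u - p) <= e + e).
    { destruct u as [a b], p as [a' b']. simpl in A1, A2, A3, A4.
      unfold Cminus, Cplus, Copp; simpl.
      eapply Rle_trans; [apply Cmod_le_abs|].
      apply Rplus_le_compat; apply Rabs_le; lra. }
    pose proof (Rmin_l d d1). pose proof (Rmin_r d d1).
    specialize (H1 u ltac:(lra)). rewrite H0 in H1.
    rewrite <- H in H1 by lra.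
    replace ((u - p) * g u - 0)%C with ((u - p) * g u)%C in H1 by ring.
    rewrite Cmod_mult in H1. pose proof (Cmod_ge_0 (g u)).
    apply Rmult_le_reg_l with e; [lra|].
    replace (e * (eps / e)) with eps by (field; lra).
    nra.
  - right. field. lra.
Qed.

(** Four cuts isolate [p] in a small square. The other pieces avoid [p] and vanish by induction, and
    the square contributes arbitrarily little. The rectangle is quantified after the list so that
    the induction hypothesis applies to the pieces. *)
Lemma oint_zero_residues (g : C -> C) (l : list C) : forall x0 x1 y0 y1,
  x0 < x1 -> y0 < y1 ->
  (forall u, in_rect x0 x1 y0 y1 u -> ~ In u l -> Cdiff g u) ->
  (forall p, In p l -> in_rect x0 x1 y0 y1 p ->
     in_interior x0 x1 y0 y1 p /\ zero_residue g p) ->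
  oint g x0 x1 y0 y1 = RtoC 0.
Proof.
  induction l as [|p l IH]; intros x0 x1 y0 y1 Hx Hy Hd Hp.
  { apply goursat; auto. }
  (* A point that lies outside the rectangle, or occurs again in the list, is simply dropped. *)
  destruct (classic (in_rect x0 x1 y0 y1 p /\ ~ In p l)) as [[Hin Hnl]|Hno].
  2: { apply IH; auto.
       - intros u Hu Hul. apply Hd; [exact Hu|]. intros [<-|H]; [|auto].
         apply Hno. auto.
       - intros q Hq. apply Hp. now right. }
  destruct (Hp p (or_introl eq_refl) Hin) as [[[I1 I2] [I3 I4]] Hz].
  destruct (list_gap Re (Re p) l) as [e1 [He1 G1]].
  destruct (list_gap Im (Im p) l) as [e2 [He2 G2]].
  apply Cmod_le_0_eq, Rle_0_of_small with 16. intros eps Heps.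
  destruct (oint_small_square g p eps Heps Hz) as [d [Hd0 Hsq]].
  assert (Hex : exists e, 0 < e /\ e < e1 /\ e < e2 /\ e < d /\ x0 < Re p - e /\
            Re p + e < x1 /\ y0 < Im p - e /\ Im p + e < y1).
  { set (m := Rmin (Rmin (Rmin e1 e2) d)
                (Rmin (Rmin (Re p - x0) (x1 - Re p)) (Rmin (Im p - y0) (y1 - Im p)))).
    assert (Hm : 0 < m) by (unfold m; repeat apply Rmin_glb_lt; lra).
    assert (M1 : m <= Rmin (Rmin e1 e2) d) by apply Rmin_l.
    assert (M2 : m <= Rmin (Rmin (Re p - x0) (x1 - Re p)) (Rmin (Im p - y0) (y1 - Im p)))
      by apply Rmin_r.
    pose proof (Rmin_l (Rmin e1 e2) d). pose proof (Rmin_r (Rmin e1 e2) d).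
    pose proof (Rmin_l e1 e2). pose proof (Rmin_r e1 e2).
    pose proof (Rmin_l (Rmin (Re p - x0) (x1 - Re p)) (Rmin (Im p - y0) (y1 - Im p))).
    pose proof (Rmin_r (Rmin (Re p - x0) (x1 - Re p)) (Rmin (Im p - y0) (y1 - Im p))).
    pose proof (Rmin_l (Re p - x0) (x1 - Re p)). pose proof (Rmin_r (Re p - x0) (x1 - Re p)).
    pose proof (Rmin_l (Im p - y0) (y1 - Im p)). pose proof (Rmin_r (Im p - y0) (y1 - Im p)).
    exists (m / 2). lra. }
  destruct Hex as [e [E0 [E1 [E2 [E3 [E4 [E5 [E6 E7]]]]]]]].
  assert (Gx : forall q, In q l -> Re q <> Re p - e /\ Re q <> Re p + e).
  { intros q Hq. destruct (G1 q Hq) as [->|H]; [lra|].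
    split; intros E; rewrite E in H; revert H; unfold Rabs; destruct (Rcase_abs _); lra. }
  assert (Gy : forall q, In q l -> Im q <> Im p - e /\ Im q <> Im p + e).
  { intros q Hq. destruct (G2 q Hq) as [->|H]; [lra|].
    split; intros E; rewrite E in H; revert H; unfold Rabs; destruct (Rcase_abs _); lra. }
  assert (Hc : forall u, in_rect x0 x1 y0 y1 u ->
            (Re u = x0 \/ Re u = x1 \/ Im u = y0 \/ Im u = y1 \/
             Re u = Re p - e \/ Re u = Re p + e \/ Im u = Im p - e \/ Im u = Im p + e) ->
            Ccont g u).
  { intros u Hu Hl. apply Cdiff_cont, Hd; [exact Hu|]. intros Hi.
    destruct (Hp u Hi Hu) as [[[J1 J2] [J3 J4]] _].
    assert (Hup : Re u <> Re p - e /\ Re u <> Re p + e /\ Im u <> Im p - e /\ Im u <> Im p + e).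
    { destruct Hi as [<-|Hi]; [lra|].
      destruct (Gx u Hi) as [K1 K2]; destruct (Gy u Hi) as [K3 K4]; repeat split; assumption. }
    destruct Hup as [K1 [K2 [K3 K4]]].
    destruct Hl as [L|[L|[L|[L|[L|[L|[L|L]]]]]]]; lra. }
  (* The sides of a piece are taken from the outer edges and the cutting lines, which avoid all
     exceptional points; hence a remaining point in a piece is interior to it. *)
  assert (Hpiece : forall a b c d, x0 <= a -> a < b -> b <= x1 -> y0 <= c -> c < d -> d <= y1 ->
            (a = x0 \/ a = Re p - e \/ a = Re p + e) ->
            (b = x1 \/ b = Re p - e \/ b = Re p + e) ->
            (c = y0 \/ c = Im p - e \/ c = Im p + e) ->
            (d = y1 \/ d = Im p - e \/ d = Im p + e) ->
            ~ in_rect a b c d p -> oint g a b c d = RtoC 0).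
  { intros a b c d' A1 A2 A3 A4 A5 A6 A7 A8 A9 A10 Hnp. apply IH; auto.
    - intros u Hu Hul. apply Hd.
      + unfold in_rect in *. lra.
      + intros [<-|H]; auto.
    - intros q Hq Hqr.
      destruct (Hp q (or_intror Hq)) as [[[J1 J2] [J3 J4]] Hzq].
      { unfold in_rect in *. lra. }
      split; [|exact Hzq]. destruct (Gx q Hq) as [K1 K2]. destruct (Gy q Hq) as [K3 K4].
      destruct Hqr as [[Q1 Q2] [Q3 Q4]].
      unfold in_interior. repeat split; apply Rnot_le_lt; intros Hle.
      + destruct A7 as [A7|[A7|A7]]; subst a; [lra|apply K1; lra|apply K2; lra].
      + destruct A8 as [A11|[A11|A11]]; subst b; [lra|apply K1; lra|apply K2; lra].
      + destruct A9 as [A11|[A11|A11]]; subst c; [lra|apply K3; lra|apply K4; lra].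
      + destruct A10 as [A11|[A11|A11]]; subst d'; [lra|apply K3; lra|apply K4; lra]. }
  rewrite (oint_split_x x0 x1 y0 y1) with (xm := Re p - e);
    [|lra|lra|intros u [Hu Hl]; apply Hc; [unfold in_rect in *; lra|tauto]].
  rewrite (oint_split_x (Re p - e) x1 y0 y1) with (xm := Re p + e);
    [|lra|lra|intros u [Hu Hl]; apply Hc; [unfold in_rect in *; lra|tauto]].
  rewrite (oint_split_y (Re p - e) (Re p + e) y0 y1) with (ym := Im p - e);
    [|lra|lra|intros u [Hu Hl]; apply Hc; [unfold in_rect in *; lra|tauto]].
  rewrite (oint_split_y (Re p - e) (Re p + e) (Im p - e) y1) with (ym := Im p + e);
    [|lra|lra|intros u [Hu Hl]; apply Hc; [unfold in_rect in *; lra|tauto]].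
  rewrite (Hpiece x0 (Re p - e) y0 y1), (Hpiece (Re p + e) x1 y0 y1),
    (Hpiece (Re p - e) (Re p + e) y0 (Im p - e)),
    (Hpiece (Re p - e) (Re p + e) (Im p + e) y1);
    try lra; try (unfold in_rect; lra); auto.
  match goal with |- Cmod ?a <= _ =>
    replace a with (oint g (Re p - e) (Re p + e) (Im p - e) (Im p + e)) by ring end.
  apply Hsq; [lra|]. intros u [Hu Hl]. apply Hc; [unfold in_rect in *; lra|tauto].
Qed.

(** * The integral of a simple fraction around a rectangle *)

Lemma Cminus_neq_0 (u p : C) : u <> p -> (u - p)%C <> RtoC 0.
Proof. intros H E. apply H. replace u with (u - p + p)%C by ring. rewrite E. ring. Qed.

Lemma Cderiv_pole (p u : C) : u <> p -> Cdiff (fun v => / (v - p))%C u.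
Proof.
  intros H. eexists. apply (Cderiv_inv (fun v => v + - p)%C).
  - now apply Cminus_neq_0.
  - apply Cderiv_plus; [apply Cderiv_id|apply Cderiv_const].
Qed.

Lemma Ccont_pole (p u : C) : u <> p -> Ccont (fun v => / (v - p))%C u.
Proof. intros H. now apply Cdiff_cont, Cderiv_pole. Qed.

(** Used at a corner of a rectangle, where the primitives along the two adjacent sides contribute
    complementary angles. *)
Lemma atan_div_inv (x y : R) : 0 < x * y -> atan (x / y) + atan (y / x) = PI / 2.
Proof.
  intros H. assert (x <> 0 /\ y <> 0) as [Hx Hy] by (split; intros ->; lra).
  replace (y / x) with (/ (x / y)) by (field; auto).
  rewrite atan_inv; [ring|].
  replace (x / y) with (x * y * (/ y * / y)) by (field; auto).
  apply Rmult_lt_0_compat; [exact H|].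
  apply Rsqr_pos_lt, Rinv_neq_0_compat, Hy.
Qed.

Lemma atan_div_inv_neg (x y : R) : x * y < 0 -> atan (x / y) + atan (y / x) = - (PI / 2).
Proof.
  intros H. assert (x <> 0 /\ y <> 0) as [Hx Hy] by (split; intros ->; lra).
  rewrite <- (atan_div_inv (- x) y) by lra.
  replace (- x / y) with (- (x / y)) by (field; auto).
  replace (y / - x) with (- (y / x)) by (field; auto).
  rewrite !atan_opp. ring.
Qed.

(** The primitive is a logarithm of [u - p], with [ln] for the modulus and [atan] for the argument.
    On a line that misses [p] the quotient under [atan] is smooth, so no branch cut has to be
    chosen. *)
Lemma CInt_pole_h (p : C) (y a b : R) : a <= b -> y <> Im p ->
  CInt (fun x => / ((x, y) - p))%C a b =
  (((ln ((b - Re p) ^ 2 + (y - Im p) ^ 2) - ln ((a - Re p) ^ 2 + (y - Im p) ^ 2)) / 2)%R,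
   (atan ((a - Re p) / (y - Im p)) - atan ((b - Re p) / (y - Im p)))%R).
Proof.
  intros Hab Hy. set (c := y - Im p). assert (Hc : c <> 0) by (unfold c; lra).
  assert (Hc2 : 0 < c * c) by nra.
  rewrite (CInt_derive (fun x => ((ln ((x - Re p) ^ 2 + c ^ 2) / 2)%R,
                                  (- atan ((x - Re p) / c))%R))).
  - unfold Cminus, Cplus, Copp; simpl. f_equal; field.
  - exact Hab.
  - intros t _.
    assert (Hcont : Ccont (fun u => / (u - p))%C (t, y)).
    { apply Ccont_pole. intros E. apply Hy. rewrite <- E. reflexivity. }
    assert (Hs : 0 <= (t - Re p) * (t - Re p)) by apply Rle_0_sqr.
    pose proof (Ccont_comp_lip _ (fun x => (x, y)) t (fun s => hpath_lip y t s) Hcont) as [C1 C2].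
    split; [|split; [|split; [exact C1|exact C2]]].
    + simpl. auto_derive.
      * nra.
      * destruct p as [p1 p2]. unfold c in *. simpl in *. unfold Rminus in *. field. nra.
    + simpl. auto_derive.
      * exact I.
      * destruct p as [p1 p2]. unfold c in *. simpl in *. unfold Rminus in *. field.
        repeat split; nra.
Qed.

Lemma CInt_pole_v (p : C) (x a b : R) : a <= b -> x <> Re p ->
  CInt (fun y => / ((x, y) - p))%C a b =
  ((atan ((b - Im p) / (x - Re p)) - atan ((a - Im p) / (x - Re p)))%R,
   ((ln ((x - Re p) ^ 2 + (a - Im p) ^ 2) - ln ((x - Re p) ^ 2 + (b - Im p) ^ 2)) / 2)%R).
Proof.
  intros Hab Hx. set (c := x - Re p). assert (Hc : c <> 0) by (unfold c; lra).
  assert (Hc2 : 0 < c * c) by nra.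
  rewrite (CInt_derive (fun y => ((atan ((y - Im p) / c))%R,
                                  (- (ln (c ^ 2 + (y - Im p) ^ 2) / 2))%R))).
  - unfold Cminus, Cplus, Copp; simpl. f_equal; field.
  - exact Hab.
  - intros t _.
    assert (Hcont : Ccont (fun u => / (u - p))%C (x, t)).
    { apply Ccont_pole. intros E. apply Hx. rewrite <- E. reflexivity. }
    assert (Hs : 0 <= (t - Im p) * (t - Im p)) by apply Rle_0_sqr.
    pose proof (Ccont_comp_lip _ (fun y => (x, y)) t (fun s => vpath_lip x t s) Hcont) as [C1 C2].
    split; [|split; [|split; [exact C1|exact C2]]].
    + simpl. auto_derive.
      * exact I.
      * destruct p as [p1 p2]. unfold c in *. simpl in *. unfold Rminus in *. field.
        repeat split; nra.
    + simpl. auto_derive.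
      * nra.
      * destruct p as [p1 p2]. unfold c in *. simpl in *. unfold Rminus in *. field. nra.
Qed.

(** The [ln] terms cancel around the boundary, and each of the four corners contributes the angle
    [PI / 2]. *)
Lemma oint_pole (p : C) (x0 x1 y0 y1 : R) : in_interior x0 x1 y0 y1 p ->
  oint (fun u => / (u - p))%C x0 x1 y0 y1 = (2 * RtoC PI * Ci)%C.
Proof.
  intros [[H1 H2] [H3 H4]]. unfold oint.
  rewrite !CInt_pole_h, !CInt_pole_v by lra.
  unfold Cmult, Cplus, Cminus, Cplus, Copp, RtoC, Ci; simpl. f_equal.
  - field.
  - pose proof (atan_div_inv (x1 - Re p) (y1 - Im p) ltac:(nra)).
    pose proof (atan_div_inv (x0 - Re p) (y0 - Im p) ltac:(nra)).
    pose proof (atan_div_inv_neg (x1 - Re p) (y0 - Im p) ltac:(nra)).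
    pose proof (atan_div_inv_neg (x0 - Re p) (y1 - Im p) ltac:(nra)).
    lra.
Qed.

(** * Principal parts and residues *)

Definition Clsum (F : C -> C) (l : list C) : C :=
  fold_right (fun p s => F p + s)%C (RtoC 0) l.

Lemma Clsum_poles_diff (c : C -> C) (l : list C) (u : C) : ~ In u l ->
  Cdiff (fun v => Clsum (fun p => c p * / (v - p))%C l) u.
Proof.
  induction l as [|p l IH]; intros Hu; simpl.
  - eexists. apply Cderiv_const.
  - destruct IH as [a Ha]; [intros H; apply Hu; now right|].
    destruct (Cderiv_pole p u) as [b Hb]; [intros ->; apply Hu; now left|].
    eexists. apply Cderiv_plus; [apply Cderiv_scal, Hb|exact Ha].
Qed.

(** By [NoDup], [p] contributes a single principal part, and the remaining ones are regular at
    [p]. *)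
Lemma Clsum_poles_split (c : C -> C) (l : list C) (p : C) : NoDup l -> In p l ->
  exists k, Ccont k p /\
    forall u, Clsum (fun q => c q * / (u - q))%C l = (c p * / (u - p) + k u)%C.
Proof.
  induction l as [|q l IH]; intros Hnd Hp; [destruct Hp|].
  inversion Hnd as [|q' l' Hq Hl]; subst. destruct Hp as [->|Hp].
  - exists (fun u => Clsum (fun q => c q * / (u - q))%C l). split.
    + now apply Cdiff_cont, Clsum_poles_diff.
    + intros u. reflexivity.
  - destruct (IH Hl Hp) as [k [Hk H]].
    exists (fun u => c q * / (u - q) + k u)%C. split.
    + apply Ccont_plus; [|exact Hk]. apply Ccont_mult; [apply Ccont_const|].
      apply Ccont_pole. intros ->. contradiction.
    + intros u. simpl. rewrite H. ring.
Qed.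

Lemma oint_Clsum_poles (c : C -> C) (l : list C) (x0 x1 y0 y1 : R) :
  x0 < x1 -> y0 < y1 -> (forall p, In p l -> in_interior x0 x1 y0 y1 p) ->
  oint (fun u => Clsum (fun p => c p * / (u - p))%C l) x0 x1 y0 y1
    = (2 * RtoC PI * Ci * Clsum c l)%C.
Proof.
  intros Hx Hy. induction l as [|p l IH]; intros Hl; simpl.
  - rewrite oint_const. ring.
  - assert (He : forall u, on_edge x0 x1 y0 y1 u -> ~ In u (p :: l)).
    { intros u [Hu Hu2] Hi. apply Hl in Hi. unfold in_interior in Hi. lra. }
    rewrite oint_plus; try lra.
    + rewrite oint_scal, oint_pole, IH; try lra.
      * ring.
      * intros q Hq. apply Hl. now right.
      * apply Hl. now left.
      * intros u Hu. apply Ccont_pole. intros ->. apply (He p Hu). now left.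
    + intros u Hu. apply Ccont_mult; [apply Ccont_const|].
      apply Ccont_pole. intros ->. apply (He p Hu). now left.
    + intros u Hu. apply Cdiff_cont, Clsum_poles_diff. intros Hi.
      apply (He u Hu). now right.
Qed.

Lemma Cdiff_div (A B : C -> C) (u : C) : Cdiff A u -> Cdiff B u -> B u <> RtoC 0 ->
  Cdiff (fun v => A v / B v)%C u.
Proof.
  intros [a Ha] [b Hb] H0. eexists. apply Cderiv_mult; [exact Ha|].
  apply Cderiv_inv; [exact H0|exact Hb].
Qed.

(** The Caratheodory factor [phi] of [B] divides out the zero: near [p], [(u - p) * (A u / B u)] is
    [A u / phi u], continuous with the residue as its value at [p]. *)
Lemma simple_pole (A B : C -> C) (p b : C) : Ccont A p -> Cderiv B p b ->
  B p = RtoC 0 -> b <> RtoC 0 ->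
  exists psi d, 0 < d /\ Ccont psi p /\ psi p = (A p / b)%C /\
    forall u, 0 < Cmod (u - p) < d -> ((u - p) * (A u / B u))%C = psi u.
Proof.
  intros HA [phi [d [Hd [H1 [H2 H3]]]]] H0 Hb. subst b.
  destruct (Ccont_nonzero phi p H3 Hb) as [d1 [Hd1 H4]].
  exists (fun u => A u * / phi u)%C, (Rmin d d1). split; [now apply Rmin_glb_lt|].
  split; [apply Ccont_mult; auto using Ccont_inv|]. split; [reflexivity|].
  intros u [Hu1 Hu2].
  rewrite H1 by (eapply Rlt_le_trans; [exact Hu2|apply Rmin_l]). rewrite H0.
  assert (phi u <> RtoC 0).
  { apply Cmod_gt_0. specialize (H4 u (Rlt_le_trans _ _ _ Hu2 (Rmin_r _ _))).
    pose proof (Cmod_ge_0 (phi p)). lra. }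
  apply Cmod_gt_0 in Hu1. field. auto.
Qed.

(** Subtracting the principal parts leaves a function with zero residues, whose contour integral
    vanishes; the principal parts themselves are integrated by [oint_pole]. *)
Lemma residue_theorem (A B dB : C -> C) (l : list C) (x0 x1 y0 y1 : R) :
  x0 < x1 -> y0 < y1 -> NoDup l ->
  (forall u, in_rect x0 x1 y0 y1 u -> Cdiff A u) ->
  (forall u, in_rect x0 x1 y0 y1 u -> Cderiv B u (dB u)) ->
  (forall u, in_rect x0 x1 y0 y1 u -> B u = RtoC 0 -> In u l) ->
  (forall p, In p l -> in_interior x0 x1 y0 y1 p /\ B p = RtoC 0 /\ dB p <> RtoC 0) ->
  oint (fun u => A u / B u)%C x0 x1 y0 y1
    = (2 * RtoC PI * Ci * Clsum (fun p => A p / dB p)%C l)%C.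
Proof.
  intros Hx Hy Hnd HA HB Hz Hl.
  set (c := fun p => (A p / dB p)%C).
  set (S := fun u => Clsum (fun p => c p * / (u - p))%C l).
  assert (HAB : forall u, in_rect x0 x1 y0 y1 u -> ~ In u l -> Cdiff (fun v => A v / B v)%C u).
  { intros u Hu Hn. apply Cdiff_div; auto. eexists; now apply HB. }
  assert (He : forall u, on_edge x0 x1 y0 y1 u -> ~ In u l).
  { intros u [Hu Hu2] Hi. apply Hl in Hi. unfold in_interior in Hi. lra. }
  assert (H0 : oint (fun u => A u / B u + (- RtoC 1) * S u)%C x0 x1 y0 y1 = RtoC 0).
  { apply oint_zero_residues with l; auto.
    - intros u Hu Hn. destruct (HAB u Hu Hn) as [a Ha].
      destruct (Clsum_poles_diff c l u Hn) as [s Hs].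
      eexists. apply Cderiv_plus; [exact Ha|apply Cderiv_scal, Hs].
    - intros p Hp Hpr. destruct (Hl p Hp) as [H1 [H2 H3]]. split; [exact H1|].
      destruct (simple_pole A B p (dB p)) as [psi [d [Hd [P1 [P2 P3]]]]]; auto.
      { now apply Cdiff_cont, HA. }
      destruct (Clsum_poles_split c l p Hnd Hp) as [k [Hk HkS]].
      exists (fun u => psi u + (- RtoC 1) * (c p + (u + - p) * k u))%C, d.
      split; [exact Hd|]. split; [|split].
      + apply Ccont_plus; [exact P1|]. apply Ccont_mult; [apply Ccont_const|].
        apply Ccont_plus; [apply Ccont_const|]. apply Ccont_mult; [|exact Hk].
        apply Ccont_plus; [apply Ccont_id|apply Ccont_const].
      + rewrite P2. unfold c. ring.
      + intros u Hu. rewrite <- P3 by exact Hu. unfold S. rewrite HkS.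
        destruct Hu as [Hu _]. apply Cmod_gt_0 in Hu.
        set (q := (A u / B u)%C). field. exact Hu. }
  rewrite oint_plus in H0; try lra.
  - rewrite oint_scal in H0; try lra.
    + unfold S in H0. rewrite oint_Clsum_poles in H0; try lra.
      *
        match type of H0 with (?a + _ * ?b)%C = _ =>
          transitivity (a + - RtoC 1 * b + b)%C; [ring|rewrite H0; ring] end.
      * intros p Hp. now apply Hl.
    + intros u Hu. apply Cdiff_cont, Clsum_poles_diff. auto.
  - intros u Hu. apply Cdiff_cont, HAB; [apply Hu|auto].
  - intros u Hu. apply Ccont_mult; [apply Ccont_const|].
    apply Cdiff_cont, Clsum_poles_diff. auto.
Qed.

(** * Contour integrals of functions that jump across the real axis *)

Lemma ex_CInt_swap (g : R -> C) (a b : R) : ex_CInt g a b -> ex_CInt g b a.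
Proof. intros [H1 H2]. split; now apply ex_RInt_swap. Qed.

Lemma CInt_swap (g : R -> C) (a b : R) : ex_CInt g a b -> CInt g b a = (- CInt g a b)%C.
Proof.
  intros [H1 H2]. unfold CInt, Copp; simpl.
  f_equal; symmetry; now apply (opp_RInt_swap (V := R_CompleteNormedModule)).
Qed.

(** An affine substitution from the parameter interval [0, 1], carried out on each coordinate. *)
Lemma seg_int_h (g : C -> C) (y a b : R) : ex_CInt (fun x => g (x, y)) a b ->
  seg_int g (a, y) (b, y) = CInt (fun x => g (x, y)) a b.
Proof.
  intros [H1 H2].
  pose proof (RInt_correct (V := R_CompleteNormedModule) _ _ _ H1) as I1.
  pose proof (RInt_correct (V := R_CompleteNormedModule) _ _ _ H2) as I2.
  replace a with ((b - a) * 0 + a) in I1 at 1 by ring.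
  replace b with ((b - a) * 1 + a) in I1 at 2 by ring.
  replace a with ((b - a) * 0 + a) in I2 at 1 by ring.
  replace b with ((b - a) * 1 + a) in I2 at 2 by ring.
  apply (is_RInt_comp_lin (V := R_NormedModule)) in I1.
  apply (is_RInt_comp_lin (V := R_NormedModule)) in I2.
  unfold seg_int. apply (is_RInt_unique (V := C_R_CompleteNormedModule)).
  apply (is_RInt_fct_extend_pair (U := R_NormedModule) (V := R_NormedModule)).
  - revert I1. apply (is_RInt_ext (V := R_NormedModule)). intros t _.
    unfold scal; simpl; unfold mult; simpl.
    replace ((a, y) + RtoC t * ((b, y) - (a, y)))%C with ((b - a) * t + a, y)
      by (unfold Cplus, Cmult, Cminus, Cplus, Copp, RtoC; simpl; f_equal; ring).
    unfold Re. ring.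
  - revert I2. apply (is_RInt_ext (V := R_NormedModule)). intros t _.
    unfold scal; simpl; unfold mult; simpl.
    replace ((a, y) + RtoC t * ((b, y) - (a, y)))%C with ((b - a) * t + a, y)
      by (unfold Cplus, Cmult, Cminus, Cplus, Copp, RtoC; simpl; f_equal; ring).
    unfold Im. ring.
Qed.

Lemma seg_int_v (g : C -> C) (x a b : R) : ex_CInt (fun y => g (x, y)) a b ->
  seg_int g (x, a) (x, b) = (Ci * CInt (fun y => g (x, y)) a b)%C.
Proof.
  intros [H1 H2].
  pose proof (RInt_correct (V := R_CompleteNormedModule) _ _ _ H1) as I1.
  pose proof (RInt_correct (V := R_CompleteNormedModule) _ _ _ H2) as I2.
  replace a with ((b - a) * 0 + a) in I1 at 1 by ring.
  replace b with ((b - a) * 1 + a) in I1 at 2 by ring.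
  replace a with ((b - a) * 0 + a) in I2 at 1 by ring.
  replace b with ((b - a) * 1 + a) in I2 at 2 by ring.
  apply (is_RInt_comp_lin (V := R_NormedModule)) in I1.
  apply (is_RInt_comp_lin (V := R_NormedModule)) in I2.
  unfold seg_int. apply (is_RInt_unique (V := C_R_CompleteNormedModule)).
  assert (E : forall c d : R, (Ci * (c, d))%C = (- d, c))
    by (intros; unfold Ci, Cmult; simpl; f_equal; ring).
  unfold CInt. rewrite E.
  apply (is_RInt_fct_extend_pair (U := R_NormedModule) (V := R_NormedModule)).
  - apply (is_RInt_opp (V := R_NormedModule)) in I2. revert I2.
    apply (is_RInt_ext (V := R_NormedModule)). intros t _.
    unfold opp, scal; simpl; unfold mult; simpl.
    replace ((x, a) + RtoC t * ((x, b) - (x, a)))%C with (x, (b - a) * t + a)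
      by (unfold Cplus, Cmult, Cminus, Cplus, Copp, RtoC; simpl; f_equal; ring).
    unfold Im. ring.
  - revert I1. apply (is_RInt_ext (V := R_NormedModule)). intros t _.
    unfold scal; simpl; unfold mult; simpl.
    replace ((x, a) + RtoC t * ((x, b) - (x, a)))%C with (x, (b - a) * t + a)
      by (unfold Cplus, Cmult, Cminus, Cplus, Copp, RtoC; simpl; f_equal; ring).
    unfold Re. ring.
Qed.

Lemma rect_int_oint (g : C -> C) (x0 x1 a : R) :
  ex_CInt (fun x => g (x, - a)) x0 x1 -> ex_CInt (fun x => g (x, a)) x0 x1 ->
  ex_CInt (fun y => g (x0, y)) (- a) a -> ex_CInt (fun y => g (x1, y)) (- a) a ->
  rect_int g x0 x1 a = oint g x0 x1 (- a) a.
Proof.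
  intros H1 H2 H3 H4. unfold rect_int, oint.
  rewrite (seg_int_h g (- a)), (seg_int_v g x1), (seg_int_h g a), (seg_int_v g x0)
    by auto using ex_CInt_swap.
  rewrite (CInt_swap _ x0 x1), (CInt_swap _ (- a) a) by auto. ring.
Qed.

Lemma ex_CInt_ext (g k : R -> C) (a b : R) : a <= b ->
  (forall t, a < t < b -> g t = k t) -> ex_CInt g a b -> ex_CInt k a b.
Proof.
  intros Hab H [H1 H2]. split.
  - revert H1. apply ex_RInt_ext. intros t Ht.
    rewrite Rmin_left, Rmax_right in Ht by lra. now rewrite H.
  - revert H2. apply ex_RInt_ext. intros t Ht.
    rewrite Rmin_left, Rmax_right in Ht by lra. now rewrite H.
Qed.

Lemma ex_CInt_scal (c : C) (g : R -> C) (a b : R) : ex_CInt g a b ->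
  ex_CInt (fun t => c * g t)%C a b.
Proof.
  intros [H1 H2]. destruct c as [c1 c2]. split; simpl.
  - apply (ex_RInt_minus (V := R_NormedModule)) with
      (f := fun t => c1 * Re (g t)) (g := fun t => c2 * Im (g t));
      now apply (ex_RInt_scal (V := R_NormedModule)).
  - apply (ex_RInt_plus (V := R_NormedModule)) with
      (f := fun t => c1 * Im (g t)) (g := fun t => c2 * Re (g t));
      now apply (ex_RInt_scal (V := R_NormedModule)).
Qed.

(** Agreement on the open interval suffices. This matters for the lower half of a vertical side, at
    whose end point on the real axis [g] already takes its upper form. *)
Lemma CInt_jump (f k g : R -> C) (c : C) (a b : R) : a <= b ->
  (forall t, a < t < b -> g t = (c * f t + - RtoC 1 * k t)%C) ->
  ex_CInt f a b -> ex_CInt k a b ->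
  ex_CInt g a b /\ CInt g a b = (c * CInt f a b - CInt k a b)%C.
Proof.
  intros Hab H Hf Hk. split.
  - apply ex_CInt_ext with (fun t => c * f t + - RtoC 1 * k t)%C; auto.
    + intros t Ht. symmetry. auto.
    + apply ex_CInt_plus; now apply ex_CInt_scal.
  - rewrite (CInt_ext g (fun t => c * f t + - RtoC 1 * k t)%C) by auto.
    rewrite CInt_plus, !CInt_scal by auto using ex_CInt_scal. ring.
Qed.

Lemma ex_CInt_join (g : R -> C) (a b c : R) :
  ex_CInt g a b -> ex_CInt g b c -> ex_CInt g a c.
Proof.
  intros [H1 H2] [H3 H4]. split; eapply ex_RInt_Chasles; eauto.
Qed.

(** Applied with [k] equal to [f m] and [g] equal to [f delta]. Closing the two half rectangles
    brings in the real segment twice with weight 1/2 and the same sign; the [CInt] term compensates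
    for both. *)
Lemma rect_int_jump (f k g : C -> C) (x0 x1 a : R) : x0 < x1 -> 0 < a ->
  (forall u, on_edge x0 x1 (- a) a u -> Ccont f u) ->
  (forall u, on_edge x0 x1 (- a) a u -> Ccont k u) ->
  (forall u, 0 <= Im u -> g u = (RtoC (- 1 / 2) * f u + - RtoC 1 * k u)%C) ->
  (forall u, Im u < 0 -> g u = (RtoC (1 / 2) * f u + - RtoC 1 * k u)%C) ->
  rect_int g x0 x1 a =
    (RtoC (1 / 2) * oint f x0 x1 (- a) 0 + RtoC (- 1 / 2) * oint f x0 x1 0 a
     + CInt (fun x => f (x, 0)) x0 x1 - oint k x0 x1 (- a) a)%C.
Proof.
  intros Hx Ha Hf Hk Hup Hdn.
  destruct (ex_CInt_edges x0 x1 (- a) a ltac:(lra) ltac:(lra) f Hf) as [F1 [F2 [F3 F4]]].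
  destruct (ex_CInt_edges x0 x1 (- a) a ltac:(lra) ltac:(lra) k Hk) as [K1 [K2 [K3 K4]]].
  assert (V : forall (w : C -> C) x, x = x0 \/ x = x1 ->
            (forall u, on_edge x0 x1 (- a) a u -> Ccont w u) ->
            ex_CInt (fun y => w (x, y)) (- a) 0 /\ ex_CInt (fun y => w (x, y)) 0 a).
  { intros w x Hxx Hw. split; apply ex_CInt_v; try lra; intros y Hy; apply Hw;
      unfold on_edge, in_rect; simpl; lra. }
  destruct (V f x0) as [F5 F6]; auto. destruct (V f x1) as [F7 F8]; auto.
  destruct (V k x0) as [K5 K6]; auto. destruct (V k x1) as [K7 K8]; auto.
  destruct (CInt_jump (fun x => f (x, - a)) (fun x => k (x, - a)) (fun x => g (x, - a))
              (RtoC (1 / 2)) x0 x1) as [G1 E1]; auto; try lra.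
  { intros t _. apply Hdn. simpl. lra. }
  destruct (CInt_jump (fun x => f (x, a)) (fun x => k (x, a)) (fun x => g (x, a))
              (RtoC (- 1 / 2)) x0 x1) as [G2 E2]; auto; try lra.
  { intros t _. apply Hup. simpl. lra. }
  destruct (CInt_jump (fun y => f (x0, y)) (fun y => k (x0, y)) (fun y => g (x0, y))
              (RtoC (1 / 2)) (- a) 0) as [G3 E3]; auto; try lra.
  { intros t Ht. apply Hdn. simpl. lra. }
  destruct (CInt_jump (fun y => f (x0, y)) (fun y => k (x0, y)) (fun y => g (x0, y))
              (RtoC (- 1 / 2)) 0 a) as [G4 E4]; auto; try lra.
  { intros t Ht. apply Hup. simpl. lra. }
  destruct (CInt_jump (fun y => f (x1, y)) (fun y => k (x1, y)) (fun y => g (x1, y))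
              (RtoC (1 / 2)) (- a) 0) as [G5 E5]; auto; try lra.
  { intros t Ht. apply Hdn. simpl. lra. }
  destruct (CInt_jump (fun y => f (x1, y)) (fun y => k (x1, y)) (fun y => g (x1, y))
              (RtoC (- 1 / 2)) 0 a) as [G6 E6]; auto; try lra.
  { intros t Ht. apply Hup. simpl. lra. }
  rewrite rect_int_oint; eauto using ex_CInt_join.
  unfold oint. rewrite E1, E2.
  rewrite <- (CInt_Chasles (fun y => g (x0, y)) (- a) 0 a),
    <- (CInt_Chasles (fun y => g (x1, y)) (- a) 0 a),
    <- (CInt_Chasles (fun y => k (x0, y)) (- a) 0 a),
    <- (CInt_Chasles (fun y => k (x1, y)) (- a) 0 a) by auto.
  rewrite E3, E4, E5, E6.
  replace (RtoC (- 1 / 2)) with (- RtoC (1 / 2))%C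
    by (rewrite <- RtoC_opp; f_equal; field).
  set (H0 := CInt (fun x => f (x, 0)) x0 x1).
  replace H0 with (RtoC (1 / 2) * H0 + RtoC (1 / 2) * H0)%C at 3.
  - ring.
  - rewrite <- Cmult_plus_distr_r, <- RtoC_plus. replace (1 / 2 + 1 / 2) with 1 by field. ring.
Qed.

(** * The complex sine and cotangent *)

Lemma Cexp_RtoC (x : R) : Cexp (RtoC x) = RtoC (exp x).
Proof. unfold Cexp, RtoC; simpl. rewrite cos_0, sin_0. f_equal; ring. Qed.

Lemma Csqrt_RtoC (x : R) : 0 <= x -> Csqrt (RtoC x) = RtoC (sqrt x).
Proof.
  intros Hx. unfold Csqrt. rewrite Cmod_R, Rabs_pos_eq by exact Hx. simpl.
  replace ((x + x) / 2) with x by field. replace ((x - x) / 2) with 0 by field.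
  rewrite sqrt_0. unfold RtoC. f_equal. destruct (Rle_dec 0 0); lra.
Qed.

Lemma Ci_sqr : (Ci * Ci)%C = (- RtoC 1)%C.
Proof. unfold Ci, Cmult, Copp, RtoC; simpl. f_equal; ring. Qed.

Lemma Ci_neq_0 : Ci <> RtoC 0.
Proof. intros E. injection E. lra. Qed.

Lemma RtoC_2_neq_0 : RtoC 2 <> RtoC 0.
Proof. apply RtoC_neq_0. lra. Qed.

Lemma Cderiv_ext (g k : C -> C) (p l : C) : (forall u, g u = k u) ->
  Cderiv g p l -> Cderiv k p l.
Proof.
  intros E [phi [d [Hd [H1 [H2 H3]]]]]. exists phi, d. repeat split; auto.
  intros u Hu. rewrite <- !E. auto.
Qed.

Lemma Csin_deriv (w : C) : Cderiv Csin w (Ccos w).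
Proof.
  assert (E : forall a, Cderiv (fun v => Cexp (a * v))%C w (a * Cexp (a * w))).
  { intros a. eapply Cderiv_eq; [|apply (Cderiv_comp Cexp (fun v => a * v)%C);
      [apply Cderiv_scal, Cderiv_id|apply Cexp_deriv]]. cbv beta. ring. }
  apply Cderiv_ext with
    (fun v => / (2 * Ci) * (Cexp (Ci * v) + - RtoC 1 * Cexp (- Ci * v)))%C.
  - intros v. unfold Csin, Cdiv. replace (- (Ci * v))%C with (- Ci * v)%C by ring. ring.
  - eapply Cderiv_eq; [|apply Cderiv_scal, Cderiv_plus; [apply E|apply Cderiv_scal, E]].
    unfold Ccos. replace (- (Ci * w))%C with (- Ci * w)%C by ring. field.
    auto using Ci_neq_0, RtoC_2_neq_0.
Qed.

Lemma Ccos_diff (w : C) : Cdiff Ccos w.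
Proof.
  assert (E : forall a, Cderiv (fun v => Cexp (a * v))%C w (a * Cexp (a * w))).
  { intros a. eapply Cderiv_eq; [|apply (Cderiv_comp Cexp (fun v => a * v)%C);
      [apply Cderiv_scal, Cderiv_id|apply Cexp_deriv]]. cbv beta. ring. }
  eexists. apply Cderiv_ext with
    (fun v => / 2 * (Cexp (Ci * v) + Cexp (- Ci * v)))%C.
  - intros v. unfold Ccos, Cdiv. replace (- (Ci * v))%C with (- Ci * v)%C by ring. ring.
  - apply Cderiv_scal, Cderiv_plus; apply E.
Qed.

Lemma Cexp_opp_r (a : C) : (Cexp a * Cexp (- a))%C = RtoC 1.
Proof. rewrite <- Cexp_plus. replace (a + - a)%C with (RtoC 0) by ring. apply Cexp_0. Qed.

Lemma Ccos2_Csin2 (w : C) : (Ccos w * Ccos w + Csin w * Csin w)%C = RtoC 1.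
Proof.
  unfold Ccos, Csin. rewrite <- (Cexp_opp_r (Ci * w)).
  set (X := Cexp (Ci * w)). set (Y := Cexp (- (Ci * w))).
  replace ((X - Y) / (2 * Ci) * ((X - Y) / (2 * Ci)))%C
    with ((X - Y) * (X - Y) / (2 * 2 * (Ci * Ci)))%C
    by (field; auto using Ci_neq_0, RtoC_2_neq_0).
  rewrite Ci_sqr. field.
Qed.

(** At a zero, [exp (i w) = exp (- i w)]: equal moduli make [w] real, and equal imaginary parts
    reduce the claim to the real sine. *)
Lemma Csin_eq_0 (w : C) : Csin w = RtoC 0 -> Im w = 0 /\ exists k : Z, Re w = IZR k * PI.
Proof.
  intros H.
  assert (E : Cexp (Ci * w) = Cexp (- (Ci * w))).
  { unfold Csin in H.
    replace (Cexp (Ci * w)) with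
      ((Cexp (Ci * w) - Cexp (- (Ci * w))) / (2 * Ci) * (2 * Ci) + Cexp (- (Ci * w)))%C
      by (field; auto using Ci_neq_0, RtoC_2_neq_0).
    rewrite H. ring. }
  assert (Hb : Im w = 0).
  { apply (f_equal Cmod) in E. rewrite !Cmod_Cexp in E. apply exp_inv in E.
    destruct w as [a b]. simpl in *. lra. }
  split; [exact Hb|]. apply sin_eq_0_0.
  destruct w as [a b]. simpl in *. subst b.
  apply (f_equal Im) in E. unfold Cexp in E. simpl in E.
  replace (0 * a + 1 * 0) with (0 * 0 - 0) in E by ring.
  replace (0 * a - 1 * 0) with 0 in E by ring.
  revert E. replace (- 0) with 0 by ring. replace (0 * 0 + 1 * a) with a by ring.
  replace (0 * 0 - 0) with 0 by ring.
  rewrite ?exp_0, ?sin_neg. lra.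
Qed.

Lemma Csin_IZR (k : Z) : Csin (RtoC (IZR k * PI)) = RtoC 0.
Proof.
  assert (E : sin (IZR k * PI) = 0) by (apply sin_eq_0_1; now exists k).
  unfold Csin.
  replace (Cexp (Ci * RtoC (IZR k * PI))) with (Cexp (- (Ci * RtoC (IZR k * PI)))).
  - unfold Cdiv. ring.
  - unfold Cexp, Ci, Cmult, Copp, RtoC; simpl.
    replace (0 * (IZR k * PI) - 1 * 0) with 0 by ring.
    replace (0 * 0 + 1 * (IZR k * PI)) with (IZR k * PI) by ring.
    rewrite cos_neg, sin_neg, E. rewrite Ropp_0. reflexivity.
Qed.

Definition phase (beta : R) (u : C) : C := (RtoC PI * u / RtoC (hh beta))%C.

Lemma hh_pos (beta : R) : beta < 2 -> 0 < hh beta.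
Proof. intros H. unfold hh. pose proof PI_RGT_0. apply Rmult_lt_0_compat; nra. Qed.

Lemma phase_eq (beta : R) (u : C) : beta < 2 ->
  phase beta u = (PI * Re u / hh beta, PI * Im u / hh beta).
Proof.
  intros H. pose proof (hh_pos beta H). unfold phase, Cdiv.
  rewrite <- RtoC_inv by lra. destruct u as [a b].
  unfold Cmult, RtoC; simpl. f_equal; field; lra.
Qed.

Lemma phase_deriv (beta : R) (u : C) : Cderiv (phase beta) u (RtoC PI / RtoC (hh beta)).
Proof.
  apply Cderiv_ext with (fun v => RtoC PI / RtoC (hh beta) * v)%C.
  - intros v. unfold phase, Cdiv. ring.
  - eapply Cderiv_eq; [|apply Cderiv_scal, Cderiv_id]. ring.
Qed.

(* On the upper half plane [- 1/2 - m_cot] is [Q / (1 - Q)] with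
   [Q = exp (2 i phase)], which is small where [Q] is; similarly below. *)
Lemma m_cot_upper (beta : R) (u : C) (P : R) : beta < 2 -> 1 <= P ->
  P <= 2 * (PI * Im u / hh beta) ->
  Cmod (RtoC (- 1 / 2) - m_cot beta u) <= 2 * exp (- P).
Proof.
  intros Hb HP1 HP. unfold m_cot. fold (phase beta u).
  pose proof (phase_eq beta u Hb) as Ev. set (v := phase beta u) in *.
  set (t := PI * Im u / hh beta) in *.
  unfold Ccot, Ccos, Csin.
  assert (HX : Cmod (Cexp (Ci * v)) = exp (- t)).
  { rewrite Cmod_Cexp, Ev. f_equal. simpl. ring. }
  assert (HY : Cmod (Cexp (- (Ci * v))) = exp t).
  { rewrite Cmod_Cexp, Ev. f_equal. simpl. ring. }
  set (X := Cexp (Ci * v)) in *. set (Y := Cexp (- (Ci * v))) in *.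
  pose proof (Cmod_reverse Y X) as Hr. rewrite HX, HY in Hr.
  assert (Ht : exp (- t) <= exp t * exp (- P)).
  { rewrite <- exp_plus. destruct (Req_dec (- t) (t + - P)) as [E|E]; [rewrite E; lra|].
    left. apply exp_increasing. lra. }
  (* This keeps the denominator [Y - X] at least half as large as [Y]. *)
  assert (HP2 : exp (- P) <= 1 / 2).
  { rewrite exp_Ropp. pose proof (exp_ineq1_le P).
    replace (1 / 2) with (/ 2) by field. apply Rinv_le_contravar; lra. }
  pose proof (exp_pos t). pose proof (exp_pos (- t)). pose proof (exp_pos (- P)).
  assert (HYX : (Y - X)%C <> RtoC 0) by (apply Cmod_gt_0; nra).
  assert (HXY : (X - Y)%C <> RtoC 0).
  { intros E. apply HYX. replace (Y - X)%C with (- (X - Y))%C by ring. rewrite E. ring. }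
  replace (RtoC (- 1 / 2)) with (- / 2)%C
    by (rewrite <- RtoC_inv, <- RtoC_opp by lra; f_equal; field).
  replace (- / 2 - - (Ci / 2) * ((X + Y) / 2 / ((X - Y) / (2 * Ci))))%C
    with (- / 2 + (Ci * Ci) / 2 * ((X + Y) / (X - Y)))%C
    by (field; auto using Ci_neq_0, RtoC_2_neq_0).
  rewrite Ci_sqr.
  replace (- / 2 + - (1) / 2 * ((X + Y) / (X - Y)))%C with (X / (Y - X))%C
    by (field; auto using RtoC_2_neq_0).
  rewrite Cmod_div by exact HYX. rewrite HX.
  apply Rmult_le_reg_r with (Cmod (Y - X)); [now apply Cmod_gt_0|].
  unfold Rdiv. rewrite Rmult_assoc, Rinv_l, Rmult_1_r by (apply Rgt_not_eq; now apply Cmod_gt_0).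
  apply Rle_trans with (2 * exp (- P) * (exp t - exp (- t))); [|apply Rmult_le_compat_l; lra].
  nra.
Qed.

(** The cotangent is odd, which reduces this to the upper half plane. *)
Lemma m_cot_lower (beta : R) (u : C) (P : R) : beta < 2 -> 1 <= P ->
  P <= 2 * (PI * (- Im u) / hh beta) ->
  Cmod (RtoC (1 / 2) - m_cot beta u) <= 2 * exp (- P).
Proof.
  intros Hb HP1 HP.
  assert (E : m_cot beta (- u) = (- m_cot beta u)%C).
  { unfold m_cot. fold (phase beta u) (phase beta (- u)).
    replace (phase beta (- u)) with (- phase beta u)%C
      by (unfold phase, Cdiv; ring).
    set (v := phase beta u). unfold Ccot, Ccos, Csin.
    replace (Ci * - v)%C with (- (Ci * v))%C by ring.
    replace (- - (Ci * v))%C with (Ci * v)%C by ring.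
    set (X := Cexp (Ci * v)). set (Y := Cexp (- (Ci * v))).
    (* At a pole of the cotangent both sides are 0, because the inverse of 0 is 0. *)
    destruct (classic ((X - Y)%C = RtoC 0)) as [H0|H0].
    - assert (E : (Y - X)%C = RtoC 0)
        by (replace (Y - X)%C with (- (X - Y))%C by ring; rewrite H0; ring).
      rewrite E, H0. unfold Cdiv. rewrite Cmult_0_l.
      assert (Hi : (/ RtoC 0)%C = RtoC 0).
      { unfold Cinv, RtoC; simpl. f_equal; unfold Rdiv; ring. }
      rewrite Hi. ring.
    - field. repeat split; auto using Ci_neq_0, RtoC_2_neq_0.
      intros E. apply H0. replace (X - Y)%C with (- (Y - X))%C by ring. rewrite E. ring. }
  pose proof (m_cot_upper beta (- u) P Hb HP1) as H.
  rewrite E in H. rewrite Cmod_minus_sym.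
  replace (m_cot beta u - RtoC (1 / 2))%C with (RtoC (- 1 / 2) - - m_cot beta u)%C.
  - apply H. destruct u; exact HP.
  - replace (- 1 / 2) with (- (1 / 2)) by field. rewrite RtoC_opp. ring.
Qed.

(** * The quadrature error as a contour integral *)

Definition sg (s : bool) : R := if s then 1 else -1.

Lemma sg_cases (s : bool) : sg s = 1 \/ sg s = -1.
Proof. destruct s; simpl; auto. Qed.

Lemma ray_pt_eq (beta : R) (s : bool) (r : R) :
  ray_pt beta s r = (r * cos (sg s * beta * PI / 2), r * sin (sg s * beta * PI / 2)).
Proof.
  unfold ray_pt, Cexp, Cmult, RtoC; simpl. rewrite exp_0. unfold sg. f_equal; ring.
Qed.

(** From the Leibniz series. The poles must lie to the right of the left edge of Gamma; for
    [beta = 0] and [P = 2] this amounts to [PI ^ 2 < 12], for which 17/5 is sharp enough. *)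
Lemma PI_lt_17_5 : PI < 17 / 5.
Proof.
  pose proof (PI_ineq 2) as [_ H]. unfold tg_alt, PI_tg in H. simpl in H. lra.
Qed.

Lemma four_TT_sqr (beta : R) (Nt : nat) : beta < 2 -> 4 * TT beta Nt ^ 2 = INR Nt * hh beta.
Proof.
  intros H. pose proof (hh_pos beta H). pose proof (pos_INR Nt).
  unfold TT. rewrite <- Rsqr_pow2, Rsqr_sqrt by nra. field.
Qed.

Section Contour.
Variables (beta : R) (Nt : nat) (s : bool) (r : R).
Hypothesis Hbeta : 0 <= beta < 2.
Hypothesis Hr : exp (4 + 2 * beta - 2 * TT beta Nt) <= r <= 1.

Let T := TT beta Nt.
Let z := ray_pt beta s r.
Let P := T + ln r / 2.
Let phi := sg s * beta * PI / 2.
Let x0 := 1 - beta / 2.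
Let x1 := 4 * T ^ 2 + 1 - beta / 2.
Let a := 2 * PI * P.

Lemma r_pos : 0 < r.
Proof. eapply Rlt_le_trans; [apply exp_pos|apply Hr]. Qed.

Lemma P_bounds : 2 + beta <= P <= T.
Proof.
  pose proof r_pos. destruct Hr as [H1 H2].
  assert (4 + 2 * beta - 2 * T <= ln r).
  { rewrite <- (ln_exp (4 + 2 * beta - 2 * T)). apply ln_le; [apply exp_pos|exact H1]. }
  assert (ln r <= 0) by (rewrite <- ln_1; now apply ln_le).
  unfold P. lra.
Qed.

Lemma x0_lt_x1 : 0 < x0 < x1.
Proof. pose proof P_bounds. unfold x1, x0. simpl. nra. Qed.

Lemma a_pos : 0 < a.
Proof. pose proof P_bounds. pose proof PI_RGT_0. unfold a. nra. Qed.

(** * The poles of [f] inside Gamma *)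

Definition den (u : C) : C := (Cexp (2 * (Csqrt u - RtoC T)) + z)%C.
Definition num (u : C) : C := (z / RtoC PI * / Csqrt u * Cexp (Csqrt u - RtoC T))%C.
Definition dden (u : C) : C := (Cexp (2 * (Csqrt u - RtoC T)) / Csqrt u)%C.

(** A pole is recorded by the imaginary part of its square root, as the real part is always [P];
    [qa] belongs to the upper and [qb] to the lower half plane. *)
Definition pole (q : R) : C := ((P, q) * (P, q))%C.
Definition qa : R := PI * (1 / 2 + sg s * beta / 4).
Definition qb : R := - (PI * (1 / 2 - sg s * beta / 4)).

Lemma z_neq_0 : z <> RtoC 0.
Proof.
  apply Cmod_gt_0. unfold z, ray_pt. rewrite Cmod_mult, Cmod_R, Cmod_Cexp.
  pose proof r_pos. rewrite Rabs_pos_eq by lra. simpl. rewrite exp_0. lra.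
Qed.

Lemma shift_deriv (u : C) : 0 < Re u ->
  Cderiv (fun v => Csqrt v + - RtoC T)%C u (/ (2 * Csqrt u)).
Proof.
  intros Hu. eapply Cderiv_eq; [|apply Cderiv_plus; [now apply Csqrt_deriv|apply Cderiv_const]].
  ring.
Qed.

Lemma den_deriv (u : C) : 0 < Re u -> Cderiv den u (dden u).
Proof.
  intros Hu. eapply Cderiv_eq; [|apply Cderiv_plus; [|apply Cderiv_const]].
  2: { apply (Cderiv_comp Cexp (fun v => 2 * (Csqrt v - RtoC T))%C); [|apply Cexp_deriv].
       apply Cderiv_scal. now apply shift_deriv. }
  unfold dden. field. now apply Csqrt_neq_0.
Qed.

Lemma num_diff (u : C) : 0 < Re u -> Cdiff num u.
Proof.
  intros Hu. eexists. apply Cderiv_mult.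
  - apply Cderiv_mult; [apply Cderiv_const|].
    apply Cderiv_inv; [now apply Csqrt_neq_0|now apply Csqrt_deriv].
  - apply (Cderiv_comp Cexp (fun v => Csqrt v - RtoC T)%C); [|apply Cexp_deriv].
    now apply shift_deriv.
Qed.

Lemma Csqrt_pole (q : R) : Csqrt (pole q) = (P, q).
Proof. apply Csqrt_sqr. pose proof P_bounds. lra. Qed.

Lemma Cexp_pole (q : R) :
  Cexp (2 * ((P, q) - RtoC T)) = (r * cos (2 * q), r * sin (2 * q)).
Proof.
  replace (2 * ((P, q) - RtoC T))%C with (ln r, 2 * q).
  - unfold Cexp; simpl. now rewrite exp_ln by apply r_pos.
  - unfold P, Cmult, Cminus, Cplus, Copp, RtoC; simpl. f_equal; field.
Qed.

Lemma q_double : 2 * qa = phi + PI /\ 2 * qb = - (PI - phi).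
Proof. unfold qa, qb, phi. split; field. Qed.

Lemma Cexp_qab (q : R) : q = qa \/ q = qb -> Cexp (2 * ((P, q) - RtoC T)) = (- z)%C.
Proof.
  intros Hq. rewrite Cexp_pole. unfold z. rewrite ray_pt_eq. fold phi.
  destruct q_double as [E1 E2].
  destruct Hq as [->| ->]; [rewrite E1|rewrite E2].
  - rewrite neg_cos, neg_sin. unfold Copp; simpl. f_equal; ring.
  - rewrite cos_neg, sin_neg, Rtrigo_facts.cos_pi_minus, Rtrigo_facts.sin_pi_minus.
    unfold Copp; simpl. f_equal; ring.
Qed.

Lemma den_pole (q : R) : q = qa \/ q = qb -> den (pole q) = RtoC 0.
Proof. intros Hq. unfold den. rewrite Csqrt_pole, Cexp_qab by exact Hq. ring. Qed.

Lemma dden_neq_0 (u : C) : 0 < Re u -> dden u <> RtoC 0.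
Proof.
  intros Hu. unfold dden, Cdiv. apply Cmult_neq_0; [apply Cexp_neq_0|].
  apply Cmod_gt_0. rewrite Cmod_inv by now apply Csqrt_neq_0.
  apply Rinv_0_lt_compat, Cmod_gt_0. now apply Csqrt_neq_0.
Qed.

(** The distance of [qa] and [qb] from 0 decides the size of [delta] at the poles; the bounds away
    from 0 keep the poles inside Gamma. *)
Lemma qab_bounds : PI * (2 - beta) / 4 <= qa < PI /\ - PI < qb <= - (PI * (2 - beta) / 4) /\
  qa <= PI * (2 + beta) / 4 /\ - (PI * (2 + beta) / 4) <= qb.
Proof.
  unfold qa, qb. pose proof PI_RGT_0.
  destruct (sg_cases s) as [-> | ->]; repeat split; nra.
Qed.

Lemma pole_interior (q : R) : q = qa \/ q = qb -> in_interior x0 x1 (- a) a (pole q).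
Proof.
  intros Hq. destruct qab_bounds as [[A1 A2] [[A3 A4] [A5 A6]]].
  pose proof PI_RGT_0. pose proof PI_lt_17_5. destruct P_bounds as [B1 B2].
  assert (Hq1 : - PI < q < PI) by (destruct Hq as [->| ->]; nra).
  assert (Hq2 : - (PI * (2 + beta) / 4) <= q <= PI * (2 + beta) / 4)
    by (destruct Hq as [->| ->]; nra).
  unfold in_interior, pole, x0, x1, a; simpl.
  assert (Hqq : q * q <= (PI * (2 + beta) / 4) * (PI * (2 + beta) / 4)) by nra.
  assert (HPI : PI * PI <= 17 / 5 * (17 / 5)) by nra.
  assert (H4 : 4 <= (2 + beta) * (2 + beta)) by nra.
  (* 289/400 is the square of 17/20, with 17/5 for [PI]. The real part [P * P - q * q] is then at
     least [111 / 400 * (2 + beta) ^ 2 >= 111 / 100], beyond the left edge. *)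
  assert (Hqq2 : q * q <= 289 / 400 * ((2 + beta) * (2 + beta))) by nra.
  assert (HPP : (2 + beta) * (2 + beta) <= P * P) by nra.
  assert (HTT : P * P <= T * T) by nra.
  repeat split; nra.
Qed.

Lemma Re_pos_in_rect (y0 y1 : R) (u : C) : in_rect x0 x1 y0 y1 u -> 0 < Re u.
Proof. intros [[H _] _]. pose proof x0_lt_x1. lra. Qed.

(** The range is that of [2 * q - phi] for [|q| <= PI] and [|phi| < PI]. *)
Lemma cos_eq_m1 (x : R) : cos x = -1 -> - (3 * PI) < x < 3 * PI -> x = PI \/ x = - PI.
Proof.
  intros H Hx. pose proof PI_RGT_0.
  assert (E : cos (x / 2) = 0).
  { replace x with (2 * (x / 2)) in H by field. rewrite cos_2a_cos in H. nra. }
  apply cos_eq_0_0 in E. destruct E as [k E].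
  assert (-2 < IZR k < 1).
  { split; apply Rmult_lt_reg_r with PI; lra. }
  assert (Hk : (k = 0 \/ k = -1)%Z).
  { destruct H1 as [K1 K2]. apply lt_IZR in K1. apply lt_IZR in K2. lia. }
  destruct Hk as [-> | ->]; [left|right]; lra.
Qed.

(** Comparing moduli forces the real part of the root to be [P]. The bound [2 * PI * P] on the
    imaginary part of [u] then reads [|q| <= PI], and comparing arguments leaves only [qa] and
    [qb]. *)
Lemma den_zero (u : C) : in_rect x0 x1 (- a) a u -> den u = RtoC 0 ->
  u = pole qa \/ u = pole qb.
Proof.
  intros Hu H0. pose proof (Re_pos_in_rect _ _ _ Hu) as Hre.
  destruct (Csqrt_spec u Hre) as [Hp Hsq]. unfold den in H0.
  destruct (Csqrt u) as [p q]. simpl in Hp.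
  pose proof PI_RGT_0. destruct P_bounds as [B1 B2]. pose proof r_pos.
  assert (E : Cexp (2 * ((p, q) - RtoC T)) = (- z)%C).
  { replace (Cexp (2 * ((p, q) - RtoC T)))
      with (Cexp (2 * ((p, q) - RtoC T)) + z - z)%C by ring. rewrite H0. ring. }
  assert (HpP : p = P).
  { pose proof (f_equal Cmod E) as Em.
    rewrite Cmod_Cexp, Cmod_opp in Em. unfold z, ray_pt in Em.
    rewrite Cmod_mult, Cmod_R, Cmod_Cexp, Rabs_pos_eq in Em by lra.
    simpl in Em. rewrite exp_0, Rmult_1_r in Em.
    apply (f_equal ln) in Em. rewrite ln_exp in Em. unfold P. lra. }
  subst p. rewrite Cexp_pole in E. unfold z in E. rewrite ray_pt_eq in E. fold phi in E.
  unfold Copp in E. simpl in E.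
  injection E as E1 E2.
  assert (C1 : cos (2 * q) = - cos phi) by (apply Rmult_eq_reg_l with r; lra).
  assert (C2 : sin (2 * q) = - sin phi) by (apply Rmult_eq_reg_l with r; lra).
  assert (C3 : cos (2 * q - phi) = -1).
  { rewrite cos_minus, C1, C2. pose proof (sin2_cos2 phi). unfold Rsqr in *. lra. }
  assert (Him : Im u = 2 * P * q) by (rewrite <- Hsq; simpl; ring).
  destruct Hu as [_ [Hu1 Hu2]]. rewrite Him in Hu1, Hu2. unfold a in Hu1, Hu2.
  assert (Hq : - PI <= q <= PI).
  { split; apply Rmult_le_reg_l with (2 * P); lra. }
  assert (Hphi : - PI < phi < PI).
  { unfold phi. destruct (sg_cases s) as [-> | ->]; nra. }
  destruct q_double as [D1 D2].
  destruct (cos_eq_m1 _ C3) as [F|F]; [lra| |].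
  - left. rewrite <- Hsq. replace q with qa by lra. reflexivity.
  - right. rewrite <- Hsq. replace q with qb by lra. reflexivity.
Qed.

Lemma f_uz_eq (u : C) : f_uz beta Nt u z = (num u / den u)%C.
Proof. reflexivity. Qed.

(** At a pole the exponential in [dden] equals [- z], which cancels the factor [z] of [num]; the
    square roots cancel as well. *)
Lemma f_residue (q : R) : q = qa \/ q = qb ->
  (num (pole q) / dden (pole q))%C = (- (Cexp ((ln r / 2)%R, q) / RtoC PI))%C.
Proof.
  intros Hq. unfold num, dden. rewrite Csqrt_pole, Cexp_qab by exact Hq.
  replace ((P, q) - RtoC T)%C with (ln r / 2, q)
    by (unfold P, Cminus, Cplus, Copp, RtoC; simpl; f_equal; ring).
  pose proof PI_RGT_0. pose proof z_neq_0.
  assert (RtoC PI <> RtoC 0) by (apply RtoC_neq_0; lra).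
  assert ((P, q) <> RtoC 0) by (intros E; injection E; destruct P_bounds; lra).
  field. auto.
Qed.

Lemma oint_f_upper : oint (fun u => num u / den u)%C x0 x1 0 a
  = (2 * RtoC PI * Ci * (num (pole qa) / dden (pole qa)))%C.
Proof.
  pose proof x0_lt_x1. pose proof a_pos. pose proof PI_RGT_0.
  destruct qab_bounds as [[A1 A2] [[A3 A4] _]]. destruct P_bounds as [B1 B2].
  assert (Hqa : 0 < qa) by nra. assert (Hqb : qb < 0) by nra.
  rewrite (residue_theorem num den dden (pole qa :: nil)); try lra.
  - simpl. ring.
  - repeat constructor. intros [].
  - intros u Hu. apply num_diff. eapply Re_pos_in_rect, Hu.
  - intros u Hu. apply den_deriv. eapply Re_pos_in_rect, Hu.
  - intros u Hu Hd. destruct (den_zero u) as [->| ->]; auto.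
    + unfold in_rect in *. lra.
    + now left.
    + exfalso. destruct Hu as [_ [Hu _]]. unfold pole in Hu. simpl in Hu. nra.
  - intros p [<-|[]].
    destruct (pole_interior qa (or_introl eq_refl)) as [[I1 I2] [I3 I4]].
    split; [|split].
    + unfold in_interior. repeat split; auto. unfold pole; simpl. nra.
    + apply den_pole. now left.
    + apply dden_neq_0. lra.
Qed.

Lemma oint_f_lower : oint (fun u => num u / den u)%C x0 x1 (- a) 0
  = (2 * RtoC PI * Ci * (num (pole qb) / dden (pole qb)))%C.
Proof.
  pose proof x0_lt_x1. pose proof a_pos. pose proof PI_RGT_0.
  destruct qab_bounds as [[A1 A2] [[A3 A4] _]]. destruct P_bounds as [B1 B2].
  assert (Hqa : 0 < qa) by nra. assert (Hqb : qb < 0) by nra.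
  rewrite (residue_theorem num den dden (pole qb :: nil)); try lra.
  - simpl. ring.
  - repeat constructor. intros [].
  - intros u Hu. apply num_diff. eapply Re_pos_in_rect, Hu.
  - intros u Hu. apply den_deriv. eapply Re_pos_in_rect, Hu.
  - intros u Hu Hd. destruct (den_zero u) as [->| ->]; auto.
    + unfold in_rect in *. lra.
    + exfalso. destruct Hu as [_ [_ Hu]]. unfold pole in Hu. simpl in Hu. nra.
    + now left.
  - intros p [<-|[]].
    destruct (pole_interior qb (or_intror eq_refl)) as [[I1 I2] [I3 I4]].
    split; [|split].
    + unfold in_interior. repeat split; auto. unfold pole; simpl. nra.
    + apply den_pole. now right.
    + apply dden_neq_0. lra.
Qed.

(** * The nodes and the poles of [f m] *)

Definition node (j : nat) : C := RtoC (INR j * hh beta).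

(** [f m] as a single quotient, to which the residue theorem applies: the zeros of [den] lie off the
    real axis and those of the sine on it, so the zeros of the product remain simple. *)
Definition anum (u : C) : C := (num u * (- (Ci / 2) * Ccos (phase beta u)))%C.
Definition aden (u : C) : C := (den u * Csin (phase beta u))%C.
Definition daden (u : C) : C :=
  (dden u * Csin (phase beta u)
   + den u * (Ccos (phase beta u) * (RtoC PI / RtoC (hh beta))))%C.

Lemma phase_node (j : nat) : phase beta (node j) = RtoC (IZR (Z.of_nat j) * PI).
Proof.
  pose proof (hh_pos beta (proj2 Hbeta)).
  rewrite phase_eq by apply Hbeta. unfold node, RtoC; simpl. rewrite <- INR_IZR_INZ.
  f_equal; field; lra.
Qed.

Lemma Csin_node (j : nat) : Csin (phase beta (node j)) = RtoC 0.
Proof. rewrite phase_node. apply Csin_IZR. Qed.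

Lemma Ccos_node_neq_0 (j : nat) : Ccos (phase beta (node j)) <> RtoC 0.
Proof.
  intros E. pose proof (Ccos2_Csin2 (phase beta (node j))) as H.
  rewrite E, Csin_node in H. apply (f_equal Re) in H. simpl in H. lra.
Qed.

Lemma Csin_zero_node (u : C) : in_rect x0 x1 (- a) a u -> Csin (phase beta u) = RtoC 0 ->
  exists j, (1 <= j <= Nt)%nat /\ u = node j.
Proof.
  intros [[Hu1 Hu2] _] H. apply Csin_eq_0 in H. rewrite phase_eq in H by apply Hbeta.
  simpl in H. destruct H as [H1 [k H2]].
  pose proof (hh_pos beta (proj2 Hbeta)) as Hh. pose proof PI_RGT_0 as Hpi.
  assert (Him : Im u = 0).
  { apply Rmult_eq_reg_l with (PI / hh beta).
    - rewrite Rmult_0_r, <- H1. field. lra.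
    - apply Rgt_not_eq, Rdiv_lt_0_compat; lra. }
  assert (Hre : Re u = IZR k * hh beta).
  { apply Rmult_eq_reg_l with (PI / hh beta).
    - transitivity (IZR k * PI); [rewrite <- H2|]; field; lra.
    - apply Rgt_not_eq, Rdiv_lt_0_compat; lra. }
  pose proof x0_lt_x1 as Hx.
  assert (K1 : 0 < IZR k) by (apply Rmult_lt_reg_r with (hh beta); lra).
  assert (K2 : IZR k < INR Nt + 1).
  { apply Rmult_lt_reg_r with (hh beta); [exact Hh|].
    rewrite Rmult_plus_distr_r, <- four_TT_sqr, <- Hre by apply Hbeta.
    unfold x1, T in Hu2. unfold hh.
    (* The offset [1 - beta / 2] equals [hh beta / (2 * PI ^ 2)], less than one step, so the node of
       index [Nt + 1] stays outside. *)
    pose proof PI2_3_2. assert (1 < PI ^ 2) by (simpl; nra). nra. }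
  exists (Z.to_nat k). apply lt_IZR in K1.
  rewrite INR_IZR_INZ, <- plus_IZR in K2. apply lt_IZR in K2. split.
  - lia.
  - unfold node. rewrite INR_IZR_INZ, Z2Nat.id, <- Hre by lia.
    destruct u as [x y]. simpl in *. subst y. reflexivity.
Qed.

Lemma node_interior (j : nat) : (1 <= j <= Nt)%nat -> in_interior x0 x1 (- a) a (node j).
Proof.
  intros [J1 J2]. pose proof a_pos. pose proof (hh_pos beta (proj2 Hbeta)) as Hh.
  apply le_INR in J1. apply le_INR in J2. simpl in J1.
  unfold in_interior, node; simpl. repeat split; try lra.
  - unfold x0. apply Rlt_le_trans with (1 * hh beta); [|apply Rmult_le_compat_r; lra].
    unfold hh. pose proof PI2_3_2. assert (1 < PI ^ 2) by (simpl; nra). nra.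
  - unfold x1, T. rewrite four_TT_sqr by apply Hbeta.
    apply Rle_lt_trans with (INR Nt * hh beta); [apply Rmult_le_compat_r; lra|]. lra.
Qed.

Lemma aden_deriv (u : C) : 0 < Re u -> Cderiv aden u (daden u).
Proof.
  intros Hu.
  apply (Cderiv_mult den (fun v => Csin (phase beta v))); [now apply den_deriv|].
  apply (Cderiv_comp Csin (phase beta)); [apply phase_deriv|apply Csin_deriv].
Qed.

Lemma anum_diff (u : C) : 0 < Re u -> Cdiff anum u.
Proof.
  intros Hu. destruct (num_diff u Hu) as [b Hb].
  destruct (Ccos_diff (phase beta u)) as [c Hc].
  eexists. apply Cderiv_mult; [exact Hb|]. apply Cderiv_scal.
  apply (Cderiv_comp Ccos (phase beta)); [apply phase_deriv|exact Hc].
Qed.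

Definition apoles : list C := pole qa :: pole qb :: map node (seq 1 Nt).

Lemma pole_qa_Im : 0 < Im (pole qa).
Proof.
  destruct qab_bounds as [[A1 A2] _]. destruct P_bounds as [B1 B2]. pose proof PI_RGT_0.
  assert (0 < qa) by nra. unfold pole; simpl. nra.
Qed.

Lemma pole_qb_Im : Im (pole qb) < 0.
Proof.
  destruct qab_bounds as [_ [[A1 A2] _]]. destruct P_bounds as [B1 B2]. pose proof PI_RGT_0.
  assert (qb < 0) by nra. unfold pole; simpl. nra.
Qed.

Lemma NoDup_apoles : NoDup apoles.
Proof.
  pose proof pole_qa_Im as Ha. pose proof pole_qb_Im as Hb.
  assert (Hn : forall u, In u (map node (seq 1 Nt)) -> Im u = 0).
  { intros u Hu. apply in_map_iff in Hu. destruct Hu as [j [<- _]]. reflexivity. }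
  constructor; [|constructor].
  - intros [E|H].
    + rewrite E in Hb. lra.
    + apply Hn in H. lra.
  - intros H. apply Hn in H. lra.
  - apply Injective_map_NoDup; [|apply seq_NoDup].
    intros i j E. unfold node in E. injection E as E.
    pose proof (hh_pos beta (proj2 Hbeta)). apply INR_eq.
    now apply Rmult_eq_reg_r with (hh beta); [|lra].
Qed.

Lemma pole_not_sin (q : R) : q = qa \/ q = qb -> Csin (phase beta (pole q)) <> RtoC 0.
Proof.
  intros Hq E. destruct (pole_interior q Hq) as [I1 I2].
  destruct (Csin_zero_node (pole q)) as [j [_ Hj]]; auto.
  { unfold in_rect. lra. }
  pose proof pole_qa_Im. pose proof pole_qb_Im.
  assert (Im (pole q) = 0) by (rewrite Hj; reflexivity).
  destruct Hq as [-> | ->]; lra.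
Qed.

Lemma node_not_den (j : nat) : (1 <= j <= Nt)%nat -> den (node j) <> RtoC 0.
Proof.
  intros Hj E. destruct (node_interior j Hj) as [I1 I2].
  pose proof pole_qa_Im. pose proof pole_qb_Im.
  destruct (den_zero (node j)) as [F|F]; auto.
  { unfold in_rect. lra. }
  - rewrite <- F in H. unfold node in H. simpl in H. lra.
  - rewrite <- F in H0. unfold node in H0. simpl in H0. lra.
Qed.

Lemma oint_f_cot : oint (fun u => anum u / aden u)%C x0 x1 (- a) a
  = (2 * RtoC PI * Ci * Clsum (fun p => anum p / daden p)%C apoles)%C.
Proof.
  pose proof x0_lt_x1. pose proof a_pos.
  apply residue_theorem; try lra.
  - apply NoDup_apoles.
  - intros u Hu. apply anum_diff. eapply Re_pos_in_rect, Hu.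
  - intros u Hu. apply aden_deriv. eapply Re_pos_in_rect, Hu.
  - intros u Hu Hd. unfold aden in Hd.
    destruct (classic (den u = RtoC 0)) as [E|E].
    + destruct (den_zero u Hu E) as [->| ->]; unfold apoles; simpl; auto.
    + destruct (classic (Csin (phase beta u) = RtoC 0)) as [E2|E2].
      * destruct (Csin_zero_node u Hu E2) as [j [Hj ->]].
        right. right. apply in_map. apply in_seq. lia.
      * exfalso. now apply (Cmult_neq_0 _ _ E E2).
  - assert (Hq : forall q, q = qa \/ q = qb -> in_interior x0 x1 (- a) a (pole q) /\
              aden (pole q) = RtoC 0 /\ daden (pole q) <> RtoC 0).
    { intros q Hq. pose proof (pole_interior q Hq) as Hi.
      split; [exact Hi|]. unfold aden, daden. rewrite den_pole by exact Hq. split; [ring|].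
      rewrite Cmult_0_l, Cplus_0_r. apply Cmult_neq_0; [|now apply pole_not_sin].
      apply dden_neq_0. destruct Hi as [Hi _]. lra. }
    intros p [<-|[<-|Hp]]; [apply Hq; now left|apply Hq; now right|].
    apply in_map_iff in Hp. destruct Hp as [j [<- Hj]]. apply in_seq in Hj.
    assert (Hj' : (1 <= j <= Nt)%nat) by lia.
    split; [now apply node_interior|]. unfold aden, daden. rewrite Csin_node. split; [ring|].
    rewrite Cmult_0_r, Cplus_0_l. apply Cmult_neq_0; [now apply node_not_den|].
    apply Cmult_neq_0; [apply Ccos_node_neq_0|].
    pose proof (hh_pos beta (proj2 Hbeta)). pose proof PI_RGT_0.
    unfold Cdiv. rewrite <- RtoC_inv, <- RtoC_mult by lra. apply RtoC_neq_0.
    apply Rgt_not_eq, Rdiv_lt_0_compat; lra.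
Qed.

Lemma m_cot_eq (u : C) : m_cot beta u = (- (Ci / 2) * (Ccos (phase beta u) / Csin (phase beta u)))%C.
Proof. reflexivity. Qed.

Lemma apole_residue (q : R) : q = qa \/ q = qb ->
  (anum (pole q) / daden (pole q))%C
    = (num (pole q) / dden (pole q) * m_cot beta (pole q))%C.
Proof.
  intros Hq. unfold anum, daden. rewrite den_pole, m_cot_eq by exact Hq.
  pose proof (pole_interior q Hq) as [Hi _]. pose proof x0_lt_x1.
  pose proof (dden_neq_0 (pole q) ltac:(lra)). pose proof (pole_not_sin q Hq).
  rewrite Cmult_0_l, Cplus_0_r. field. auto.
Qed.

(** The cotangent of the phase has residue [h / PI] at a node, and
    [2 * PI * i * (- i / 2) * (h / PI) = h]. *)
Lemma node_residue (j : nat) : (1 <= j <= Nt)%nat ->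
  (2 * RtoC PI * Ci * (anum (node j) / daden (node j)))%C
    = (RtoC (hh beta) * (num (node j) / den (node j)))%C.
Proof.
  intros Hj. unfold anum, daden. rewrite Csin_node.
  pose proof (node_not_den j Hj). pose proof (Ccos_node_neq_0 j).
  pose proof (hh_pos beta (proj2 Hbeta)). pose proof PI_RGT_0.
  assert (RtoC PI <> RtoC 0) by (apply RtoC_neq_0; lra).
  assert (RtoC (hh beta) <> RtoC 0) by (apply RtoC_neq_0; lra).
  rewrite Cmult_0_r, Cplus_0_l.
  transitivity (- (Ci * Ci) * (RtoC (hh beta) * (num (node j) / den (node j))))%C.
  - field. auto.
  - rewrite Ci_sqr. ring.
Qed.

Lemma Clsum_app (F : C -> C) (l m : list C) : Clsum F (l ++ m) = (Clsum F l + Clsum F m)%C.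
Proof. induction l as [|p l IH]; simpl; [ring|rewrite IH; ring]. Qed.

Lemma Clsum_nodes (F : C -> C) (n : nat) :
  Clsum F (map node (seq 1 n)) = csum (fun j => F (node j)) n.
Proof.
  induction n as [|n IH]; [reflexivity|].
  rewrite seq_S, map_app, Clsum_app, IH. simpl. ring.
Qed.

Lemma csum_scal_ext (c d : C) (F G : nat -> C) (n : nat) :
  (forall j, (1 <= j <= n)%nat -> (c * F j = d * G j)%C) ->
  (c * csum F n = d * csum G n)%C.
Proof.
  induction n as [|n IH]; intros H; simpl; [ring|].
  rewrite !Cmult_plus_distr_l, IH, (H (S n)); auto; try lia.
  intros j Hj. apply H. lia.
Qed.

Lemma r_t_nodes :
  r_t beta Nt z = (RtoC (hh beta) * csum (fun j => num (node j) / den (node j))%C Nt)%C.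
Proof.
  unfold r_t. apply csum_scal_ext. intros j Hj. unfold num, den, node.
  pose proof (hh_pos beta (proj2 Hbeta)). pose proof (pos_INR j).
  rewrite Csqrt_RtoC by nra.
  assert (Hs : sqrt (INR j * hh beta) <> 0).
  { apply Rgt_not_eq, sqrt_lt_R0, Rmult_lt_0_compat; auto. apply lt_0_INR. lia. }
  rewrite <- RtoC_minus, <- RtoC_mult, !Cexp_RtoC.
  rewrite RtoC_inv by exact Hs.
  fold T. unfold T, TT.
  replace (2 * (sqrt (INR j * hh beta) - sqrt (INR Nt * hh beta / 4)))
    with (2 * sqrt (INR j * hh beta) - 2 * sqrt (INR Nt * hh beta / 4)) by ring.
  unfold Cdiv. ring.
Qed.

(** * The contour integral in closed form and the size of its pole terms *)

Definition rho (q : R) : C := (num (pole q) / dden (pole q))%C.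

(** Each pole enters twice: through [f] on its own half rectangle, with weight 1/2 or -1/2, and
    through the subtracted [f m], with weight [m]. Together these weights are [delta] at the pole;
    the nodes give [r_t]. *)
Lemma Gamma_int_eq :
  Gamma_int beta Nt r (fun u => f_uz beta Nt u z * delta beta u)%C =
    (CInt (fun x => f_uz beta Nt (x, 0%R) z) x0 x1 - r_t beta Nt z
     + 2 * RtoC PI * Ci * (rho qb * (RtoC (1 / 2) - m_cot beta (pole qb))
                           + rho qa * (RtoC (- 1 / 2) - m_cot beta (pole qa))))%C.
Proof.
  pose proof x0_lt_x1. pose proof a_pos.
  assert (Hedge : forall u, on_edge x0 x1 (- a) a u ->
            den u <> RtoC 0 /\ Csin (phase beta u) <> RtoC 0).
  { intros u [Hu Hu2]. split; intros E.
    - destruct (den_zero u Hu E) as [E2|E2]; subst u.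
      + destruct (pole_interior qa (or_introl eq_refl)). lra.
      + destruct (pole_interior qb (or_intror eq_refl)). lra.
    - destruct (Csin_zero_node u Hu E) as [j [Hj ->]].
      destruct (node_interior j Hj). lra. }
  unfold Gamma_int. fold T. fold P. fold x0. fold x1. fold a.
  rewrite (rect_int_jump (fun u => num u / den u)%C (fun u => f_uz beta Nt u z * m_cot beta u)%C);
    try lra.
  - rewrite oint_f_lower, oint_f_upper.
    rewrite (oint_ext x0 x1 (- a) a ltac:(lra) ltac:(lra)
               (fun u => f_uz beta Nt u z * m_cot beta u)%C (fun u => anum u / aden u)%C).
    + rewrite oint_f_cot. unfold apoles. simpl Clsum.
      change (fold_right (fun p s => anum p / daden p + s)%C (RtoC 0) (map node (seq 1 Nt)))
        with (Clsum (fun p => anum p / daden p)%C (map node (seq 1 Nt))).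
      rewrite !apole_residue by auto. fold (rho qa) (rho qb).
      rewrite r_t_nodes.
      rewrite <- (csum_scal_ext (2 * RtoC PI * Ci) (RtoC (hh beta))
                    (fun j => anum (node j) / daden (node j))%C) by (intros; now apply node_residue).
      rewrite Clsum_nodes. change (fun x : R => f_uz beta Nt (x, 0%R) z) with
        (fun x : R => num (x, 0%R) / den (x, 0%R))%C.
      ring.
    + intros u Hu. destruct (Hedge u Hu) as [E1 E2].
      rewrite f_uz_eq, m_cot_eq. unfold anum, aden. field. auto.
  - intros u Hu. destruct (Hedge u Hu) as [E1 E2].
    assert (Hre : 0 < Re u) by (eapply Re_pos_in_rect, Hu).
    apply Cdiff_cont, Cdiff_div; auto using num_diff.
    eexists; now apply den_deriv.
  - intros u Hu. destruct (Hedge u Hu) as [E1 E2].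
    assert (Hre : 0 < Re u) by (eapply Re_pos_in_rect, Hu).
    apply Ccont_mult.
    + apply (Cdiff_cont (fun u => num u / den u)%C), Cdiff_div; auto using num_diff.
      eexists; now apply den_deriv.
    + apply Ccont_mult; [apply Ccont_const|].
      destruct (Ccos_diff (phase beta u)) as [c Hc].
      apply (Cdiff_cont (fun u => Ccos (phase beta u) / Csin (phase beta u))%C), Cdiff_div; auto.
      * eexists. apply (Cderiv_comp Ccos (phase beta)); [apply phase_deriv|exact Hc].
      * eexists. apply (Cderiv_comp Csin (phase beta)); [apply phase_deriv|apply Csin_deriv].
  - intros u Hu. rewrite f_uz_eq. unfold delta, mu.
    destruct (Rle_dec 0 (Im u)) as [_|F]; [ring|lra].
  - intros u Hu. rewrite f_uz_eq. unfold delta, mu.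
    destruct (Rle_dec 0 (Im u)) as [F|_]; [lra|ring].
Qed.

Lemma Cmod_rho (q : R) : q = qa \/ q = qb -> Cmod (rho q) = exp (ln r / 2) / PI.
Proof.
  intros Hq. pose proof PI_RGT_0. unfold rho. rewrite f_residue by exact Hq.
  rewrite Cmod_opp, Cmod_div by (apply RtoC_neq_0; lra).
  rewrite Cmod_R, Rabs_pos_eq, Cmod_Cexp by lra. reflexivity.
Qed.

(** The dependence on [r] cancels: [sqrt r * exp (- P) = exp (- T)]. *)
Lemma residue_bound (q : R) (w : C) : q = qa \/ q = qb -> Cmod w <= 2 * exp (- P) ->
  Cmod (rho q * w) <= 2 / PI * exp (- T).
Proof.
  intros Hq Hw. pose proof PI_RGT_0.
  rewrite Cmod_mult, Cmod_rho by exact Hq.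
  apply Rle_trans with (exp (ln r / 2) / PI * (2 * exp (- P))).
  - apply Rmult_le_compat_l; [|exact Hw].
    apply Rlt_le, Rdiv_lt_0_compat; [apply exp_pos|lra].
  - replace (- T) with (ln r / 2 + - P) by (unfold P; ring). rewrite exp_plus.
    right. field. lra.
Qed.

Lemma quadrature_error :
  Cmod (CInt (fun x => f_uz beta Nt (x, 0%R) z) x0 x1 - r_t beta Nt z)
    <= Cmod (Gamma_int beta Nt r (fun u => f_uz beta Nt u z * delta beta u)%C)
       + 8 * exp (- T).
Proof.
  rewrite Gamma_int_eq.
  set (I := (CInt (fun x => f_uz beta Nt (x, 0%R) z) x0 x1 - r_t beta Nt z)%C).
  set (wa := (RtoC (- 1 / 2) - m_cot beta (pole qa))%C).
  set (wb := (RtoC (1 / 2) - m_cot beta (pole qb))%C).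
  set (E := (2 * RtoC PI * Ci * (rho qb * wb + rho qa * wa))%C).
  pose proof PI_RGT_0 as Hpi. destruct P_bounds as [B1 B2].
  destruct qab_bounds as [[A1 A2] [[A3 A4] _]].
  pose proof (hh_pos beta (proj2 Hbeta)) as Hh.
  (* At the smallest [q] there is equality: [4 * PI * P * q / h = P] with [q = PI * (2 - beta) / 4]
     is the equation that determines [h]. *)
  assert (Hstep : forall q, PI * (2 - beta) / 4 <= q -> P <= 2 * (PI * (2 * P * q) / hh beta)).
  { intros q Hq. apply Rmult_le_reg_r with (hh beta); [exact Hh|].
    replace (2 * (PI * (2 * P * q) / hh beta) * hh beta) with (4 * (PI * P) * q) by (field; lra).
    apply Rle_trans with (4 * (PI * P) * (PI * (2 - beta) / 4)).
    - unfold hh. right. simpl. field.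
    - apply Rmult_le_compat_l; nra. }
  assert (Ha : Cmod wa <= 2 * exp (- P)).
  { apply m_cot_upper; try lra. replace (Im (pole qa)) with (2 * P * qa)
      by (unfold pole; simpl; ring). now apply Hstep. }
  assert (Hb : Cmod wb <= 2 * exp (- P)).
  { apply m_cot_lower; try lra. replace (- Im (pole qb)) with (2 * P * (- qb))
      by (unfold pole; simpl; ring). apply Hstep. lra. }
  apply residue_bound with (q := qa) in Ha; auto.
  apply residue_bound with (q := qb) in Hb; auto.
  assert (HE : Cmod E <= 8 * exp (- T)).
  { unfold E. rewrite !Cmod_mult, Cmod_Ci, !Cmod_R, (Rabs_pos_eq PI), (Rabs_pos_eq 2) by lra.
    apply Rle_trans with (2 * PI * 1 * (2 / PI * exp (- T) + 2 / PI * exp (- T))).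
    - apply Rmult_le_compat_l; [lra|]. eapply Rle_trans; [apply Cmod_triangle|]. lra.
    - right. field. lra. }
  pose proof (Cmod_triangle (I + E) (- E)) as Ht. rewrite Cmod_opp in Ht.
  replace (I + E + - E)%C with I in Ht by ring. lra.
Qed.

End Contour.

(** * The truncated integral *)

Lemma atan_lip (x y : R) : Rabs (atan x - atan y) <= Rabs (x - y).
Proof.
  assert (H : forall a b, a < b -> Rabs (atan b - atan a) <= Rabs (b - a)).
  { intros a b Hab.
    destruct (MVT_cor2 atan (fun t => / (1 + t ^ 2)) a b Hab) as [c [E _]].
    { intros t _. apply derivable_pt_lim_atan. }
    rewrite E, Rabs_mult. rewrite <- (Rmult_1_l (Rabs (b - a))) at 2.
    apply Rmult_le_compat_r; [apply Rabs_pos|].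
    assert (0 <= c ^ 2) by apply pow2_ge_0.
    rewrite Rabs_pos_eq by (apply Rlt_le, Rinv_0_lt_compat; lra).
    rewrite <- Rinv_1. apply Rinv_le_contravar; lra. }
  destruct (Rtotal_order x y) as [Hxy|[->|Hxy]].
  - rewrite Rabs_minus_sym, (Rabs_minus_sym x). now apply H.
  - rewrite !Rminus_diag. lra.
  - now apply H.
Qed.

Lemma atan_near_PI2 (x : R) : 0 < x -> Rabs (atan x - PI / 2) <= / x.
Proof.
  intros Hx. pose proof (atan_inv x Hx) as E.
  replace (atan x - PI / 2) with (- (atan (/ x) - atan 0)) by (rewrite atan_0, E; ring).
  rewrite Rabs_Ropp. eapply Rle_trans; [apply atan_lip|].
  rewrite Rminus_0_r, Rabs_pos_eq; [lra|]. apply Rlt_le, Rinv_0_lt_compat, Hx.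
Qed.

Lemma ln_diff_bound (m A B : R) : 0 < m -> m <= A -> m <= B ->
  Rabs (ln A - ln B) <= Rabs (A - B) / m.
Proof.
  intros Hm.
  assert (H : forall A B, m <= A -> m <= B -> ln A - ln B <= Rabs (A - B) / m).
  { intros a b Ha Hb. rewrite <- ln_div by lra.
    assert (Hab : 0 < a / b) by (apply Rdiv_lt_0_compat; lra).
    pose proof (exp_ineq1_le (ln (a / b))) as He. rewrite exp_ln in He by exact Hab.
    apply Rle_trans with (Rabs (a - b) / b).
    - apply Rle_trans with ((a - b) / b).
      + replace ((a - b) / b) with (a / b - 1) by (field; lra). lra.
      + apply Rmult_le_compat_r; [apply Rlt_le, Rinv_0_lt_compat; lra|apply Rle_abs].
    - apply Rmult_le_compat_l; [apply Rabs_pos|]. apply Rinv_le_contravar; lra. }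
  intros HA HB. apply Rabs_le. split.
  - pose proof (H B A HB HA). rewrite Rabs_minus_sym in H0. lra.
  - now apply H.
Qed.

(* [zeta / 2 * (theta w, - lam w)] is the primitive of [zeta^2 / (w^2 + zeta^2)]
   vanishing at [0], for [zeta = (c, d)]. *)
Definition theta (c d w : R) : R := atan ((w + d) / c) + atan ((w - d) / c).
Definition lam (c d w : R) : R :=
  (ln ((w + d) ^ 2 + c ^ 2) - ln ((w - d) ^ 2 + c ^ 2)) / 2.
Definition dtheta (c d w : R) : R :=
  c / ((w + d) ^ 2 + c ^ 2) + c / ((w - d) ^ 2 + c ^ 2).
Definition dlam (c d w : R) : R :=
  (w + d) / ((w + d) ^ 2 + c ^ 2) - (w - d) / ((w - d) ^ 2 + c ^ 2).

Lemma sqr_plus_pos (c x : R) : 0 < c -> 0 < x ^ 2 + c ^ 2.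
Proof. intros Hc. pose proof (pow2_ge_0 x). pose proof (pow_lt c 2 Hc). lra. Qed.

Lemma theta_lam_deriv (c d w : R) : 0 < c ->
  is_derive (theta c d) w (dtheta c d w) /\ is_derive (lam c d) w (dlam c d w).
Proof.
  intros Hc. pose proof (sqr_plus_pos c (w + d) Hc) as H1.
  pose proof (sqr_plus_pos c (w - d) Hc) as H2. split.
  - unfold theta, dtheta. auto_derive; [exact I|]. simpl in *. field.
    repeat split; nra.
  - unfold lam, dlam. auto_derive; [simpl in *; lra|]. simpl in *. field.
    repeat split; nra.
Qed.

(** Partial fractions: [dtheta - i dlam] is [2 zeta / (w^2 + zeta^2)], stated here without
    division. *)
Lemma dtheta_dlam (c d w : R) : 0 < c ->
  ((dtheta c d w, (- dlam c d w)%R) * (RtoC (w * w) + (c, d) * (c, d)))%C = (2 * (c, d))%C.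
Proof.
  intros Hc. pose proof (sqr_plus_pos c (w + d) Hc) as H1.
  pose proof (sqr_plus_pos c (w - d) Hc) as H2.
  unfold dtheta, dlam, Cmult, Cplus, RtoC; simpl in *. f_equal; field; repeat split; nra.
Qed.

(** As [|d| <= 1 <= w / 2], both [w + d] and [w - d] are at least [w / 2]: each angle is within
    [2 / w] of [PI / 2], and the two logarithms differ by at most [16 / w]. *)
Lemma upper_end (c d w : R) : 0 < c <= 1 -> Rabs d <= 1 -> 2 <= w ->
  Rabs (theta c d w - PI) + Rabs (lam c d w) <= 12 / w.
Proof.
  intros Hc Hd Hw.
  assert (Hd' : -1 <= d <= 1) by (unfold Rabs in Hd; destruct (Rcase_abs d); lra).
  assert (Hat : forall x, w / 2 <= x -> Rabs (atan (x / c) - PI / 2) <= 2 / w).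
  { intros x Hx. eapply Rle_trans.
    - apply atan_near_PI2. apply Rdiv_lt_0_compat; lra.
    - replace (2 / w) with (/ (w / 2)) by (field; lra). apply Rinv_le_contravar; [lra|].
      apply Rle_trans with (x / 1); [lra|]. apply Rmult_le_compat_l; [lra|].
      apply Rinv_le_contravar; lra. }
  assert (T1 : Rabs (theta c d w - PI) <= 4 / w).
  { unfold theta.
    replace (atan ((w + d) / c) + atan ((w - d) / c) - PI)
      with ((atan ((w + d) / c) - PI / 2) + (atan ((w - d) / c) - PI / 2)) by field.
    eapply Rle_trans; [apply Rabs_triang|].
    pose proof (Hat (w + d) ltac:(lra)). pose proof (Hat (w - d) ltac:(lra)).
    replace (4 / w) with (2 / w + 2 / w) by (field; lra). lra. }
  assert (T2 : Rabs (lam c d w) <= 8 / w).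
  { unfold lam. unfold Rdiv. rewrite Rabs_mult, (Rabs_pos_eq (/ 2)) by lra.
    assert (Hb := ln_diff_bound (w * w / 4) ((w + d) ^ 2 + c ^ 2) ((w - d) ^ 2 + c ^ 2)).
    assert (Rabs ((w + d) ^ 2 + c ^ 2 - ((w - d) ^ 2 + c ^ 2)) <= 4 * w).
    { replace ((w + d) ^ 2 + c ^ 2 - ((w - d) ^ 2 + c ^ 2)) with (4 * w * d) by ring.
      rewrite Rabs_mult, (Rabs_pos_eq (4 * w)) by lra. nra. }
    specialize (Hb ltac:(nra) ltac:(simpl; nra) ltac:(simpl; nra)).
    assert (Rabs ((w + d) ^ 2 + c ^ 2 - ((w - d) ^ 2 + c ^ 2)) / (w * w / 4) <= 16 / w).
    { apply Rle_trans with (4 * w / (w * w / 4)).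
      - apply Rmult_le_compat_r; [|exact H]. apply Rlt_le, Rinv_0_lt_compat. nra.
      - right. field. lra. }
    apply Rmult_le_reg_r with 2; [lra|]. rewrite Rmult_assoc, Rinv_l by lra.
    replace (8 * / w * 2) with (16 / w) by (field; lra). lra. }
  replace (12 / w) with (4 / w + 8 / w) by (field; lra). lra.
Qed.

(** Both quantities vanish at [w = 0] and grow at most linearly. For a root [(c, d)] of [z] the
    coefficients are of size [1 / sqrt r], which the prefactor [sqrt z] of the primitive will
    cancel. *)
Lemma lower_end (c d w : R) : 0 < c -> 0 < w ->
  Rabs (theta c d w) + Rabs (lam c d w) <= 2 * w / c + 2 * w * Rabs d / (c * c).
Proof.
  intros Hc Hw. apply Rplus_le_compat.
  - unfold theta. replace ((w - d) / c) with (- ((d - w) / c)) by (field; lra).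
    rewrite atan_opp. eapply Rle_trans; [apply atan_lip|].
    replace ((w + d) / c - (d - w) / c) with (2 * w / c) by (field; lra).
    rewrite Rabs_pos_eq; [lra|]. apply Rlt_le, Rdiv_lt_0_compat; lra.
  - unfold lam. unfold Rdiv at 1. rewrite Rabs_mult, (Rabs_pos_eq (/ 2)) by lra.
    pose proof (pow2_ge_0 (w + d)). pose proof (pow2_ge_0 (w - d)).
    assert (Hb := ln_diff_bound (c * c) ((w + d) ^ 2 + c ^ 2) ((w - d) ^ 2 + c ^ 2)).
    specialize (Hb ltac:(nra) ltac:(simpl in *; nra) ltac:(simpl in *; nra)).
    replace ((w + d) ^ 2 + c ^ 2 - ((w - d) ^ 2 + c ^ 2)) with (4 * w * d) in Hb by ring.
    rewrite Rabs_mult, (Rabs_pos_eq (4 * w)) in Hb by lra.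
    apply Rmult_le_reg_r with 2; [lra|]. rewrite Rmult_assoc, Rinv_l by lra.
    replace (2 * w * Rabs d / (c * c) * 2) with (4 * w * Rabs d / (c * c)) by (field; lra). lra.
Qed.

(** * The square root on the two rays and the integral of [f] *)

Definition root_re (beta r : R) : R := exp (ln r / 2) * cos (beta * PI / 4).
Definition root_im (beta : R) (s : bool) (r : R) : R :=
  exp (ln r / 2) * (sg s * sin (beta * PI / 4)).

Lemma cos_quarter_pos (beta : R) : 0 <= beta < 2 -> 0 < cos (beta * PI / 4).
Proof. intros H. pose proof PI_RGT_0. apply cos_gt_0; nra. Qed.

Lemma ray_pt_root (beta : R) (s : bool) (r : R) : 0 < r ->
  ray_pt beta s r =
    ((root_re beta r, root_im beta s r) * (root_re beta r, root_im beta s r))%C.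
Proof.
  intros Hr. rewrite ray_pt_eq.
  assert (E : exp (ln r / 2) * exp (ln r / 2) = r).
  { rewrite <- exp_plus. replace (ln r / 2 + ln r / 2) with (ln r) by field. now apply exp_ln. }
  unfold root_re, root_im, Cmult; simpl. set (e := exp (ln r / 2)) in *. rewrite <- E.
  set (t := beta * PI / 4).
  assert (Hc : cos (sg s * beta * PI / 2) = cos (2 * t) /\
               sin (sg s * beta * PI / 2) = sg s * sin (2 * t)).
  { destruct (sg_cases s) as [-> | ->].
    - replace (1 * beta * PI / 2) with (2 * t) by (unfold t; field). split; ring.
    - replace (-1 * beta * PI / 2) with (- (2 * t)) by (unfold t; field).
      rewrite cos_neg, sin_neg. split; ring. }
  destruct Hc as [-> ->]. rewrite cos_2a, sin_2a.
  assert (Hs : sg s * sg s = 1) by (destruct (sg_cases s) as [-> | ->]; ring).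
  f_equal.
  - transitivity (e * e * (cos t * cos t - (sg s * sg s) * (sin t * sin t))); [|ring].
    rewrite Hs. ring.
  - ring.
Qed.

Lemma root_re_pos (beta r : R) : 0 <= beta < 2 -> 0 < root_re beta r.
Proof.
  intros H. apply Rmult_lt_0_compat; [apply exp_pos|now apply cos_quarter_pos].
Qed.

Lemma Csqrt_ray_pt (beta : R) (s : bool) (r : R) : 0 <= beta < 2 -> 0 < r ->
  Csqrt (ray_pt beta s r) = (root_re beta r, root_im beta s r).
Proof.
  intros H Hr. rewrite ray_pt_root by exact Hr. now apply Csqrt_sqr, root_re_pos.
Qed.

Lemma Cmod_root (beta : R) (s : bool) (r : R) :
  Cmod (root_re beta r, root_im beta s r) = exp (ln r / 2).
Proof.
  unfold Cmod, root_re, root_im; simpl. transitivity (sqrt (Rsqr (exp (ln r / 2)))).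
  - f_equal. set (e := exp (ln r / 2)). set (t := beta * PI / 4).
    assert (Hs : sg s * sg s = 1) by (destruct (sg_cases s) as [-> | ->]; ring).
    transitivity (e * e * ((sg s * sg s) * Rsqr (sin t) + Rsqr (cos t))).
    + unfold Rsqr. ring.
    + rewrite Hs, Rmult_1_l, sin2_cos2. unfold Rsqr. ring.
  - apply sqrt_Rsqr. left; apply exp_pos.
Qed.

(** The substitution [w = exp (sqrt x - T)], with [dw = w / (2 sqrt x) dx], turns [f dx] into
    [2 z / PI * dw / (w^2 + z)]. *)
Lemma f_uz_real (beta : R) (Nt : nat) (z : C) (c d x : R) : 0 < c -> 0 < x ->
  z = ((c, d) * (c, d))%C ->
  let w := exp (sqrt x - TT beta Nt) in
  f_uz beta Nt (x, 0) z =
    ((c, d) / RtoC PI * ((dtheta c d w * (w / (2 * sqrt x)))%R,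
                         (- (dlam c d w * (w / (2 * sqrt x))))%R))%C.
Proof.
  intros Hc Hx Hz w. unfold f_uz. change ((x, 0) : C) with (RtoC x).
  rewrite Csqrt_RtoC by lra. rewrite <- RtoC_minus, <- RtoC_mult, !Cexp_RtoC. fold w.
  replace (exp (2 * (sqrt x - TT beta Nt))) with (w * w)
    by (unfold w; rewrite <- exp_plus; f_equal; ring).
  pose proof (dtheta_dlam c d w Hc) as E. rewrite <- Hz in E.
  pose proof (sqrt_lt_R0 x Hx) as Hs. pose proof PI_RGT_0 as Hpi.
  assert (Hcd : ((c, d) : C) <> RtoC 0) by (intros F; injection F; lra).
  assert (H0 : (RtoC (w * w) + z)%C <> RtoC 0).
  { intros F. rewrite F, Cmult_0_r in E. apply Hcd.
    replace ((c, d) : C) with (/ 2 * (2 * (c, d)))%C by field. rewrite <- E. ring. }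
  replace ((dtheta c d w * (w / (2 * sqrt x)))%R, (- (dlam c d w * (w / (2 * sqrt x))))%R)
    with (RtoC (w / (2 * sqrt x)) * (dtheta c d w, (- dlam c d w)%R))%C
    by (unfold Cmult, RtoC; simpl; f_equal; ring).
  replace ((dtheta c d w, (- dlam c d w)%R) : C) with (2 * (c, d) / (RtoC (w * w) + z))%C
    by (rewrite <- E; field; exact H0).
  rewrite RtoC_div, (RtoC_mult 2) by lra. rewrite Hz at 1.
  assert (RtoC PI <> RtoC 0) by (apply RtoC_neq_0; lra).
  assert (RtoC (sqrt x) <> RtoC 0) by (apply RtoC_neq_0; lra).
  field. auto.
Qed.

Lemma CInt_f_uz (beta : R) (Nt : nat) (z : C) (c d x0 x1 : R) : 0 < c -> 0 < x0 <= x1 ->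
  z = ((c, d) * (c, d))%C ->
  let w x := exp (sqrt x - TT beta Nt) in
  CInt (fun x => f_uz beta Nt (x, 0) z) x0 x1 =
    ((c, d) / RtoC PI * ((theta c d (w x1) - theta c d (w x0))%R,
                         (lam c d (w x0) - lam c d (w x1))%R))%C.
Proof.
  intros Hc [Hx0 Hx1] Hz w.
  set (k := fun x => ((dtheta c d (w x) * (w x / (2 * sqrt x)))%R,
                      (- (dlam c d (w x) * (w x / (2 * sqrt x))))%R) : C).
  set (F := fun x => (theta c d (w x), - lam c d (w x)) : C).
  assert (Hw : forall x, 0 < x -> is_derive w x (w x / (2 * sqrt x))).
  { intros x Hx. unfold w. auto_derive; [exact Hx|]. unfold Rminus. field.
    apply Rgt_not_eq, sqrt_lt_R0, Hx. }
  assert (HF : forall x, x0 <= x <= x1 ->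
     is_derive (fun s => Re (F s)) x (Re (k x)) /\
     is_derive (fun s => Im (F s)) x (Im (k x)) /\
     continuous (fun s => Re (k s)) x /\ continuous (fun s => Im (k s)) x).
  { intros x Hx. assert (Hx' : 0 < x) by lra.
    destruct (theta_lam_deriv c d (w x) Hc) as [D1 D2].
    pose proof (sqrt_lt_R0 x Hx') as Hs.
    pose proof (sqr_plus_pos c (w x + d) Hc) as A1.
    pose proof (sqr_plus_pos c (w x - d) Hc) as A2.
    split; [|split; [|split]].
    - simpl. rewrite Rmult_comm. exact (is_derive_comp (theta c d) w x _ _ D1 (Hw x Hx')).
    - simpl. rewrite Rmult_comm.
      exact (is_derive_opp _ _ _ (is_derive_comp (lam c d) w x _ _ D2 (Hw x Hx'))).
    - apply (ex_derive_continuous (fun s => Re (k s))). unfold k, dtheta, w in *. simpl in *. auto_derive.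
      unfold Rminus in *. repeat split; auto; lra.
    - apply (ex_derive_continuous (fun s => Im (k s))). unfold k, dlam, w in *. simpl in *. auto_derive.
      unfold Rminus in *. repeat split; auto; lra. }
  rewrite (CInt_ext _ (fun x => (c, d) / RtoC PI * k x)%C) by
    (auto; intros x Hx; apply (f_uz_real beta Nt z c d x); auto; lra).
  rewrite CInt_scal.
  - f_equal. rewrite (CInt_derive F k x0 x1 Hx1 HF).
    unfold F, Cminus, Cplus, Copp; simpl. f_equal; ring.
  - apply ex_CInt_continuous; [exact Hx1|]. intros t Ht. destruct (HF t Ht) as [_ [_ H]]. exact H.
Qed.

Lemma integral_error (beta : R) (Nt : nat) (s : bool) (r : R) :
  0 <= beta < 2 -> 0 < r <= 1 -> 1 <= TT beta Nt ->
  let kap := cos (beta * PI / 4) in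
  Cmod (CInt (fun x => f_uz beta Nt (x, 0) (ray_pt beta s r))
          (1 - beta / 2) (4 * TT beta Nt ^ 2 + 1 - beta / 2) - Csqrt (ray_pt beta s r))
    <= (12 + 3 * (2 / kap + 2 / (kap * kap))) * exp (- TT beta Nt).
Proof.
  intros Hb Hr HT kap. set (T := TT beta Nt) in *.
  rewrite Csqrt_ray_pt by lra.
  set (c := root_re beta r). set (d := root_im beta s r).
  assert (Hc : 0 < c) by now apply root_re_pos.
  set (x0 := 1 - beta / 2). set (x1 := 4 * T ^ 2 + 1 - beta / 2).
  assert (Hx0 : 0 < x0) by (unfold x0; lra).
  assert (Hx1 : x0 <= x1) by (unfold x0, x1; simpl; nra).
  rewrite (CInt_f_uz beta Nt _ c d) by (auto; apply ray_pt_root; lra).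
  fold T. set (w0 := exp (sqrt x0 - T)). set (w1 := exp (sqrt x1 - T)).
  set (e := exp (ln r / 2)).
  assert (He0 : 0 < e) by apply exp_pos.
  assert (He1 : e <= 1).
  { unfold e. rewrite <- exp_0. destruct (Req_dec (ln r / 2) 0) as [->|Hn]; [lra|].
    left. apply exp_increasing. assert (ln r <= 0) by (rewrite <- ln_1; apply ln_le; lra). lra. }
  assert (Hkap : 0 < kap) by now apply cos_quarter_pos.
  assert (Hkap1 : kap <= 1) by apply COS_bound.
  assert (Hce : c = e * kap) by reflexivity.
  assert (Hm : Cmod (c, d) = e) by apply Cmod_root.
  assert (Hde : Rabs d <= e) by (rewrite <- Hm; apply (im_le_Cmod (c, d))).
  pose proof PI2_3_2 as Hpi.
  pose proof (exp_pos (- T)) as HeT.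
  (* Since [x0 <= 1], [w0] is at most [exp (1 - T)]; the factor 3 bounds [exp 1]. *)
  assert (Hw0 : 0 < w0 <= 3 * exp (- T)).
  { split; [apply exp_pos|]. unfold w0, Rminus. rewrite exp_plus.
    apply Rmult_le_compat_r; [lra|]. apply Rle_trans with (exp 1); [|apply exp_le_3].
    assert (Hs1 : sqrt x0 <= 1) by (rewrite <- sqrt_1; apply sqrt_le_1_alt; unfold x0; lra).
    destruct (Req_dec (sqrt x0) 1) as [->|Hn]; [lra|]. left. apply exp_increasing. lra. }
  (* The right end lies beyond [4 T^2], whose root is [2 T]. *)
  assert (Hw1 : exp T <= w1).
  { unfold w1. assert (Hs : 2 * T <= sqrt x1).
    { rewrite <- (sqrt_Rsqr (2 * T)) by lra. apply sqrt_le_1_alt.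
      unfold Rsqr, x1. simpl. lra. }
    destruct (Req_dec T (sqrt x1 - T)) as [<-|Hn]; [lra|].
    left. apply exp_increasing. lra. }
  assert (HeT2 : 2 <= exp T) by (pose proof (exp_ineq1_le T); lra).
  assert (U := upper_end c d w1 ltac:(nra) ltac:(lra) ltac:(lra)).
  assert (L := lower_end c d w0 Hc (proj1 Hw0)).
  assert (HU : 12 / w1 <= 12 * exp (- T)).
  { rewrite exp_Ropp. apply Rmult_le_compat_l; [lra|]. apply Rinv_le_contravar; lra. }
  set (a1 := theta c d w1) in *. set (a0 := theta c d w0) in *.
  set (l1 := lam c d w1) in *. set (l0 := lam c d w0) in *.
  assert (HpiC : RtoC PI <> RtoC 0) by (apply RtoC_neq_0; lra).
  (* The limit [PI] of [theta] at infinity reproduces [sqrt z]; moved into the bracket, it leaves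
     only the two end errors. *)
  replace ((c, d) / RtoC PI * ((a1 - a0)%R, (l0 - l1)%R) - (c, d))%C
    with ((c, d) / RtoC PI * ((a1 - PI - a0)%R, (l0 - l1)%R))%C.
  2: { replace ((a1 - PI - a0)%R, (l0 - l1)%R) with (((a1 - a0)%R, (l0 - l1)%R) - RtoC PI)%C
         by (unfold Cminus, Cplus, Copp, RtoC; simpl; f_equal; ring).
       field. exact HpiC. }
  rewrite Cmod_mult, Cmod_div, Hm, Cmod_R, (Rabs_pos_eq PI) by (auto; lra).
  assert (HX : Cmod ((a1 - PI - a0)%R, (l0 - l1)%R)
               <= 12 * exp (- T) + (2 * w0 / c + 2 * w0 * Rabs d / (c * c))).
  { eapply Rle_trans; [apply Cmod_le_abs|].
    pose proof (Rabs_triang (a1 - PI) (- a0)). rewrite Rabs_Ropp in H.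
    pose proof (Rabs_triang l0 (- l1)). rewrite Rabs_Ropp in H0.
    unfold Rminus in *. lra. }
  apply Rle_trans with (e * Cmod ((a1 - PI - a0)%R, (l0 - l1)%R)).
  { apply Rmult_le_compat_r; [apply Cmod_ge_0|].
    apply Rmult_le_reg_r with PI; [lra|]. unfold Rdiv.
    rewrite Rmult_assoc, Rinv_l by lra. nra. }
  apply Rle_trans with (e * (12 * exp (- T) + (2 * w0 / c + 2 * w0 * Rabs d / (c * c)))).
  { apply Rmult_le_compat_l; lra. }
  (* With [c = e * kap] and [|d| <= e], the prefactor [e] cancels the inverse powers of [e], which
     makes the bound uniform in [r]; only [kap] remains. *)
  rewrite Hce.
  apply Rle_trans with (12 * exp (- T) + (w0 * (2 / kap) + w0 * (2 / (kap * kap)))).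
  - rewrite !Rmult_plus_distr_l. apply Rplus_le_compat; [|apply Rplus_le_compat].
    + nra.
    + right. field. lra.
    + replace (e * (2 * w0 * Rabs d / (e * kap * (e * kap))))
        with (w0 * (2 / (kap * kap)) * (Rabs d / e)) by (field; lra).
      rewrite <- (Rmult_1_r (w0 * (2 / (kap * kap)))) at 2.
      apply Rmult_le_compat_l.
      * apply Rmult_le_pos; [lra|]. apply Rlt_le, Rdiv_lt_0_compat; nra.
      * apply Rmult_le_reg_r with e; [lra|]. unfold Rdiv.
        rewrite Rmult_assoc, Rinv_l by lra. lra.
  - assert (0 < 2 / kap) by (apply Rdiv_lt_0_compat; lra).
    assert (0 < 2 / (kap * kap)) by (apply Rdiv_lt_0_compat; nra).
    nra.
Qed.

(** * Small arguments *)

Lemma Cmod_csum_inv_sqr (F : nat -> C) (M : R) (n : nat) : 0 <= M ->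
  (forall j, (1 <= j)%nat -> Cmod (F j) <= M / (INR j * INR j)) ->
  Cmod (csum F n) <= 2 * M.
Proof.
  intros HM H. destruct n as [|n]; [simpl; rewrite Cmod_0; lra|].
  (* The sum of [1 / j^2] is compared with a telescoping sum; the subtracted term makes the
     induction close. *)
  apply Rle_trans with (M * (2 - / INR (S n))).
  - induction n as [|n IH].
    + simpl csum. rewrite Cplus_0_l. eapply Rle_trans; [apply H; lia|].
      right. simpl. field.
    + change (csum F (S (S n))) with (csum F (S n) + F (S (S n)))%C.
      eapply Rle_trans; [apply Cmod_triangle|].
      assert (Hn : 0 < INR (S n)) by (apply lt_0_INR; lia).
      specialize (H (S (S n)) ltac:(lia)). rewrite (S_INR (S n)) in *.
      set (x := INR (S n)) in *.
      apply Rle_trans with (M * (2 - / x) + M / ((x + 1) * (x + 1))); [lra|].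
      replace (M * (2 - / x) + M / ((x + 1) * (x + 1)))
        with (M * (2 - / x + / ((x + 1) * (x + 1)))) by (field; lra).
      apply Rmult_le_compat_l; [exact HM|].
      assert (/ ((x + 1) * (x + 1)) <= / (x * (x + 1))) by (apply Rinv_le_contravar; nra).
      replace (/ (x * (x + 1))) with (/ x - / (x + 1)) in H0 by (field; lra). lra.
  - assert (0 < / INR (S n)) by (apply Rinv_0_lt_compat, lt_0_INR; lia). nra.
Qed.

(** From [exp x >= (x / 3) ^ 3]. At [x = sqrt (j h)] the right side is a multiple of [1 / j^2],
    hence summable. *)
Lemma exp_neg_div_bound (x : R) : 0 < x -> / x * exp (- x) <= 27 / ((x * x) * (x * x)).
Proof.
  intros Hx. pose proof (exp_ineq1_le (x / 3)) as H.
  assert (E : exp x = exp (x / 3) * (exp (x / 3) * exp (x / 3)))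
    by (rewrite <- !exp_plus; f_equal; field).
  assert (H3 : x * x * x / 27 <= exp x).
  { rewrite E. set (y := exp (x / 3)) in *. assert (x / 3 <= y) by lra.
    replace (x * x * x / 27) with (x / 3 * (x / 3 * (x / 3))) by field.
    apply Rmult_le_compat; nra. }
  rewrite exp_Ropp.
  replace (27 / (x * x * (x * x))) with (/ x * / (x * x * x / 27)) by (field; lra).
  apply Rmult_le_compat_l; [apply Rlt_le, Rinv_0_lt_compat, Hx|].
  apply Rinv_le_contravar; [|exact H3].
  apply Rdiv_lt_0_compat; [|lra]. apply Rmult_lt_0_compat; nra.
Qed.

(* Rotating by half the argument of [z] moves both summands into a half plane. *)
Lemma Cmod_plus_ray_pt (beta : R) (s : bool) (r t : R) :
  0 <= beta < 2 -> 0 <= r -> 0 <= t ->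
  cos (beta * PI / 4) * t <= Cmod (RtoC t + ray_pt beta s r).
Proof.
  intros Hb Hr Ht. pose proof (cos_quarter_pos beta Hb) as Hk.
  set (al := sg s * (beta * PI / 4)).
  assert (Hal : cos al = cos (beta * PI / 4)).
  { unfold al. destruct (sg_cases s) as [-> | ->].
    - now rewrite Rmult_1_l.
    - replace (-1 * (beta * PI / 4)) with (- (beta * PI / 4)) by ring. apply cos_neg. }
  replace (Cmod (RtoC t + ray_pt beta s r))
    with (Cmod (Cexp (0, - al) * (RtoC t + ray_pt beta s r))).
  - eapply Rle_trans; [|apply re_le_Cmod]. eapply Rle_trans; [|apply Rle_abs].
    rewrite ray_pt_eq. replace (sg s * beta * PI / 2) with (al + al) by (unfold al; field).
    unfold Cexp; simpl. rewrite exp_0, cos_neg, sin_neg, cos_plus, sin_plus, <- Hal.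
    pose proof (sin2_cos2 al) as E. unfold Rsqr in E.
    replace (1 * cos al * (t + r * (cos al * cos al - sin al * sin al))
             - 1 * - sin al * (0 + r * (sin al * cos al + cos al * sin al)))
      with (cos al * t + r * cos al * (sin al * sin al + cos al * cos al)) by ring.
    rewrite E. rewrite <- Hal in Hk. nra.
  - rewrite Cmod_mult, Cmod_Cexp. simpl. rewrite exp_0. ring.
Qed.

Lemma Cmod_ray_pt (beta : R) (s : bool) (r : R) : 0 <= r -> Cmod (ray_pt beta s r) = r.
Proof.
  intros Hr. unfold ray_pt. rewrite Cmod_mult, Cmod_R, Cmod_Cexp, Rabs_pos_eq by exact Hr.
  simpl. rewrite exp_0. ring.
Qed.

(** With denominators of modulus at least [kap * w], the sum is [O (exp T)] uniformly in [Nt]; the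
    factor [r = O (exp (- 2 T))] in front leaves [exp (- T)]. *)
Lemma r_t_small (beta : R) (Nt : nat) (s : bool) (r : R) : 0 <= beta < 2 ->
  0 <= r <= exp (4 + 2 * beta - 2 * TT beta Nt) ->
  let kap := cos (beta * PI / 4) in
  Cmod (r_t beta Nt (ray_pt beta s r))
    <= 54 * exp (4 + 2 * beta) / (hh beta * kap) * exp (- TT beta Nt).
Proof.
  intros Hb Hr kap. pose proof (hh_pos beta (proj2 Hb)) as Hh.
  pose proof (cos_quarter_pos beta Hb) as Hk. fold kap in Hk.
  unfold r_t. change (sqrt (INR Nt * hh beta / 4)) with (TT beta Nt).
  set (T := TT beta Nt) in *. set (h := hh beta) in *.
  pose proof PI2_3_2 as Hpi. assert (HpiC : RtoC PI <> RtoC 0) by (apply RtoC_neq_0; lra).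
  set (M := 27 / (h * h) * (exp T / kap)).
  assert (HM : 0 <= M).
  { apply Rmult_le_pos; apply Rlt_le, Rdiv_lt_0_compat; try nra. apply exp_pos. }
  rewrite Cmod_mult, Cmod_div, Cmod_mult, Cmod_ray_pt, !Cmod_R by (auto; lra).
  rewrite (Rabs_pos_eq h), (Rabs_pos_eq PI) by lra.
  apply Rle_trans with (r * h / PI * (2 * M)).
  - apply Rmult_le_compat_l.
    { apply Rmult_le_pos; [nra|]. apply Rlt_le, Rinv_0_lt_compat; lra. }
    apply Cmod_csum_inv_sqr; [exact HM|]. intros j Hj.
    assert (Hj0 : 1 <= INR j) by (apply (le_INR 1); exact Hj).
    set (x := sqrt (INR j * h)).
    assert (Hx : 0 < x) by (apply sqrt_lt_R0; nra).
    assert (Hxx : x * x = INR j * h) by (apply sqrt_sqrt; nra).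
    set (w := exp (2 * x - 2 * T)).
    assert (Hw : 0 < w) by apply exp_pos.
    pose proof (Cmod_plus_ray_pt beta s r w Hb (proj1 Hr) ltac:(lra)) as Hl. fold kap in Hl.
    assert (Hne : (RtoC w + ray_pt beta s r)%C <> RtoC 0) by (apply Cmod_gt_0; nra).
    rewrite Cmod_mult, Cmod_div, !Cmod_R by exact Hne.
    rewrite (Rabs_pos_eq (/ x)) by (apply Rlt_le, Rinv_0_lt_compat, Hx).
    rewrite Rabs_pos_eq by (left; apply exp_pos).
    apply Rle_trans with (/ x * (exp (x - T) / (kap * w))).
    + apply Rmult_le_compat_l; [apply Rlt_le, Rinv_0_lt_compat, Hx|].
      apply Rmult_le_compat_l; [left; apply exp_pos|]. apply Rinv_le_contravar; nra.
    + assert (E : exp (x - T) = exp (- x) * exp T * w).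
      { unfold w. rewrite <- !exp_plus. f_equal. ring. }
      rewrite E.
      replace (/ x * (exp (- x) * exp T * w / (kap * w)))
        with (/ x * exp (- x) * (exp T / kap)) by (field; lra).
      replace (M / (INR j * INR j)) with (27 / (x * x * (x * x)) * (exp T / kap)).
      * apply Rmult_le_compat_r; [apply Rlt_le, Rdiv_lt_0_compat; [apply exp_pos|lra]|].
        now apply exp_neg_div_bound.
      * rewrite Hxx. unfold M. field. lra.
  - assert (E : exp (4 + 2 * beta - 2 * T) = exp (4 + 2 * beta) * exp (- T) * exp (- T)).
    { rewrite <- !exp_plus. f_equal. ring. }
    assert (E1 : exp T * exp (- T) = 1)
      by (rewrite <- exp_plus; replace (T + - T) with 0 by ring; apply exp_0).
    assert (H54 : 0 < 54 / (h * kap)) by (apply Rdiv_lt_0_compat; nra).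
    pose proof (exp_pos T) as HeT. pose proof (exp_pos (- T)).
    apply Rle_trans with (r * (54 / (h * kap) * exp T) * (/ PI)).
    { right. unfold M. field. lra. }
    apply Rle_trans with (r * (54 / (h * kap) * exp T) * 1).
    { apply Rmult_le_compat_l.
      - apply Rmult_le_pos; [lra|]. apply Rmult_le_pos; lra.
      - rewrite <- Rinv_1. apply Rinv_le_contravar; lra. }
    rewrite Rmult_1_r.
    apply Rle_trans with (exp (4 + 2 * beta) * exp (- T) * exp (- T) * (54 / (h * kap) * exp T)).
    { apply Rmult_le_compat_r; [apply Rmult_le_pos; lra|]. lra. }
    right. replace (exp (4 + 2 * beta) * exp (- T) * exp (- T) * (54 / (h * kap) * exp T))
      with (exp (4 + 2 * beta) * exp (- T) * (54 / (h * kap)) * (exp T * exp (- T))) by ring.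
    rewrite E1. field. lra.
Qed.

Lemma Csqrt_small (beta : R) (s : bool) (r E : R) : 0 <= beta < 2 ->
  0 <= r <= exp (2 * E) -> Cmod (Csqrt (ray_pt beta s r)) <= exp E.
Proof.
  (* At [r = 0] the form of the root through [ln r] breaks down. *)
  intros Hb [Hr0 Hr1]. destruct (Req_dec r 0) as [->|Hn].
  - replace (ray_pt beta s 0) with (RtoC 0) by (unfold ray_pt; ring).
    rewrite Csqrt_RtoC, sqrt_0, Cmod_0 by lra. left; apply exp_pos.
  - rewrite Csqrt_ray_pt, Cmod_root by lra.
    assert (Hl : ln r <= 2 * E) by (rewrite <- (ln_exp (2 * E)); apply ln_le; lra).
    destruct (Req_dec (ln r / 2) E) as [->|Hn2]; [lra|]. left. apply exp_increasing. lra.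
Qed.

(** * The uniform error bound *)

Lemma TT_eq (beta : R) (Nt : nat) : beta < 2 ->
  PI * sqrt ((2 - beta) * INR Nt / 4) = TT beta Nt.
Proof.
  intros Hb. pose proof PI_RGT_0. pose proof (pos_INR Nt). unfold TT, hh.
  replace (INR Nt * ((2 - beta) * PI ^ 2) / 4)
    with ((PI * PI) * ((2 - beta) * INR Nt / 4)) by (simpl; field).
  rewrite sqrt_mult by nra. now rewrite sqrt_square by lra.
Qed.

Theorem theorem5p1 (beta : R) (Hbeta : 0 <= beta < 2) :
  (exists K : R, exists N0 : nat, forall Nt : nat, (N0 <= Nt)%nat ->
     forall (s : bool) (r : R),
       exp (4 + 2 * beta - 2 * TT beta Nt) <= r <= 1 ->
       Cmod (Gamma_int beta Nt r
               (fun u => (f_uz beta Nt u (ray_pt beta s r) * delta beta u)%C))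
         <= K * exp (- TT beta Nt)) ->
  exists C0 : R, exists N1 : nat, forall Nt : nat, (N1 <= Nt)%nat ->
    forall (s : bool) (r : R), 0 <= r <= 1 ->
      Cmod (r_t beta Nt (ray_pt beta s r) - Csqrt (ray_pt beta s r))%C
        <= C0 * exp (- sqrt (INR Nt * hh beta / 4)) /\
      Cmod (r_t beta Nt (ray_pt beta s r) - Csqrt (ray_pt beta s r))%C
        <= C0 * exp (- (PI * sqrt ((2 - beta) * INR Nt / 4))).
Proof.
  intros [K [N0 HK]].
  set (kap := cos (beta * PI / 4)).
  set (C1 := 12 + 3 * (2 / kap + 2 / (kap * kap))).
  set (C2 := 54 * exp (4 + 2 * beta) / (hh beta * kap)).
  assert (Hk : 0 < kap) by now apply cos_quarter_pos.
  pose proof (hh_pos beta (proj2 Hbeta)) as Hh.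
  assert (HC2 : 0 < C2).
  { pose proof (exp_pos (4 + 2 * beta)). apply Rdiv_lt_0_compat; nra. }
  (* The two arguments of [Rmax] belong to the two ranges of [r]. [N0] can be kept, because any [r]
     in the upper range already forces [T >= 2 + beta] through [P_bounds]. *)
  exists (Rmax (K + 8 + C1) (C2 + exp (2 + beta))), N0. intros Nt HN s r Hr.
  rewrite TT_eq by apply Hbeta. fold (TT beta Nt).
  set (T := TT beta Nt). pose proof (exp_pos (- T)) as HeT.
  (* After [TT_eq] the two claimed bounds coincide. *)
  match goal with |- ?A /\ ?A => cut A; [intros HA; now split|] end.
  destruct (Rle_lt_dec (exp (4 + 2 * beta - 2 * TT beta Nt)) r) as [Hbig|Hsmall].
  - apply Rle_trans with ((K + 8 + C1) * exp (- T));
      [|apply Rmult_le_compat_r; [lra|apply Rmax_l]].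
    assert (Hr' : exp (4 + 2 * beta - 2 * TT beta Nt) <= r <= 1) by lra.
    pose proof (P_bounds beta Nt r Hr') as HP.
    pose proof (r_pos beta Nt r Hr') as Hr0.
    pose proof (quadrature_error beta Nt s r Hbeta Hr') as HQ.
    pose proof (HK Nt HN s r Hr') as HG.
    pose proof (integral_error beta Nt s r Hbeta ltac:(lra) ltac:(lra)) as HI.
    cbv zeta in HI. fold kap C1 in HI. fold T in HQ, HG, HI |- *.
    set (J := CInt (fun x => f_uz beta Nt (x, 0) (ray_pt beta s r)) (1 - beta / 2)
                (4 * T ^ 2 + 1 - beta / 2)) in *.
    replace (r_t beta Nt (ray_pt beta s r) - Csqrt (ray_pt beta s r))%C
      with (- (J - r_t beta Nt (ray_pt beta s r)) + (J - Csqrt (ray_pt beta s r)))%C by ring.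
    eapply Rle_trans; [apply Cmod_triangle|]. rewrite Cmod_opp. lra.
  - apply Rle_trans with ((C2 + exp (2 + beta)) * exp (- T));
      [|apply Rmult_le_compat_r; [lra|apply Rmax_r]].
    pose proof (r_t_small beta Nt s r Hbeta ltac:(lra)) as H1. cbv zeta in H1.
    fold kap C2 T in H1.
    pose proof (Csqrt_small beta s r (2 + beta - T) Hbeta) as H2.
    replace (2 * (2 + beta - T)) with (4 + 2 * beta - 2 * T) in H2 by ring.
    specialize (H2 ltac:(unfold T; lra)).
    replace (exp (2 + beta - T)) with (exp (2 + beta) * exp (- T)) in H2
      by (rewrite <- exp_plus; f_equal; ring).
    eapply Rle_trans; [apply Cmod_triangle|]. rewrite Cmod_opp. lra.
Qed.
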